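(* Let $\mu,\lambda\in\mathbb R$ with $\mu>0$ and $2\mu+3\lambda>0$, let $\ell\ge 0$ and $|m|\le \ell$ be integers, and let $\underline{Y_{\ell m}}=(V_{\ell m}\,|\,W_{\ell m}\,|\,X_{\ell m})$ be the $3\times 3$ matrix-valued function on the unit sphere $\mathbb S^2$ whose columns are the vector spherical harmonics $V_{\ell m},W_{\ell m},X_{\ell m}$. Let $\mathcal S$ and $\mathcal V$ be the single layer potential and the single layer boundary operator on $\Gamma=\mathbb S^2$ for the isotropic elasticity operator with Lamé constants $\mu,\lambda$, applied to matrix-valued functions column by column. Then: 1. On $\mathbb S^2$, $(\mathcal V\,\underline{Y_{\ell m}})(x)=\underline{Y_{\ell m}}(x)\,A_{\mathcal V,\ell}$, where $A_{\mathcal V,\ell}$ is the constant diagonal matrix $$A_{\mathcal V,\ell}=\begin{bmatrix}\frac{(3\ell+1)\mu+\ell\lambda}{(2\ell+3)(2\ell+1)\mu(2\mu+\lambda)}&0&0\\ 0&\frac{(3\ell+2)\mu+(\ell+1)\lambda}{(2\ell-1)(2\ell+1)\mu(2\mu+\lambda)}&0\\ 0&0&\frac{1}{\mu(2\ell+1)}\end{bmatrix}.$$ 2. For $0<|x|<1$, $(\mathcal S\,\underline{Y_{\ell m}})(x)=\underline{Y_{\ell m}}\left(\frac{x}{|x|}\right)A^{in}_{\mathcal S,\ell}(x)$, where $$A^{in}_{\mathcal S,\ell}(x)=\begin{bmatrix}\frac{(3\ell+1)\mu+\ell\lambda}{(2\ell+3)(2\ell+1)\mu(2\mu+\lambda)}|x|^{\ell+1}&0&0\\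 \frac{(\ell+1)(\mu+\lambda)}{2(2\ell+1)\mu(2\mu+\lambda)}\left(|x|^{\ell+1}-|x|^{\ell-1}\right)&\frac{(3\ell+2)\mu+(\ell+1)\lambda}{(2\ell-1)(2\ell+1)\mu(2\mu+\lambda)}|x|^{\ell-1}&0\\ 0&0&\frac{1}{(2\ell+1)\mu}|x|^{\ell}\end{bmatrix}.$$ 3. For $|x|>1$, $(\mathcal S\,\underline{Y_{\ell m}})(x)=\underline{Y_{\ell m}}\left(\frac{x}{|x|}\right)A^{out}_{\mathcal S,\ell}(x)$, where $$A^{out}_{\mathcal S,\ell}(x)=\begin{bmatrix}\frac{(3\ell+1)\mu+\ell\lambda}{(2\ell+3)(2\ell+1)\mu(2\mu+\lambda)}|x|^{-\ell-2}&\frac{\ell(\mu+\lambda)}{2(2\ell+1)\mu(2\mu+\lambda)}\left(|x|^{-\ell-2}-|x|^{-\ell}\right)&0\\ 0&\frac{(3\ell+2)\mu+(\ell+1)\lambda}{(2\ell-1)(2\ell+1)\mu(2\mu+\lambda)}|x|^{-\ell}&0\\ 0&0&\frac{1}{(2\ell+1)\mu}|x|^{-\ell-1}\end{bmatrix}.$$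
   Context: Elasticity operator: ${\bf L}u=-\operatorname{div}\big(2\mu e(u)+\lambda\operatorname{Tr}(e(u))\,\mathrm{Id}\big)$ with $e(u)=\frac12(\nabla u+\nabla u^\top)$ for $u$ with values in $\mathbb R^3$. Its fundamental solution is the matrix $G=(G_{ij})$, $$G_{ij}(x)=\frac{1}{8\pi\mu|x|}\left(\frac{\lambda+3\mu}{\lambda+2\mu}\delta_{ij}+\frac{\lambda+\mu}{\lambda+2\mu}\frac{x_ix_j}{|x|^2}\right),\qquad x\in\mathbb R^3\setminus\{0\}.$$ Layer operators on $\Gamma=\mathbb S^2$: for $\phi:\mathbb S^2\to\mathbb R^3$, with $dy$ the surface measure, $$(\mathcal S\phi)(x)=\int_{\mathbb S^2}G(x-y)\phi(y)\,dy\ \ (x\in\mathbb R^3\setminus\mathbb S^2),\qquad (\mathcal V\phi)(x)=\int_{\mathbb S^2}G(x-y)\phi(y)\,dy\ \ (x\in\mathbb S^2).$$ Vector spherical harmonics: $(Y_{\ell m})_{\ell\ge0,|m|\le\ell}$ are the real scalar spherical harmonics (degree $\ell$, order $m$), orthonormal in $L^2(\mathbb S^2)$. $\nabla_{\rm s}$ is the surface (tangential) gradient on $\mathbb S^2$, written as a column vector in $\mathbb R^3$, and $\hat r$ is the radial unit vector, so $\hat r=x$ at $x\in\mathbb S^2$. On $\mathbb S^2$, $$V_{\ell m}=\nabla_{\rm s}Y_{\ell m}-(\ell+1)Y_{\ell m}\hat r,\qquad W_{\ell m}=\nabla_{\rm s}Y_{\ell m}+\ell\,Y_{\ell m}\hat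 r,\qquad X_{\ell m}=\hat r\times\nabla_{\rm s}Y_{\ell m}.$$ In particular $W_{00}=X_{00}=0$. *)

(* Defs.v *)
From HB Require Import structures.
From mathcomp Require Import all_boot all_order all_algebra.
From mathcomp Require Import complex.
From mathcomp Require Import all_classical all_reals all_analysis.

Set Implicit Arguments.
Unset Strict Implicit.
Unset Printing Implicit Defensive.

Import Order.TTheory GRing.Theory Num.Theory.
Import numFieldNormedType.Exports.

Local Open Scope classical_set_scope.
Local Open Scope ring_scope.

Definition vec3 (R : realType) (a b c : R) : 'cV[R]_3 :=
  \col_i [:: a; b; c]`_i.

Definition mx3 (R : realType) (rows : seq (seq R)) : 'M[R]_3 :=
  \matrix_(i, j) (nth [::] rows i)`_j.

Definition cols3 (R : realType) (a b c : 'cV[R]_3) : 'M[R]_3 :=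
  \matrix_(i, j) ([:: a; b; c]`_j) i ord0.

Definition ix : 'I_3 := inord 0.
Definition iy : 'I_3 := inord 1.
Definition iz : 'I_3 := inord 2.

Definition cross (R : realType) (a b : 'cV[R]_3) : 'cV[R]_3 :=
  vec3 (a iy ord0 * b iz ord0 - a iz ord0 * b iy ord0)
       (a iz ord0 * b ix ord0 - a ix ord0 * b iz ord0)
       (a ix ord0 * b iy ord0 - a iy ord0 * b ix ord0).

(* The norm that the library puts on matrices is the sup norm, hence the
   explicit Euclidean norm. *)
Definition enorm (R : realType) (x : 'cV[R]_3) : R :=
  Num.sqrt (\sum_i x i ord0 ^+ 2).

Definition normalize (R : realType) (x : 'cV[R]_3) : 'cV[R]_3 :=
  (enorm x)^-1 *: x.

(* Integral for the surface measure: Lebesgue integral in the polar angle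
   t in [0, pi] and the azimuth p in [0, 2 pi], with area element
   sin t dt dp. *)
Definition sphere_point (R : realType) (t p : R) : 'cV[R]_3 :=
  vec3 (sin t * cos p) (sin t * sin p) (cos t).

Definition sphere_integral (R : realType) (f : 'cV[R]_3 -> R) : R :=
  \int[(@lebesgue_measure R \x @lebesgue_measure R)%E]_(
      a in `[0, pi] `*` `[0, 2 * pi])
    (f (sphere_point a.1 a.2) * sin a.1).

(* Real spherical harmonics.  With P_l the Legendre polynomial (Rodrigues'
   formula) and k = |m|, the usual expression on the unit sphere is
     Y_lm = N_lm (sin t)^k P_l^(k)(cos t) * cos (k p)   if m >= 0,
     Y_lm = N_lm (sin t)^k P_l^(k)(cos t) * sin (k p)   if m < 0,
   without Condon-Shortley phase; here cos t = z and
   (sin t)^k (cos (k p) + i sin (k p)) = (x + i y)^k. *)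
Definition legendre (R : realType) (l : nat) : {poly R} :=
  (2 ^+ l * l`!%:R)^-1 *: (('X ^+ 2 - 1) ^+ l)^`(l).

(* The factor making the family orthonormal in L^2 of the sphere. *)
Definition sph_norm (R : realType) (l : nat) (m : int) : R :=
  Num.sqrt ((if m == 0 then 1 else 2) * (2 * l%:R + 1) / (4 * pi)
            * (l - `|m|)`!%:R / (l + `|m|)`!%:R).

Definition sph_harm (R : realType) (l : nat) (m : int) (x : 'cV[R]_3) : R :=
  let w := (Complex (x ix ord0) (x iy ord0)) ^+ `|m|%N in
  sph_norm R l m * ((legendre R l)^`(`|m|%N)).[x iz ord0]
  * (if 0 <= m then complex.Re w else complex.Im w).

(* The surface gradient is the Euclidean gradient of the extension of f that
   is constant along rays; it depends on f only through its values on the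
   sphere, and is tangential there. *)
Definition surf_grad (R : realType) (f : 'cV[R]_3 -> R) (x : 'cV[R]_3) :
    'cV[R]_3 :=
  \col_i 'D_(delta_mx i ord0) (fun y => f (normalize y)) x.

(* Vector spherical harmonics at points of the unit sphere, where the radial
   unit vector at x is x itself. *)
Definition Vsph (R : realType) (l : nat) (m : int) (x : 'cV[R]_3) : 'cV[R]_3 :=
  surf_grad (sph_harm l m) x - ((l%:R + 1) * sph_harm l m x) *: x.

Definition Wsph (R : realType) (l : nat) (m : int) (x : 'cV[R]_3) : 'cV[R]_3 :=
  surf_grad (sph_harm l m) x + (l%:R * sph_harm l m x) *: x.

Definition Xsph (R : realType) (l : nat) (m : int) (x : 'cV[R]_3) : 'cV[R]_3 :=
  cross x (surf_grad (sph_harm l m) x).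

Definition Ysph (R : realType) (l : nat) (m : int) (x : 'cV[R]_3) : 'M[R]_3 :=
  cols3 (Vsph l m x) (Wsph l m x) (Xsph l m x).

(* Kelvin's fundamental solution of the elasticity operator
   - div (2 mu e(u) + lambda Tr(e(u)) Id). *)
Definition kelvin (R : realType) (mu lambda : R) (x : 'cV[R]_3) : 'M[R]_3 :=
  \matrix_(i, j)
    ((8 * pi * mu * enorm x)^-1 *
     ((lambda + 3 * mu) / (lambda + 2 * mu) * (i == j)%:R
      + (lambda + mu) / (lambda + 2 * mu)
        * (x i ord0 * x j ord0 / enorm x ^+ 2))).

Definition layer_integral (R : realType) (mu lambda : R)
    (phi : 'cV[R]_3 -> 'cV[R]_3) (x : 'cV[R]_3) : 'cV[R]_3 :=
  \col_i sphere_integral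
    (fun y => (kelvin mu lambda (x - y) *m phi y) i ord0).

(* The two operators are given by one and the same integral; [slp] is meant
   for x off the unit sphere and [slbo] for x on it, where the kernel has an
   integrable singularity at y = x (the value 0 that [kelvin] takes at the
   origin is immaterial). *)
Definition slp (R : realType) (mu lambda : R) (phi : 'cV[R]_3 -> 'cV[R]_3) :
    'cV[R]_3 -> 'cV[R]_3 := layer_integral mu lambda phi.

Definition slbo (R : realType) (mu lambda : R) (phi : 'cV[R]_3 -> 'cV[R]_3) :
    'cV[R]_3 -> 'cV[R]_3 := layer_integral mu lambda phi.

Definition columnwise (R : realType)
    (T : ('cV[R]_3 -> 'cV[R]_3) -> 'cV[R]_3 -> 'cV[R]_3)
    (Phi : 'cV[R]_3 -> 'M[R]_3) (x : 'cV[R]_3) : 'M[R]_3 :=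
  \matrix_(i, j) T (fun y => col j (Phi y)) x i ord0.

Definition A_slbo (R : realType) (mu lambda : R) (l : nat) : 'M[R]_3 :=
  let L : R := l%:R in
  mx3 [:: [:: ((3 * L + 1) * mu + L * lambda)
              / ((2 * L + 3) * (2 * L + 1) * mu * (2 * mu + lambda)); 0; 0];
          [:: 0; ((3 * L + 2) * mu + (L + 1) * lambda)
                 / ((2 * L - 1) * (2 * L + 1) * mu * (2 * mu + lambda)); 0];
          [:: 0; 0; 1 / (mu * (2 * L + 1))]].

Definition A_slp_in (R : realType) (mu lambda : R) (l : nat) (x : 'cV[R]_3) :
    'M[R]_3 :=
  let L : R := l%:R in
  let r := enorm x in
  mx3 [:: [:: ((3 * L + 1) * mu + L * lambda)
              / ((2 * L + 3) * (2 * L + 1) * mu * (2 * mu + lambda))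
              * r ^ (l%:Z + 1);
              0;
              0];
          [:: (L + 1) * (mu + lambda)
              / (2 * (2 * L + 1) * mu * (2 * mu + lambda))
              * (r ^ (l%:Z + 1) - r ^ (l%:Z - 1));
              ((3 * L + 2) * mu + (L + 1) * lambda)
              / ((2 * L - 1) * (2 * L + 1) * mu * (2 * mu + lambda))
              * r ^ (l%:Z - 1);
              0];
          [:: 0;
              0;
              1 / ((2 * L + 1) * mu) * r ^ l%:Z]].

Definition A_slp_out (R : realType) (mu lambda : R) (l : nat) (x : 'cV[R]_3) :
    'M[R]_3 :=
  let L : R := l%:R in
  let r := enorm x in
  mx3 [:: [:: ((3 * L + 1) * mu + L * lambda)
              / ((2 * L + 3) * (2 * L + 1) * mu * (2 * mu + lambda))
              * r ^ (- l%:Z - 2);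
              L * (mu + lambda)
              / (2 * (2 * L + 1) * mu * (2 * mu + lambda))
              * (r ^ (- l%:Z - 2) - r ^ (- l%:Z));
              0];
          [:: 0;
              ((3 * L + 2) * mu + (L + 1) * lambda)
              / ((2 * L - 1) * (2 * L + 1) * mu * (2 * mu + lambda))
              * r ^ (- l%:Z);
              0];
          [:: 0;
              0;
              1 / ((2 * L + 1) * mu) * r ^ (- l%:Z - 1)]].

(* Main.v *)
From HB Require Import structures.
From mathcomp Require Import all_boot all_order all_algebra.
From mathcomp Require Import complex ring lra.
From mathcomp Require Import all_classical all_reals all_analysis measurable_realfun.
Require Import Defs.

Set Implicit Arguments.
Unset Strict Implicit.
Unset Printing Implicit Defensive.

Import Order.TTheory GRing.Theory Num.Theory.
Import numFieldNormedType.Exports.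

Local Open Scope classical_set_scope.
Local Open Scope ring_scope.

(** On the sphere the three components of V, W and X are polynomials, and they
    restrict to spherical harmonics of degree l + 1, l - 1 and l, while the
    radial component of each of the three fields is a multiple of Y. The
    theorem thus reduces to two scalar facts.

    The first expresses the Kelvin integral through Newtonian potentials.
    Off the sphere put [Psi x] = int (x - y).phi(y) / |x - y| dy. Differentiating
    under the integral sign, d_i [Psi x] is the Newtonian potential of phi_i
    minus the integral of (x - y)_i (x - y).phi(y) / |x - y|^3, and the latter
    integral is the second half of the Kelvin kernel ([layer_off],
    [double_kernel_off]). On the other hand [Psi x] is x.N(phi) - N(y.phi), where
    N denotes the Newtonian potential of each component ([Psi_off]). Hence N of
    the components of phi and of y.phi determines the layer potential.

    The second fact is that for a spherical polynomial P of degree n, N(P) at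
    r w is 4 pi / (2 n + 1) P(w) times r^n for r < 1 and times r^(-n-1) for
    r > 1 ([newton_potential_in], [newton_potential_out]). It needs neither
    the addition theorem nor Legendre expansions. The rotation generators
    x_j d_k - x_k d_j integrate to zero over the sphere ([rotation_integral]), so
    their sum of squares, the Casimir operator, is symmetric
    ([casimir_by_parts]). It acts on P as the scalar - n (n + 1), and on the kernel
    1 / |r w - y|, which is harmonic, as - D (D + 1) with D = r d/dr. Therefore
    F(r) = N(P)(r w) is annihilated by (D + n + 1) (D - n); being bounded near
    r = 0 it satisfies D F = n F, that is F(r) = c r^n. Applying 2 D + 1 to the
    Newton kernel gives the Poisson kernel, an approximate identity as r -> 1,
    so that (2 n + 1) c = 4 pi P(w) ([poisson_error]); the case n = 0 provides the
    mass of the kernels that this limit uses. The exterior follows by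
    inversion, since |r w - y| = r |w / r - y| for unit w and y.

    On the sphere itself the kernel is singular. Along the ray through x the
    integrands are dominated by a multiple of 1 / |x - y|, which is integrable
    by Fatou's lemma and the interior values at n = 0 ([newton1_integrable]). The
    layer potential is then continuous along the ray ([layer_continuous]), and
    its boundary value is the limit of the interior formula ([layer_boundary]). *)

(** * Coordinates *)

Lemma ord3P (i : 'I_3) : [\/ i = ix, i = iy | i = iz].
Proof.
case: i => -[|[|[|//]]] hi; [constructor 1|constructor 2|constructor 3];
  by apply/val_inj; rewrite /= inordK.
Qed.

Lemma val_ix : val ix = 0%N. Proof. by rewrite /= inordK. Qed.
Lemma val_iy : val iy = 1%N. Proof. by rewrite /= inordK. Qed.
Lemma val_iz : val iz = 2%N. Proof. by rewrite /= inordK. Qed.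

Lemma sum3 (V : nmodType) (F : 'I_3 -> V) : \sum_i F i = F ix + F iy + F iz.
Proof.
rewrite !big_ord_recl big_ord0 addr0 addrA; congr (F _ + F _ + F _);
  by apply/val_inj; rewrite /= inordK.
Qed.

Lemma eq3E : (((ix == iy) = false) * ((ix == iz) = false) *
  ((iy == ix) = false) * ((iy == iz) = false) * ((iz == ix) = false) *
  ((iz == iy) = false))%type.
Proof. by do !split; rewrite -val_eqE /= !inordK. Qed.

Section coordinates.
Variable R : realType.
Implicit Types x y w : 'cV[R]_3.

Lemma vec3E (a b c : R) : ((vec3 a b c ix ord0 = a) *
  (vec3 a b c iy ord0 = b) * (vec3 a b c iz ord0 = c))%type.
Proof. by rewrite !mxE val_ix val_iy val_iz. Qed.

Definition dot x y : R := \sum_i x i ord0 * y i ord0.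

Lemma dotE x y : dot x y =
  x ix ord0 * y ix ord0 + x iy ord0 * y iy ord0 + x iz ord0 * y iz ord0.
Proof. by rewrite /dot sum3. Qed.

Lemma enormE x : enorm x = Num.sqrt (dot x x).
Proof. by rewrite /enorm; congr Num.sqrt; apply: eq_bigr => i _; rewrite expr2. Qed.

Lemma dot_ge0 x : 0 <= dot x x.
Proof. by rewrite dotE !addr_ge0// -expr2 sqr_ge0. Qed.

Lemma enorm_sqr x : enorm x ^+ 2 = dot x x.
Proof. by rewrite enormE sqr_sqrtr// dot_ge0. Qed.

Lemma enorm_ge0 x : 0 <= enorm x.
Proof. by rewrite enormE sqrtr_ge0. Qed.

Lemma dot_sphere x : enorm x = 1 -> dot x x = 1.
Proof. by rewrite -enorm_sqr => ->; rewrite expr1n. Qed.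

Lemma enorm1 x : dot x x = 1 -> enorm x = 1.
Proof. by rewrite enormE => ->; rewrite sqrtr1. Qed.

Lemma coord_sqr_le x i : x i ord0 ^+ 2 <= dot x x.
Proof.
rewrite dotE; have := (sqr_ge0 (x ix ord0), sqr_ge0 (x iy ord0), sqr_ge0 (x iz ord0)).
move=> [[]]; have [->|->|->] := ord3P i; lra.
Qed.

Lemma coord_le1 x i : dot x x = 1 -> `|x i ord0| <= 1.
Proof.
by move=> h; rewrite -(@expr_le1 _ 2)// real_normK ?num_real// -h coord_sqr_le.
Qed.

Lemma cauchy_schwarz x y : dot x y ^+ 2 <= dot x x * dot y y.
Proof.
rewrite !dotE -subr_ge0.
set a := x ix ord0; set b := x iy ord0; set c := x iz ord0.
set d := y ix ord0; set e := y iy ord0; set f := y iz ord0.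
suff -> : (a * a + b * b + c * c) * (d * d + e * e + f * f) -
  (a * d + b * e + c * f) ^+ 2 =
  (a * e - b * d) ^+ 2 + (a * f - c * d) ^+ 2 + (b * f - c * e) ^+ 2.
  by rewrite !addr_ge0 ?sqr_ge0.
ring.
Qed.

Lemma dot_le1 x y : dot x x = 1 -> dot y y = 1 -> -1 <= dot x y <= 1.
Proof.
move=> hx hy; rewrite -ler_norml -(@expr_le1 _ 2)// real_normK ?num_real//.
by have := cauchy_schwarz x y; rewrite hx hy mulr1.
Qed.

Lemma dot_normalize x : 0 < enorm x -> dot (normalize x) (normalize x) = 1.
Proof.
move=> h; rewrite /normalize /dot.
under eq_bigr do rewrite !mxE mulrACA.
by rewrite -mulr_sumr -/(dot x x) -enorm_sqr -expr2 -exprMn mulVf ?expr1n// gt_eqF.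
Qed.

Lemma scale_normalize x : 0 < enorm x -> x = enorm x *: normalize x.
Proof. by move=> h; rewrite /normalize scalerA mulfV ?scale1r// gt_eqF. Qed.

Lemma enormZ (r : R) x : 0 <= r -> enorm (r *: x) = r * enorm x.
Proof.
move=> r0; rewrite !enormE /dot.
under eq_bigr do rewrite !mxE mulrACA.
by rewrite -mulr_sumr sqrtrM -expr2 ?sqr_ge0// sqrtr_sqr ger0_norm.
Qed.

Lemma enormZ1 (r : R) w : 0 <= r -> dot w w = 1 -> enorm (r *: w) = r.
Proof. by move=> r0 w1; rewrite enormZ// enorm1// mulr1. Qed.

Lemma normalizeZ (r : R) w : 0 < r -> dot w w = 1 -> normalize (r *: w) = w.
Proof.
move=> r0 w1; rewrite /normalize enormZ1 ?(ltW r0)// scalerA mulVf ?scale1r//.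
by rewrite gt_eqF.
Qed.

Lemma dot_sphere_point (t p : R) : dot (sphere_point t p) (sphere_point t p) = 1.
Proof.
rewrite dotE !vec3E -[RHS](cos2Dsin2 t).
have := cos2Dsin2 p; set c := cos p; set s := sin p => h.
transitivity (sin t ^+ 2 * (c ^+ 2 + s ^+ 2) + cos t ^+ 2); first by ring.
by rewrite h; ring.
Qed.

End coordinates.

(** * Derivatives of real functions, in pointwise form *)

Section derivatives.
Variable R : realType.
Implicit Types (f g : R -> R) (t a b : R).

Lemma derD f g t a b : is_derive t 1 f a -> is_derive t 1 g b ->
  is_derive t 1 (fun s => f s + g s) (a + b).
Proof. exact: is_deriveD. Qed.

Lemma derB f g t a b : is_derive t 1 f a -> is_derive t 1 g b ->
  is_derive t 1 (fun s => f s - g s) (a - b).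
Proof. exact: is_deriveB. Qed.

Lemma derN f t a : is_derive t 1 f a -> is_derive t 1 (fun s => - f s) (- a).
Proof. exact: is_deriveN. Qed.

Lemma derM f g t a b : is_derive t 1 f a -> is_derive t 1 g b ->
  is_derive t 1 (fun s => f s * g s) (a * g t + f t * b).
Proof.
move=> hf hg; have h := is_deriveM hf hg.
by apply: (is_derive_eq h); rewrite addrC; congr (_ + _); rewrite /GRing.scale /= mulrC.
Qed.

Lemma dercst (c t : R) : is_derive t 1 (fun _ => c) 0.
Proof. exact: is_derive_cst. Qed.

Lemma derid t : is_derive t 1 (fun s => s) 1.
Proof. exact: is_derive_id. Qed.

Lemma derZ f (c t a : R) : is_derive t 1 f a -> is_derive t 1 (fun s => c * f s) (c * a).
Proof. exact: is_deriveZ. Qed.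

Lemma derX f n t a : is_derive t 1 f a ->
  is_derive t 1 (fun s => f s ^+ n) (n%:R * f t ^+ n.-1 * a).
Proof.
move=> hf; rewrite (_ : (fun s => _) = f ^+ n); first exact: is_deriveX.
by rewrite exprfctE.
Qed.

Lemma dercomp f g t a b : is_derive (g t) 1 f a -> is_derive t 1 g b ->
  is_derive t 1 (fun s => f (g s)) (a * b).
Proof. exact: is_derive1_comp. Qed.

Lemma derV f t a : f t != 0 -> is_derive t 1 f a ->
  is_derive t 1 (fun s => (f s)^-1) (- (f t) ^- 2 * a).
Proof. exact: is_deriveV. Qed.

Lemma der_cont f t a : is_derive t 1 f a -> {for t, continuous f}.
Proof. by move=> [h _]; apply: differentiable_continuous; exact/derivable1_diffP. Qed.

Lemma der_unique f t a b : is_derive t 1 f a -> is_derive t 1 f b -> a = b.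
Proof. by move=> [_ <-] [_ <-]. Qed.

(** Written with the cube, so that the iterated derivatives of an inverse
    distance stay polynomials in it. *)
Lemma der_rsqrt f t a : 0 < f t -> is_derive t 1 f a ->
  is_derive t 1 (fun s => (Num.sqrt (f s))^-1) (- (a / 2) * (Num.sqrt (f t))^-1 ^+ 3).
Proof.
move=> f0 hf.
have s0 : Num.sqrt (f t) != 0 by rewrite gt_eqF// sqrtr_gt0.
apply: is_derive_eq; first exact: (@derV (fun s => Num.sqrt (f s)) t _ s0 (dercomp (is_derive1_sqrt f0) hf)).
by rewrite /=; field.
Qed.

Lemma der0_const f (a b : R) : a <= b -> {within `[a, b], continuous f} ->
  (forall t, a < t < b -> is_derive t 1 f 0) -> f a = f b.
Proof.
move=> ab cf df.
have df0 t : t \in `]a, b[ -> is_derive t 1 f 0 by rewrite in_itv; exact: df.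
have [c _] := @MVT_segment R f (fun=> 0) a b ab df0 cf.
by rewrite mul0r => /eqP; rewrite subr_eq0 => /eqP.
Qed.

End derivatives.

(** * Polynomial functions on space and the rotation generators *)

Section polynomials.
Variable R : realType.
Implicit Types (y w : 'cV[R]_3) (i j k : 'I_3).

(** Polynomials in the three coordinates are kept as syntax, so that partial
    derivatives can be iterated by structural recursion; only their values
    matter. *)
Inductive pol := Cst of R | Var of 'I_3 | Add of pol & pol | Mul of pol & pol.

Fixpoint eval (P : pol) y : R :=
  match P with
  | Cst c => c
  | Var i => y i ord0
  | Add P Q => eval P y + eval Q y
  | Mul P Q => eval P y * eval Q y
  end.

Fixpoint pd k (P : pol) : pol :=
  match P with
  | Cst _ => Cst 0
  | Var i => Cst (i == k)%:R
  | Add P Q => Add (pd k P) (pd k Q)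
  | Mul P Q => Add (Mul (pd k P) Q) (Mul P (pd k Q))
  end.

Lemma eval_curve (P : pol) (c dc : R -> 'cV[R]_3) (t : R) :
  (forall i, is_derive t 1 (fun s => c s i ord0) (dc t i ord0)) ->
  is_derive t 1 (fun s => eval P (c s)) (\sum_i eval (pd i P) (c t) * dc t i ord0).
Proof.
move=> hc; rewrite sum3.
elim: P => [a|i|P hP Q hQ|P hP Q hQ] /=.
- by rewrite !mul0r !addr0; exact: dercst.
- apply: (is_derive_eq (hc i)).
  by have [->|->|->] := ord3P i; rewrite !eqxx ?eq3E /=; ring.
- by apply: (is_derive_eq (derD hP hQ)); ring.
- by apply: (is_derive_eq (derM hP hQ)); ring.
Qed.

Definition axis_line k y (h : R) : 'cV[R]_3 := y + h *: delta_mx k ord0.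

Lemma axis_lineE k y h i : axis_line k y h i ord0 = y i ord0 + h * (i == k)%:R.
Proof. by rewrite !mxE eqxx andbT. Qed.

Lemma axis_line_der k y (t : R) i :
  is_derive t 1 (fun h => axis_line k y h i ord0) ((delta_mx k ord0 : 'cV[R]_3) i ord0).
Proof.
under eq_fun do rewrite axis_lineE.
rewrite !mxE eqxx andbT.
apply: (is_derive_eq (derD (dercst _ _) (derM (derid _) (dercst _ _)))); ring.
Qed.

Lemma sum3_delta k (F : 'I_3 -> R) :
  \sum_i F i * (delta_mx k ord0 : 'cV[R]_3) i ord0 = F k.
Proof.
rewrite sum3 !mxE !eqxx !andbT.
by have [->|->|->] := ord3P k; rewrite !eqxx ?eq3E /=; ring.
Qed.

Lemma eval_pd (P : pol) k y (t : R) :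
  is_derive t 1 (fun h => eval P (axis_line k y h)) (eval (pd k P) (axis_line k y t)).
Proof.
apply: is_derive_eq.
  apply: (@eval_curve _ _ (fun=> delta_mx k ord0)) => i; exact: axis_line_der.
by rewrite sum3_delta.
Qed.

Lemma axis_line0 k y : axis_line k y 0 = y.
Proof. by rewrite /axis_line scale0r addr0. Qed.

(** The derivative depends on the values only, so that identities between
    polynomials can be differentiated. *)
Lemma pd_ext k (P Q : pol) : eval P =1 eval Q -> eval (pd k P) =1 eval (pd k Q).
Proof.
move=> PQ y; rewrite -(axis_line0 k y).
apply: der_unique (eval_pd P k y 0) _.
rewrite (_ : (fun h => _) = (fun h => eval Q (axis_line k y h))); first exact: eval_pd.
by apply/funext => h; rewrite PQ.
Qed.

Lemma pdC i k (P : pol) y : eval (pd i (pd k P)) y = eval (pd k (pd i P)) y.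
Proof.
elim: P => [a|j|P hP Q hQ|P hP Q hQ] //=; first by rewrite hP hQ.
by rewrite hP hQ; ring.
Qed.

Definition pdCE := (pdC iy ix, pdC iz ix, pdC iz iy).

Definition Opp (P : pol) := Mul (Cst (-1)) P.
Definition Sub (P Q : pol) := Add P (Opp Q).

(** The infinitesimal generator of the rotations in the (j, k) plane. *)
Definition rot j k (P : pol) := Sub (Mul (Var j) (pd k P)) (Mul (Var k) (pd j P)).

Lemma rotE j k (P : pol) y : eval (rot j k P) y =
  y j ord0 * eval (pd k P) y - y k ord0 * eval (pd j P) y.
Proof. by rewrite /=; ring. Qed.

Lemma rot_ext j k (P Q : pol) : eval P =1 eval Q -> eval (rot j k P) =1 eval (rot j k Q).
Proof. by move=> PQ y; rewrite !rotE !(pd_ext _ PQ). Qed.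

Lemma rotD j k (P Q : pol) y : eval (rot j k (Add P Q)) y = eval (rot j k P) y + eval (rot j k Q) y.
Proof. by rewrite !rotE /=; ring. Qed.

Lemma rotZ j k (c : R) (P : pol) y : eval (rot j k (Mul (Cst c) P)) y = c * eval (rot j k P) y.
Proof. by rewrite !rotE /=; ring. Qed.

(** The commutation relations of the Lie algebra of the rotation group. *)
Lemma rot_commutator (P : pol) :
  [/\ eval (rot iy iz (rot iz ix P)) =1
         eval (Add (rot iz ix (rot iy iz P)) (Mul (Cst (-1)) (rot ix iy P))),
      eval (rot iz ix (rot ix iy P)) =1
         eval (Add (rot ix iy (rot iz ix P)) (Mul (Cst (-1)) (rot iy iz P))) &
      eval (rot ix iy (rot iy iz P)) =1
         eval (Add (rot iy iz (rot ix iy P)) (Mul (Cst (-1)) (rot iz ix P)))].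
Proof. by split=> y; rewrite /= ?eqxx ?eq3E /= ?pdCE; ring. Qed.

(** The Casimir operator of the rotation generators; on the unit sphere it is
    the Laplace-Beltrami operator. *)
Definition casimir (P : pol) :=
  Add (rot iy iz (rot iy iz P))
    (Add (rot iz ix (rot iz ix P)) (rot ix iy (rot ix iy P))).

(** Minus the cross product of y with the rotation generators: on the unit
    sphere, the surface gradient. *)
Definition sgrad i (P : pol) :=
  Add (Mul (Var ix) (rot ix i P))
    (Add (Mul (Var iy) (rot iy i P)) (Mul (Var iz) (rot iz i P))).

(** With D = y . grad, this is |y| ^ 2 Laplacian - D (D + 1). *)
Lemma casimirE (P : pol) y : let d i := eval (pd i P) y in
  let dd i j := eval (pd i (pd j P)) y in
  eval (casimir P) y =
  dot y y * (dd ix ix + dd iy iy + dd iz iz)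
  - (y ix ord0 * y ix ord0 * dd ix ix + y iy ord0 * y iy ord0 * dd iy iy
     + y iz ord0 * y iz ord0 * dd iz iz + 2 * y ix ord0 * y iy ord0 * dd ix iy
     + 2 * y ix ord0 * y iz ord0 * dd ix iz + 2 * y iy ord0 * y iz ord0 * dd iy iz)
  - 2 * (y ix ord0 * d ix + y iy ord0 * d iy + y iz ord0 * d iz).
Proof. by rewrite /= dotE !eqxx !eq3E /= ?pdCE; ring. Qed.

Lemma sgradE i (P : pol) y : eval (sgrad i P) y =
  dot y y * eval (pd i P) y - y i ord0 * \sum_j y j ord0 * eval (pd j P) y.
Proof. by rewrite sum3 dotE /=; have [->|->|->] := ord3P i; ring. Qed.

Lemma casimir_ext (P Q : pol) : eval P =1 eval Q -> eval (casimir P) =1 eval (casimir Q).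
Proof.
move=> PQ y; rewrite !casimirE.
have h i j : eval (pd i (pd j P)) y = eval (pd i (pd j Q)) y.
  by apply: pd_ext => z; exact: pd_ext.
by rewrite !h !(pd_ext _ PQ).
Qed.

Lemma casimirD (P Q : pol) y :
  eval (casimir (Add P Q)) y = eval (casimir P) y + eval (casimir Q) y.
Proof. by rewrite !casimirE /=; ring. Qed.

Lemma casimirZ (c : R) (P : pol) y :
  eval (casimir (Mul (Cst c) P)) y = c * eval (casimir P) y.
Proof. by rewrite !casimirE /=; ring. Qed.

(** The brackets of a with b ^ 2 and with c ^ 2 are the opposite anticommutators
    - (b c + c b) and b c + c b. *)
Let casimir_commute (a b c : pol -> pol) :
  (forall P Q, eval P =1 eval Q -> eval (b P) =1 eval (b Q)) ->
  (forall P Q, eval P =1 eval Q -> eval (c P) =1 eval (c Q)) ->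
  (forall P Q y, eval (b (Add P Q)) y = eval (b P) y + eval (b Q) y) ->
  (forall P Q y, eval (c (Add P Q)) y = eval (c P) y + eval (c Q) y) ->
  (forall r P y, eval (c (Mul (Cst r) P)) y = r * eval (c P) y) ->
  (forall P, eval (a (b P)) =1 eval (Add (b (a P)) (Mul (Cst (-1)) (c P)))) ->
  (forall P, eval (c (a P)) =1 eval (Add (a (c P)) (Mul (Cst (-1)) (b P)))) ->
  forall P y, eval (b (b (a P))) y + eval (c (c (a P))) y =
    eval (a (b (b P))) y + eval (a (c (c P))) y.
Proof.
move=> b_ext c_ext bD cD cZ ab ca P y.
have ba Q : eval (b (a Q)) =1 eval (Add (a (b Q)) (c Q)).
  by move=> z; rewrite /= ab /=; ring.
rewrite (b_ext _ _ (ba P)) bD ba (c_ext _ _ (ca P)) cD cZ ca /=; ring.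
Qed.

Lemma casimir_rot j k (P : pol) y :
  eval (casimir (rot j k P)) y = eval (rot j k (casimir P)) y.
Proof.
have anti a b : eval (casimir (rot a b P)) y = eval (rot a b (casimir P)) y ->
    eval (casimir (rot b a P)) y = eval (rot b a (casimir P)) y.
  move=> h; rewrite (@casimir_ext (rot b a P) (Mul (Cst (-1)) (rot a b P))).
    by rewrite casimirZ h !rotE; ring.
  by move=> z; rewrite /=; ring.
have diag a : eval (casimir (rot a a P)) y = eval (rot a a (casimir P)) y.
  rewrite rotE subrr (@casimir_ext (rot a a P) (Cst 0)); first by rewrite casimirE /=; ring.
  by move=> z; rewrite rotE subrr.
have cyc : [/\ eval (casimir (rot iy iz P)) y = eval (rot iy iz (casimir P)) y,
    eval (casimir (rot iz ix P)) y = eval (rot iz ix (casimir P)) y &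
    eval (casimir (rot ix iy P)) y = eval (rot ix iy (casimir P)) y].
  have ext j' k' := @rot_ext j' k'; have D j' k' := @rotD j' k'; have Z j' k' := @rotZ j' k'.
  have c1 Q := (let: And3 h _ _ := rot_commutator Q in h).
  have c2 Q := (let: And3 _ h _ := rot_commutator Q in h).
  have c3 Q := (let: And3 _ _ h := rot_commutator Q in h).
  have h1 := casimir_commute (@ext _ _) (@ext _ _) (D _ _) (D _ _) (Z _ _) c1 c3 P y.
  have h2 := casimir_commute (@ext _ _) (@ext _ _) (D _ _) (D _ _) (Z _ _) c2 c1 P y.
  have h3 := casimir_commute (@ext _ _) (@ext _ _) (D _ _) (D _ _) (Z _ _) c3 c2 P y.
  have E Q : eval (casimir Q) y = eval (rot iy iz (rot iy iz Q)) y +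
    (eval (rot iz ix (rot iz ix Q)) y + eval (rot ix iy (rot ix iy Q)) y) by [].
  have E' a b : eval (rot a b (casimir P)) y = eval (rot a b (rot iy iz (rot iy iz P))) y +
    (eval (rot a b (rot iz ix (rot iz ix P))) y + eval (rot a b (rot ix iy (rot ix iy P))) y).
    rewrite /casimir (rotD _ _ (rot iy iz (rot iy iz P))).
    by rewrite (rotD _ _ (rot iz ix (rot iz ix P))).
  rewrite !E !E'; move: h1 h2 h3; do 15?[move: (eval _ _) => ?].
  by split; lra.
case: cyc => c1 c2 c3.
have [->|->|->] := ord3P j; have [->|->|->] := ord3P k.
- exact: diag. - exact: c3. - exact: anti c2.
- exact: anti c3. - exact: diag. - exact: c1.
- exact: c2. - exact: anti c1. - exact: diag.
Qed.

(** The cross term of the product rule is the surface gradient. *)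
Lemma casimir_var i (P : pol) y : eval (casimir (Mul (Var i) P)) y =
  y i ord0 * eval (casimir P) y - 2 * y i ord0 * eval P y + 2 * eval (sgrad i P) y.
Proof.
rewrite !casimirE /= !dotE.
have [->|->|->] := ord3P i; by rewrite ?eqxx ?eq3E /= ?pdCE; ring.
Qed.

(** Expanding sgrad into products of a coordinate and a rotation generator
    reduces this to [casimir_var] and [casimir_rot]. *)
Lemma casimir_sgrad i (P : pol) y : eval (casimir (sgrad i P)) y =
  eval (sgrad i (casimir P)) y - 2 * y i ord0 * eval (casimir P) y.
Proof.
have E Q : eval (sgrad i Q) y = y ix ord0 * eval (rot ix i Q) y +
  (y iy ord0 * eval (rot iy i Q) y + y iz ord0 * eval (rot iz i Q) y) by [].
have e : eval (sgrad ix (rot ix i P)) y + eval (sgrad iy (rot iy i P)) y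
    + eval (sgrad iz (rot iz i P)) y =
    eval (sgrad i P) y - y i ord0 * eval (casimir P) y.
  rewrite !sgradE !sum3 casimirE dotE /=.
  by have [->|->|->] := ord3P i; rewrite ?eqxx ?eq3E /= ?pdCE; ring.
rewrite {1}/sgrad !casimirD !casimir_var !casimir_rot E.
by move: e; rewrite E; do 12?[move: (eval _ _) => ?]; lra.
Qed.

End polynomials.

(** * Bounded functions *)

Section bounded_on.
Variables (R : realType) (T : Type) (D : T -> Prop).
Implicit Types f g : T -> R.

Definition bounded_on f := exists M, forall x, D x -> `|f x| <= M.

Lemma bo_cst (c : R) : bounded_on (fun=> c).
Proof. by exists `|c|. Qed.

Lemma boD f g : bounded_on f -> bounded_on g -> bounded_on (fun x => f x + g x).
Proof.
move=> [M hM] [N hN]; exists (M + N) => x hx.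
by rewrite (le_trans (ler_normD _ _))// lerD ?hM ?hN.
Qed.

Lemma boM f g : bounded_on f -> bounded_on g -> bounded_on (fun x => f x * g x).
Proof.
move=> [M hM] [N hN]; exists (M * N) => x hx.
by rewrite normrM ler_pM ?hM ?hN.
Qed.

Lemma boN f : bounded_on f -> bounded_on (fun x => - f x).
Proof. by move=> [M hM]; exists M => x hx; rewrite normrN hM. Qed.

Lemma boB f g : bounded_on f -> bounded_on g -> bounded_on (fun x => f x - g x).
Proof. by move=> hf hg; apply: boD => //; exact: boN. Qed.

Lemma boX f n : bounded_on f -> bounded_on (fun x => f x ^+ n).
Proof. by move=> [M hM]; exists (M ^+ n) => x hx; rewrite normrX lerXn2r ?hM ?nnegrE// (le_trans _ (hM x hx)). Qed.

End bounded_on.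

(** * Integration over the unit sphere *)

Section sphere_integration.
Variable R : realType.
Implicit Types (f g : 'cV[R]_3 -> R) (y w : 'cV[R]_3) (t p : R).

Notation mu := (@lebesgue_measure R).
Notation mu2 := (mu \x mu)%E.
(* The plane, with the sigma-algebra that carries the Lebesgue measure. *)
Notation plane := (measurableTypeR R * measurableTypeR R)%type.
Notation chart := (`[0, pi] `*` `[0, 2 * pi] : set plane).

Lemma measurable_chart : measurable chart.
Proof. exact: measurableX. Qed.

Lemma chart_fin : (mu2 chart < +oo)%E.
Proof.
rewrite product_measure1E//; apply: lte_mul_pinfty => //.
- by rewrite /= lebesgue_measure_itv/=; case: ifP.
- by rewrite /= lebesgue_measure_itv/=; case: ifP => // _; rewrite -EFinB ltry.
Qed.

Definition sphere_measurable f :=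
  measurable_fun [set: plane] (fun a => f (sphere_point a.1 a.2)).

Definition sphere_bounded f := bounded_on (fun y => dot y y = 1) f.

Definition sphere_integrable f :=
  mu2.-integrable chart (EFin \o (fun a : plane => f (sphere_point a.1 a.2) * sin a.1)).

Lemma measurable_sin_fst : measurable_fun [set: plane] (fun a => sin a.1).
Proof.
apply: (@measurableT_comp _ _ _ _ _ _ (@sin R)); last exact: measurable_fst.
exact: continuous_measurable_fun (@continuous_sin R).
Qed.

Lemma measurable_cos_fst : measurable_fun [set: plane] (fun a => cos a.1).
Proof.
apply: (@measurableT_comp _ _ _ _ _ _ (@cos R)); last exact: measurable_fst.
exact: continuous_measurable_fun (@continuous_cos R).
Qed.

Lemma measurable_sin_snd : measurable_fun [set: plane] (fun a => sin a.2).
Proof.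
apply: (@measurableT_comp _ _ _ _ _ _ (@sin R)); last exact: measurable_snd.
exact: continuous_measurable_fun (@continuous_sin R).
Qed.

Lemma measurable_cos_snd : measurable_fun [set: plane] (fun a => cos a.2).
Proof.
apply: (@measurableT_comp _ _ _ _ _ _ (@cos R)); last exact: measurable_snd.
exact: continuous_measurable_fun (@continuous_cos R).
Qed.

Lemma sm_cst (c : R) : sphere_measurable (fun=> c).
Proof. exact: measurable_cst. Qed.

Lemma smD f g : sphere_measurable f -> sphere_measurable g ->
  sphere_measurable (fun y => f y + g y).
Proof. exact: measurable_funD. Qed.

Lemma smB f g : sphere_measurable f -> sphere_measurable g ->
  sphere_measurable (fun y => f y - g y).
Proof. exact: measurable_funB. Qed.

Lemma smM f g : sphere_measurable f -> sphere_measurable g ->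
  sphere_measurable (fun y => f y * g y).
Proof. exact: measurable_funM. Qed.

Lemma smX f n : sphere_measurable f -> sphere_measurable (fun y => f y ^+ n).
Proof. exact: measurable_funX. Qed.

Lemma sm_comp (k : R -> R) f : measurable_fun setT k -> sphere_measurable f ->
  sphere_measurable (fun y => k (f y)).
Proof. by move=> mk mf; exact: (measurableT_comp mk mf). Qed.

Lemma sm_coord i : sphere_measurable (fun y => y i ord0).
Proof.
rewrite /sphere_measurable; have [->|->|->] := ord3P i; under eq_fun do rewrite vec3E.
- exact: measurable_funM measurable_sin_fst measurable_cos_snd.
- exact: measurable_funM measurable_sin_fst measurable_sin_snd.
- exact: measurable_cos_fst.
Qed.

Lemma sm_eval (P : pol R) : sphere_measurable (eval P).
Proof.
elim: P => [c|i|P hP Q hQ|P hP Q hQ] /=.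
- exact: sm_cst. - exact: sm_coord. - exact: smD. - exact: smM.
Qed.

Lemma sm_dot w : sphere_measurable (dot w).
Proof.
rewrite /sphere_measurable; under eq_fun do rewrite dotE.
by do 2 (apply: measurable_funD; last (by apply: measurable_funM => //; exact: sm_coord));
  apply: measurable_funM => //; exact: sm_coord.
Qed.

Lemma measurable_rsqrt : measurable_fun [set: R] (fun q : R => (Num.sqrt q)^-1).
Proof.
rewrite (_ : (fun q => _) = (fun q => (Num.sqrt q) `^ (-1))); last first.
  by apply/funext => q; rewrite powR_inv1.
apply: (@measurableT_comp _ _ _ _ _ _ (fun z : R => z `^ (-1)) _ (@Num.sqrt R)).
  exact: measurable_powR.
by apply: continuous_measurable_fun; exact: sqrt_continuous.
Qed.

Lemma sb_eval (P : pol R) : sphere_bounded (eval P).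
Proof.
elim: P => [c|i|P hP Q hQ|P hP Q hQ] /=.
- exact: bo_cst. - by exists 1 => y; exact: coord_le1. - exact: boD. - exact: boM.
Qed.

Lemma sb_dot (k : R -> R) w : dot w w = 1 ->
  (exists M, forall s, -1 <= s <= 1 -> `|k s| <= M) ->
  sphere_bounded (fun y => k (dot w y)).
Proof. by move=> hw [M hM]; exists M => y hy; apply: hM; exact: dot_le1. Qed.

Lemma bounded_integrable (h : plane -> R) : measurable_fun [set: plane] h ->
  (exists M, forall a, chart a -> `|h a| <= M) ->
  mu2.-integrable chart (EFin \o h).
Proof.
move=> mh [M hM]; apply: measurable_bounded_integrable.
- exact: measurable_chart.
- exact: chart_fin.
- exact: measurable_funTS.
- exists M; split; first exact: num_real.
  by move=> N MN a /hM /le_trans; apply; exact: ltW.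
Qed.

Lemma sin_le1 t : `|sin t| <= 1.
Proof. by rewrite ler_norml sin_geN1 sin_le1. Qed.

Lemma cos_le1 t : `|cos t| <= 1.
Proof. by rewrite ler_norml cos_geN1 cos_le1. Qed.

Lemma sphere_integrableP f : sphere_measurable f -> sphere_bounded f -> sphere_integrable f.
Proof.
move=> mf [M hM]; apply: bounded_integrable.
  exact: measurable_funM measurable_sin_fst.
exists M => a _; rewrite normrM (le_trans (ler_piMr _ (sin_le1 _)))//.
exact/hM/dot_sphere_point.
Qed.

Lemma sphere_integrable_scale (c : R) f : sphere_integrable f ->
  sphere_integrable (fun y => c * f y).
Proof.
move=> hf; have := integrableZl measurable_chart c hf.
rewrite /sphere_integrable; congr (is_true (integrable _ _ _)).
by apply/funext => a /=; rewrite -EFinM mulrA.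
Qed.

Lemma sphere_integrableD f g : sphere_integrable f -> sphere_integrable g ->
  sphere_integrable (fun y => f y + g y).
Proof.
move=> hf hg; have := integrableD measurable_chart hf hg.
rewrite /sphere_integrable; congr (is_true (integrable _ _ _)).
by apply/funext => a /=; rewrite -EFinD mulrDl.
Qed.

Lemma sphere_integral_ext f g : (forall y, dot y y = 1 -> f y = g y) ->
  sphere_integral f = sphere_integral g.
Proof.
move=> fg; apply: eq_Rintegral => a _ /=.
by rewrite fg// dot_sphere_point.
Qed.

Lemma sphere_integralZ (c : R) f : sphere_integrable f ->
  sphere_integral (fun y => c * f y) = c * sphere_integral f.
Proof.
move=> hf; rewrite /sphere_integral -RintegralZl//; last exact: measurable_chart.
by apply: eq_Rintegral => a _; rewrite mulrA.
Qed.

Lemma sphere_integralD f g : sphere_integrable f -> sphere_integrable g ->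
  sphere_integral (fun y => f y + g y) = sphere_integral f + sphere_integral g.
Proof.
move=> hf hg; rewrite /sphere_integral -RintegralD//; last exact: measurable_chart.
by apply: eq_Rintegral => a _; rewrite mulrDl.
Qed.

Lemma sphere_integralB f g : sphere_integrable f -> sphere_integrable g ->
  sphere_integral (fun y => f y - g y) = sphere_integral f - sphere_integral g.
Proof.
move=> hf hg; rewrite /sphere_integral -RintegralB//; last exact: measurable_chart.
by apply: eq_Rintegral => a _; rewrite mulrBl.
Qed.

Lemma sin_chart (a : plane) : chart a -> 0 <= sin a.1.
Proof. by case=> /=; rewrite in_itv /= => h _; apply: sin_ge0_pi. Qed.

Lemma sphere_integral_le f g : sphere_integrable f -> sphere_integrable g ->
  (forall y, dot y y = 1 -> f y <= g y) -> sphere_integral f <= sphere_integral g.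
Proof.
move=> hf hg fg; apply: le_Rintegral => //; first exact: measurable_chart.
by move=> a ha; rewrite ler_wpM2r ?sin_chart// fg// dot_sphere_point.
Qed.

Lemma sphere_integral_norm_le f g : sphere_integrable f -> sphere_integrable g ->
  (forall y, dot y y = 1 -> `|f y| <= g y) -> `|sphere_integral f| <= sphere_integral g.
Proof.
move=> hf hg fg; have hfg y : dot y y = 1 -> - g y <= f y <= g y.
  by move=> hy; rewrite -ler_norml fg.
have h0 : sphere_integral (fun y => -1 * g y) = - sphere_integral g.
  by rewrite sphere_integralZ// mulN1r.
have hmg := sphere_integrable_scale (-1) hg.
rewrite ler_norml -h0; apply/andP; split; apply: sphere_integral_le => // y hy;
  by have /andP[] := hfg y hy; rewrite ?mulN1r.
Qed.

Lemma sphere_integrable_le f g : sphere_measurable f -> sphere_integrable g ->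
  (forall y, dot y y = 1 -> `|f y| <= g y) -> sphere_integrable f.
Proof.
move=> mf ig fg; apply: le_integrable ig; first exact: measurable_chart.
  apply/measurable_EFinP/measurable_funTS.
  exact: measurable_funM mf measurable_sin_fst.
move=> a ha /=; rewrite lee_fin !normrM ler_wpM2r//.
by rewrite (le_trans (fg _ (dot_sphere_point _ _)))// ler_norm.
Qed.

(** Fubini and the fundamental theorem of calculus in the polar angle. *)
Lemma chart_integral_dt (A dA : R -> R -> R) (c : R) :
  (forall t p, is_derive t 1 (A ^~ p) (dA t p)) ->
  (forall p, continuous (dA ^~ p)) ->
  measurable_fun [set: plane] (fun a => dA a.1 a.2) ->
  (exists M, forall t p, `|dA t p| <= M) ->
  (forall p, A pi p - A 0 p = c) ->
  \int[mu2]_(a in chart) dA a.1 a.2 = 2 * pi * c.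
Proof.
move=> hA cA mA [M hM] hc.
have iA : mu2.-integrable chart (EFin \o (fun a : plane => dA a.1 a.2)).
  by apply: bounded_integrable => //; exists M => a _; exact: hM.
have p0 : 0 < pi :> R := pi_gt0 R.
rewrite /Rintegral integral_mkcond.
rewrite -integral21_prod_meas1; last first.
  by apply/integrable_restrict => //; [exact: measurable_chart|rewrite setTI].
rewrite /fubini_G.
transitivity (fine (\int[mu]_(p in `[0%R, (2 * pi)%R]) c%:E)%E).
  congr fine; rewrite [RHS]integral_mkcond; apply: eq_integral => p _.
  rewrite {2}/patch; case: ifPn => hp.
    rewrite -(hc p) EFinB -(@continuous_FTC2 _ (dA ^~ p) (A ^~ p))//.
    - rewrite [RHS]integral_mkcond; apply: eq_integral => t _.
      by rewrite /patch/= in_setX hp andbT.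
    - exact/continuous_subspaceT/cA.
    - split; first by move=> t _; have [] := hA t p.
      + apply: cvg_at_right_filter; exact: (der_cont (hA 0 p)).
      + apply: cvg_at_left_filter; exact: (der_cont (hA pi p)).
    - by move=> t _; rewrite derive1E; have [_ ->] := hA t p.
  apply: integral0_eq => t _; rewrite /patch in_setX (negbTE hp) andbF//.
rewrite integral_cst//= lebesgue_measure_itv /= lte_fin.
by rewrite mulr_gt0// oppr0 adde0 -EFinM /= mulrC.
Qed.

Lemma chart_integral_dp (A dA : R -> R -> R) :
  (forall t p, is_derive p 1 (A t) (dA t p)) ->
  (forall t, continuous (dA t)) ->
  measurable_fun [set: plane] (fun a => dA a.1 a.2) ->
  (exists M, forall t p, `|dA t p| <= M) ->
  (forall t, A t (2 * pi) = A t 0) ->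
  \int[mu2]_(a in chart) dA a.1 a.2 = 0.
Proof.
move=> hA cA mA [M hM] hc.
have iA : mu2.-integrable chart (EFin \o (fun a : plane => dA a.1 a.2)).
  by apply: bounded_integrable => //; exists M => a _; exact: hM.
have p0 : 0 < 2 * pi :> R by rewrite mulr_gt0// pi_gt0.
rewrite /Rintegral integral_mkcond.
rewrite -integral12_prod_meas1; last first.
  by apply/integrable_restrict => //; [exact: measurable_chart|rewrite setTI].
rewrite /fubini_F integral0_eq// => t _.
have [ht|ht] := boolP (t \in `[0%R, pi]).
  have <- : ((A t (2 * pi)%R)%:E - (A t 0%R)%:E = 0)%E by rewrite hc subee.
  rewrite -(@continuous_FTC2 _ (dA t) (A t))//.
  - rewrite [RHS]integral_mkcond; apply: eq_integral => p _.
    by rewrite /patch/= in_setX mem_setE ht.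
  - exact/continuous_subspaceT/cA.
  - split; first by move=> p _; have [] := hA t p.
    + apply: cvg_at_right_filter; exact: (der_cont (hA t 0)).
    + apply: cvg_at_left_filter; exact: (der_cont (hA t (2 * pi))).
  - by move=> p _; rewrite derive1E; have [_ ->] := hA t p.
by apply: integral0_eq => p _; rewrite /patch in_setX mem_setE (negbTE ht).
Qed.

Lemma sphere_area : sphere_integral (fun=> 1) = 4 * pi :> R.
Proof.
rewrite /sphere_integral; under eq_Rintegral do rewrite mul1r.
have h t (p : R) : is_derive t 1 (fun s => - cos s) (sin t).
  exact: (is_derive_eq (derN (is_derive_cos t)) (opprK _)).
rewrite (@chart_integral_dt (fun t _ => - cos t) (fun t _ => sin t) 2 h).
- by rewrite mulrAC -natrM.
- by move=> _; exact: continuous_sin.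
- exact: measurable_sin_fst.
- by exists 1 => t _; exact: sin_le1.
- by move=> _; rewrite cospi cos0; lra.
Qed.

End sphere_integration.

(** * Integration by parts on the sphere *)

Section divergence.
Variable R : realType.
Implicit Types (y w : 'cV[R]_3) (t p : R).

Definition sphere_curve (c dc : R -> 'cV[R]_3) :=
  (forall t i, is_derive t 1 (fun s => c s i ord0) (dc t i ord0)) /\
  (forall t, dot (c t) (c t) = 1).

(** Continuous differentiability on the sphere, with g in the role of the
    gradient; differentiability is only asked along curves in the sphere. *)
Record sphere_C1 (f : 'cV[R]_3 -> R) (g : 'I_3 -> 'cV[R]_3 -> R) : Prop := SphereC1 {
  C1_der : forall c dc, sphere_curve c dc -> forall t,
    is_derive t 1 (fun s => f (c s)) (\sum_i g i (c t) * dc t i ord0);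
  C1_cont : forall i c dc, sphere_curve c dc -> continuous (fun t => g i (c t));
  C1_meas : sphere_measurable f;
  C1_gmeas : forall i, sphere_measurable (g i);
  C1_bounded : sphere_bounded f;
  C1_gbounded : forall i, sphere_bounded (g i) }.

Definition d_polar t p : 'cV[R]_3 := vec3 (cos t * cos p) (cos t * sin p) (- sin t).
Definition d_azimuth t p : 'cV[R]_3 := vec3 (- (sin t * sin p)) (sin t * cos p) 0.

Lemma polar_curve p : sphere_curve (fun t => sphere_point t p) (d_polar ^~ p).
Proof.
split=> [t i|t]; last exact: dot_sphere_point.
have [->|->|->] := ord3P i; under eq_fun do rewrite vec3E; rewrite vec3E.
- by apply: (is_derive_eq (derM (is_derive_sin t) (dercst _ _))); ring.
- by apply: (is_derive_eq (derM (is_derive_sin t) (dercst _ _))); ring.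
- exact: is_derive_cos.
Qed.

Lemma azimuth_curve t : sphere_curve (sphere_point t) (d_azimuth t).
Proof.
split=> [p i|p]; last exact: dot_sphere_point.
have [->|->|->] := ord3P i; under eq_fun do rewrite vec3E; rewrite vec3E.
- by apply: (is_derive_eq (derM (dercst _ _) (is_derive_cos p))); ring.
- by apply: (is_derive_eq (derM (dercst _ _) (is_derive_sin p))); ring.
- exact: dercst.
Qed.

Section rotation_integral.
Variables (f : 'cV[R]_3 -> R) (g : 'I_3 -> 'cV[R]_3 -> R).
Hypothesis fg : sphere_C1 f g.

Let h t p := f (sphere_point t p).
Let ht t p := \sum_i g i (sphere_point t p) * d_polar t p i ord0.
Let hp t p := \sum_i g i (sphere_point t p) * d_azimuth t p i ord0.

Let h_der_t t p : is_derive t 1 (h ^~ p) (ht t p).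
Proof. exact: (C1_der fg (polar_curve p)). Qed.

Let h_der_p t p : is_derive p 1 (h t) (hp t p).
Proof. exact: (C1_der fg (azimuth_curve t)). Qed.

Let ht_cont p : continuous (ht ^~ p).
Proof.
rewrite /ht; under eq_fun do rewrite sum3 !vec3E.
have cs := @continuous_sin R; have cc := @continuous_cos R.
move=> t; have hg i := @C1_cont _ _ fg i _ _ (polar_curve p) t.
apply: cvgD; first apply: cvgD; (apply: cvgM; first exact: hg).
- by apply: cvgM; [exact: cc|exact: cvg_cst].
- by apply: cvgM; [exact: cc|exact: cvg_cst].
- by apply: cvgN; exact: cs.
Qed.

Let hp_cont t : continuous (hp t).
Proof.
rewrite /hp; under eq_fun do rewrite sum3 !vec3E.
have cs := @continuous_sin R; have cc := @continuous_cos R.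
move=> p; have hg i := @C1_cont _ _ fg i _ _ (azimuth_curve t) p.
apply: cvgD; first apply: cvgD; (apply: cvgM; first exact: hg).
- by apply: cvgN; apply: cvgM; [exact: cvg_cst|exact: cs].
- by apply: cvgM; [exact: cvg_cst|exact: cc].
- exact: cvg_cst.
Qed.

Notation plane := (measurableTypeR R * measurableTypeR R)%type.
Let meas (k : R -> R -> R) := measurable_fun [set: plane] (fun a => k a.1 a.2).
Let bnd (k : R -> R -> R) := exists M, forall t p, `|k t p| <= M.

Let bndD k1 k2 : bnd k1 -> bnd k2 -> bnd (fun t p => k1 t p + k2 t p).
Proof.
move=> [M hM] [N hN]; exists (M + N) => t p.
by rewrite (le_trans (ler_normD _ _))// lerD ?hM ?hN.
Qed.

Let bndM k1 k2 : bnd k1 -> bnd k2 -> bnd (fun t p => k1 t p * k2 t p).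
Proof.
move=> [M hM] [N hN]; exists (M * N) => t p.
by rewrite normrM ler_pM ?hM ?hN.
Qed.

Let bnd_st : bnd (fun t _ => sin t). Proof. by exists 1 => t _; exact: sin_le1. Qed.
Let bnd_ct : bnd (fun t _ => cos t). Proof. by exists 1 => t _; exact: cos_le1. Qed.
Let bnd_sp : bnd (fun _ p => sin p). Proof. by exists 1 => _ p; exact: sin_le1. Qed.
Let bnd_cp : bnd (fun _ p => cos p). Proof. by exists 1 => _ p; exact: cos_le1. Qed.
Let bnd_cst (c : R) : bnd (fun _ _ => c). Proof. by exists `|c|. Qed.
Let bnd_sphere k : sphere_bounded k -> bnd (fun t p => k (sphere_point t p)).
Proof. by move=> [M hM]; exists M => t p; apply/hM/dot_sphere_point. Qed.

Let measD k1 k2 : meas k1 -> meas k2 -> meas (fun t p => k1 t p + k2 t p).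
Proof. exact: measurable_funD. Qed.
Let measM k1 k2 : meas k1 -> meas k2 -> meas (fun t p => k1 t p * k2 t p).
Proof. exact: measurable_funM. Qed.
Let meas_cst (c : R) : meas (fun _ _ => c). Proof. exact: measurable_cst. Qed.
Let meas_st : meas (fun t _ => sin t). Proof. exact: measurable_sin_fst. Qed.
Let meas_ct : meas (fun t _ => cos t). Proof. exact: measurable_cos_fst. Qed.
Let meas_sp : meas (fun _ p => sin p). Proof. exact: measurable_sin_snd. Qed.
Let meas_cp : meas (fun _ p => cos p). Proof. exact: measurable_cos_snd. Qed.

Let ht_bnd : bnd ht.
Proof.
suff : bnd (fun t p => g ix (sphere_point t p) * (cos t * cos p) +
    g iy (sphere_point t p) * (cos t * sin p) + g iz (sphere_point t p) * (-1 * sin t)).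
  move=> [M hM]; exists M => t p; apply: le_trans (hM t p).
  by rewrite /ht sum3 !vec3E mulN1r.
have hg i := bnd_sphere (C1_gbounded fg i).
by apply: bndD; first apply: bndD; apply: bndM => //; apply: bndM.
Qed.

Let hp_bnd : bnd hp.
Proof.
suff : bnd (fun t p => g ix (sphere_point t p) * (-1 * (sin t * sin p)) +
    g iy (sphere_point t p) * (sin t * cos p)).
  move=> [M hM]; exists M => t p; apply: le_trans (hM t p).
  by rewrite /hp sum3 !vec3E mulN1r mulr0 addr0.
have hg i := bnd_sphere (C1_gbounded fg i).
by apply: bndD; apply: bndM => //; do ?apply: bndM.
Qed.

Let ht_meas : meas ht.
Proof.
rewrite (_ : ht = (fun t p => g ix (sphere_point t p) * (cos t * cos p) +
    g iy (sphere_point t p) * (cos t * sin p) + g iz (sphere_point t p) * (-1 * sin t))).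
  have hg i : meas (fun t p => g i (sphere_point t p)) by exact: C1_gmeas fg i.
  by apply: measD; first apply: measD; apply: measM => //; apply: measM.
by apply/funext => t; apply/funext => p; rewrite /ht sum3 !vec3E mulN1r.
Qed.

Let hp_meas : meas hp.
Proof.
rewrite (_ : hp = (fun t p => g ix (sphere_point t p) * (-1 * (sin t * sin p)) +
    g iy (sphere_point t p) * (sin t * cos p))).
  have hg i : meas (fun t p => g i (sphere_point t p)) by exact: C1_gmeas fg i.
  by apply: measD; apply: measM => //; do ?apply: measM.
by apply/funext => t; apply/funext => p; rewrite /hp sum3 !vec3E mulN1r mulr0 addr0.
Qed.

Let h_bnd : bnd h := bnd_sphere (C1_bounded fg).
Let h_meas : meas h := C1_meas fg.

(* A function of the azimuth alone times sin t times f has zero integral of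
   its polar derivative, since sin t vanishes at both ends. *)
Let int_dt (a : R -> R) : (exists M, forall p, `|a p| <= M) -> continuous a ->
  \int[(@lebesgue_measure R \x @lebesgue_measure R)%E]_(b in `[0, pi] `*` `[0, 2 * pi])
    (a b.2 * (cos b.1 * h b.1 b.2 + sin b.1 * ht b.1 b.2)) = 0.
Proof.
move=> [M aM] ca.
have ma : meas (fun _ p => a p).
  apply: (@measurableT_comp _ _ _ _ _ _ a); last exact: measurable_snd.
  exact: continuous_measurable_fun.
have ba : bnd (fun _ p => a p) by exists M.
have dA t p : is_derive t 1 (fun s => a p * (sin s * h s p))
    (a p * (cos t * h t p + sin t * ht t p)).
  exact: derZ (derM (is_derive_sin t) (h_der_t t p)).
rewrite (@chart_integral_dt R _ (fun t p => a p * (cos t * h t p + sin t * ht t p))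
  0 dA) ?mulr0//.
- move=> p t; apply: cvgM; first exact: cvg_cst.
  apply: cvgD; apply: cvgM.
  + exact: continuous_cos.
  + exact: (der_cont (h_der_t t p)).
  + exact: continuous_sin.
  + exact: ht_cont.
- exact: (measM ma (measD (measM meas_ct h_meas) (measM meas_st ht_meas))).
- exact: (bndM ba (bndD (bndM bnd_ct h_bnd) (bndM bnd_st ht_bnd))).
- by move=> p; rewrite sinpi sin0; ring.
Qed.

(* Periodicity in the azimuth. *)
Let int_dp (b a da : R -> R) : (forall p, is_derive p 1 a (da p)) -> continuous da ->
  (exists M, forall p, `|a p| <= M) -> (exists M, forall p, `|da p| <= M) ->
  (exists M, forall t, `|b t| <= M) -> continuous b -> a (2 * pi) = a 0 ->
  \int[(@lebesgue_measure R \x @lebesgue_measure R)%E]_(c in `[0, pi] `*` `[0, 2 * pi])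
    (b c.1 * (da c.2 * h c.1 c.2 + a c.2 * hp c.1 c.2)) = 0.
Proof.
move=> ha cda [M aM] [M' daM] [N bN] cb a2pi.
have ca : continuous a by move=> p; exact: der_cont (ha p).
have ma : meas (fun _ p => a p).
  apply: (@measurableT_comp _ _ _ _ _ _ a); last exact: measurable_snd.
  exact: continuous_measurable_fun.
have mda : meas (fun _ p => da p).
  apply: (@measurableT_comp _ _ _ _ _ _ da); last exact: measurable_snd.
  exact: continuous_measurable_fun.
have mb : meas (fun t _ => b t).
  apply: (@measurableT_comp _ _ _ _ _ _ b); last exact: measurable_fst.
  exact: continuous_measurable_fun.
have ba : bnd (fun _ p => a p) by exists M.
have bda : bnd (fun _ p => da p) by exists M'.
have bb : bnd (fun t _ => b t) by exists N.
have dA t p : is_derive p 1 (fun q => b t * (a q * h t q))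
    (b t * (da p * h t p + a p * hp t p)).
  exact: derZ (derM (ha p) (h_der_p t p)).
rewrite (@chart_integral_dp R _ (fun t p => b t * (da p * h t p + a p * hp t p)) dA)//.
- move=> t p; apply: cvgM; first exact: cvg_cst.
  apply: cvgD; apply: cvgM.
  + exact: cda.
  + exact: (der_cont (h_der_p t p)).
  + exact: ca.
  + exact: hp_cont.
- exact: (measM mb (measD (measM mda h_meas) (measM ma hp_meas))).
- exact: (bndM bb (bndD (bndM bda h_bnd) (bndM ba hp_bnd))).
- move=> t; rewrite a2pi /h; congr (_ * (_ * f _)).
  by rewrite /sphere_point -[2 * pi]add0r mulr_natl sinD2pi cosD2pi.
Qed.

Let int_sum (k1 k2 k : R -> R -> R) : meas k1 -> meas k2 -> bnd k1 -> bnd k2 ->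
  (forall t p, k t p = k1 t p + k2 t p) ->
  \int[(@lebesgue_measure R \x @lebesgue_measure R)%E]_(c in `[0, pi] `*` `[0, 2 * pi])
    k1 c.1 c.2 = 0 ->
  \int[(@lebesgue_measure R \x @lebesgue_measure R)%E]_(c in `[0, pi] `*` `[0, 2 * pi])
    k2 c.1 c.2 = 0 ->
  \int[(@lebesgue_measure R \x @lebesgue_measure R)%E]_(c in `[0, pi] `*` `[0, 2 * pi])
    k c.1 c.2 = 0.
Proof.
move=> m1 m2 [M1 b1] [M2 b2] kE i1 i2.
rewrite -[RHS]addr0 -[in X in _ = X + _]i1 -[in X in _ = _ + X]i2.
rewrite -RintegralD; first by apply: eq_Rintegral => c _; rewrite kE.
- exact: measurable_chart.
- by apply: bounded_integrable => //; exists M1 => c _.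
- by apply: bounded_integrable => //; exists M2 => c _.
Qed.

(* The multiples of f cancel between the two divergence-form terms. *)
Let int_div (a da : R -> R) : (forall p, is_derive p 1 a (da p)) -> continuous da ->
  (exists M, forall p, `|a p| <= M) -> (exists M, forall p, `|da p| <= M) ->
  a (2 * pi) = a 0 ->
  \int[(@lebesgue_measure R \x @lebesgue_measure R)%E]_(c in `[0, pi] `*` `[0, 2 * pi])
    (da c.2 * (sin c.1 * ht c.1 c.2) - cos c.1 * (a c.2 * hp c.1 c.2)) = 0.
Proof.
move=> ha cda aM daM a2pi.
have ca : continuous a by move=> p; exact: der_cont (ha p).
have ma : meas (fun _ p => a p).
  apply: (@measurableT_comp _ _ _ _ _ _ a); last exact: measurable_snd.
  exact: continuous_measurable_fun.
have mda : meas (fun _ p => da p).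
  apply: (@measurableT_comp _ _ _ _ _ _ da); last exact: measurable_snd.
  exact: continuous_measurable_fun.
have ba : bnd (fun _ p => a p) by have [M hM] := aM; exists M.
have bda : bnd (fun _ p => da p) by have [M hM] := daM; exists M.
have cb : continuous (fun t : R => -1 * cos t).
  by move=> t; apply: cvgM; [exact: cvg_cst|exact: continuous_cos].
have bb : exists M : R, forall t, `|-1 * cos t| <= M.
  by exists 1 => t; rewrite mulN1r normrN cos_le1.
have mb : meas (fun t _ => -1 * cos t) := measM (meas_cst (-1)) meas_ct.
have bb' : bnd (fun t _ => -1 * cos t) := bndM (bnd_cst (-1)) bnd_ct.
apply: (@int_sum (fun t p => da p * (cos t * h t p + sin t * ht t p))
  (fun t p => (-1 * cos t) * (da p * h t p + a p * hp t p))
  (fun t p => da p * (sin t * ht t p) - cos t * (a p * hp t p))).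
- exact: (measM mda (measD (measM meas_ct h_meas) (measM meas_st ht_meas))).
- exact: (measM mb (measD (measM mda h_meas) (measM ma hp_meas))).
- exact: (bndM bda (bndD (bndM bnd_ct h_bnd) (bndM bnd_st ht_bnd))).
- exact: (bndM bb' (bndD (bndM bda h_bnd) (bndM ba hp_bnd))).
- by move=> t p; ring.
- exact: (@int_dt da daM cda).
- exact: (@int_dp (fun t => -1 * cos t) a da ha cda aM daM bb cb a2pi).
Qed.

(** Rotations preserve the surface measure, so their generators integrate to
    zero.  In the chart, the integrand times sin t is the sum of a polar
    derivative of a function vanishing at both poles and an azimuthal
    derivative of a periodic function. *)
Lemma rotation_integral :
  [/\ sphere_integral (fun y => y iy ord0 * g iz y - y iz ord0 * g iy y) = 0,
      sphere_integral (fun y => y iz ord0 * g ix y - y ix ord0 * g iz y) = 0 &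
      sphere_integral (fun y => y ix ord0 * g iy y - y iy ord0 * g ix y) = 0].
Proof.
have bs : exists M : R, forall p, `|sin p| <= M by exists 1; exact: sin_le1.
have bc : exists M : R, forall p, `|cos p| <= M by exists 1; exact: cos_le1.
have bns : exists M : R, forall p, `|- sin p| <= M.
  by exists 1 => p; rewrite normrN sin_le1.
have cs := @continuous_sin R; have cc := @continuous_cos R.
have cns : continuous (fun p : R => - sin p) by move=> p; apply: cvgN; exact: cs.
have per : sin (2 * pi : R) = sin 0 /\ cos (2 * pi : R) = cos 0.
  by rewrite -[2 * pi]add0r mulr_natl sinD2pi cosD2pi.
split; rewrite /sphere_integral.
- rewrite -[RHS](@int_div cos (fun p => - sin p) (@is_derive_cos R) cns bc bns per.2).
  apply: eq_Rintegral => -[t p] _ /=; rewrite /ht /hp !sum3 !vec3E.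
  have := cos2Dsin2 p.
  set c := cos p; set s := sin p => cs1.
  set u := cos t; set v := sin t; set a := g ix _; set b := g iy _; set d := g iz _.
  transitivity (v * (v * s * d) - v * u * b * (c ^+ 2 + s ^+ 2)); last by ring.
  by rewrite cs1; ring.
- rewrite -[RHS](@int_div sin cos (@is_derive_sin R) cc bs bc per.1).
  apply: eq_Rintegral => -[t p] _ /=; rewrite /ht /hp !sum3 !vec3E.
  have := cos2Dsin2 p.
  set c := cos p; set s := sin p => cs1.
  set u := cos t; set v := sin t; set a := g ix _; set b := g iy _; set d := g iz _.
  transitivity (v * u * a * (c ^+ 2 + s ^+ 2) - v * (v * c * d)); last by ring.
  by rewrite cs1; ring.
- have b1 : exists M : R, forall p : R, `|1 : R| <= M by exists 1 => _; rewrite normr1.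
  have b0 : exists M : R, forall p : R, `|0 : R| <= M by exists 0 => _; rewrite normr0.
  rewrite -[RHS](@int_dp sin (fun _ => 1) (fun _ => 0) (dercst 1)
    (fun _ => cvg_cst _) b1 b0 bs cs erefl).
  apply: eq_Rintegral => -[t p] _ /=; rewrite /ht /hp !sum3 !vec3E.
  by ring.
Qed.

End rotation_integral.
End divergence.

(** * Polynomials against zonal functions *)

Section zonal.
Variable R : realType.
Implicit Types (y w : 'cV[R]_3) (P : pol R) (k dk : R -> R).

Record zonal_C1 k dk : Prop := ZonalC1 {
  zonal_der : forall s : R, -1 <= s <= 1 -> is_derive s 1 k (dk s);
  zonal_cont : forall s : R, -1 <= s <= 1 -> {for s, continuous dk};
  zonal_meas : measurable_fun [set: R] k;
  zonal_dmeas : measurable_fun [set: R] dk }.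

Lemma continuous_bounded k : (forall s : R, -1 <= s <= 1 -> {for s, continuous k}) ->
  exists M, forall s : R, -1 <= s <= 1 -> `|k s| <= M.
Proof.
move=> ck.
have [||c _ hc] := @EVT_max R (fun s => `|k s|) (-1) 1.
- by lra.
- apply: continuous_in_subspaceT => s; rewrite inE /= in_itv /= => hs.
  by apply: continuous_comp; [exact: ck|exact: norm_continuous].
- by exists `|k c| => s hs; apply: hc; rewrite in_itv.
Qed.

Lemma zonal_bounded k dk : zonal_C1 k dk -> exists M, forall s : R, -1 <= s <= 1 -> `|k s| <= M.
Proof. by move=> hk; apply: continuous_bounded => s /(zonal_der hk); exact: der_cont. Qed.

Lemma zonal_dbounded k dk : zonal_C1 k dk -> exists M, forall s : R, -1 <= s <= 1 -> `|dk s| <= M.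
Proof. by move=> hk; apply: continuous_bounded => s hs; exact: (zonal_cont hk hs). Qed.

Lemma sm_zonal (k : R -> R) w : measurable_fun [set: R] k ->
  sphere_measurable (fun y => k (dot w y)).
Proof. by move=> mk; exact: (sm_comp mk (@sm_dot R w)). Qed.

Lemma dot_curve w (c dc : R -> 'cV[R]_3) (t : R) :
  (forall i, is_derive t 1 (fun s => c s i ord0) (dc t i ord0)) ->
  is_derive t 1 (fun s => dot w (c s)) (dot w (dc t)).
Proof.
move=> hc; rewrite dotE; under eq_fun do rewrite dotE.
exact: (derD (derD (derZ _ (hc ix)) (derZ _ (hc iy))) (derZ _ (hc iz))).
Qed.

Lemma zonal_sphere_C1 P k dk w : dot w w = 1 -> zonal_C1 k dk ->
  sphere_C1 (fun y => eval P y * k (dot w y))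
    (fun i y => eval (pd i P) y * k (dot w y) + eval P y * (w i ord0 * dk (dot w y))).
Proof.
move=> w1 hk.
have bk : sphere_bounded (fun y => k (dot w y)) by exact: sb_dot (zonal_bounded hk).
have bdk : sphere_bounded (fun y => dk (dot w y)) by exact: sb_dot (zonal_dbounded hk).
have mk := sm_zonal w (zonal_meas hk); have mdk := sm_zonal w (zonal_dmeas hk).
split.
- move=> c dc [dc1 c1] t.
  have h1 := eval_curve P (dc1 t).
  have h2 := dercomp (zonal_der hk (dot_le1 w1 (c1 t))) (dot_curve w (dc1 t)).
  apply: (is_derive_eq (derM h1 h2)).
  by rewrite !sum3 [dot w (dc t)]dotE; ring.
- move=> i c dc [dc1 c1] t.
  have cd : {for t, continuous (fun s => dot w (c s))} by exact: der_cont (dot_curve w (dc1 t)).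
  have ck : {for t, continuous (fun s => k (dot w (c s)))}.
    exact: (@continuous_comp _ _ _ (fun s => dot w (c s)) k t cd
      (der_cont (zonal_der hk (dot_le1 w1 (c1 t))))).
  have cdk : {for t, continuous (fun s => dk (dot w (c s)))}.
    exact: (@continuous_comp _ _ _ (fun s => dot w (c s)) dk t cd
      (zonal_cont hk (dot_le1 w1 (c1 t)))).
  have cP Q : {for t, continuous (fun s => eval Q (c s))} := der_cont (eval_curve Q (dc1 t)).
  apply: cvgD; apply: cvgM; [exact: cP|exact: ck|exact: cP|].
  by apply: cvgM; [exact: cvg_cst|exact: cdk].
- by apply: smM => //; exact: sm_eval.
- move=> i; apply: smD; apply: smM => //; try exact: sm_eval.
  by apply: smM => //; exact: sm_cst.
- by apply: boM => //; exact: sb_eval.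
- move=> i; apply: boD; apply: boM => //; try exact: sb_eval.
  by apply: boM => //; exact: bo_cst.
Qed.

(** The coordinate of the cross product of y and w that belongs to the (i, j)
    plane; it is what the generator of that plane makes of <w, y>. *)
Definition cross_pol w i j : pol R :=
  Sub (Mul (Cst (w j ord0)) (Var R i)) (Mul (Cst (w i ord0)) (Var R j)).

Lemma zonal_integrable P k w : dot w w = 1 -> measurable_fun [set: R] k ->
  (exists M, forall s : R, -1 <= s <= 1 -> `|k s| <= M) ->
  sphere_integrable (fun y => eval P y * k (dot w y)).
Proof.
move=> w1 mk bk; apply: sphere_integrableP.
  by apply: smM; [exact: sm_eval|exact: sm_zonal].
by apply: boM; [exact: sb_eval|exact: sb_dot].
Qed.

Lemma rot_by_parts P k dk w : dot w w = 1 -> zonal_C1 k dk ->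
  forall i j, [\/ (i = iy /\ j = iz), (i = iz /\ j = ix) | (i = ix /\ j = iy)] ->
  sphere_integral (fun y => eval (rot i j P) y * k (dot w y)) =
  - sphere_integral (fun y => eval (Mul P (cross_pol w i j)) y * dk (dot w y)).
Proof.
move=> w1 hk i j ij.
have [h1 h2 h3] := rotation_integral (zonal_sphere_C1 P w1 hk).
apply/eqP; rewrite -subr_eq0 opprK -sphere_integralD; last 2 first.
- exact: zonal_integrable (zonal_meas hk) (zonal_bounded hk).
- exact: zonal_integrable (zonal_dmeas hk) (zonal_dbounded hk).
apply/eqP; case: ij => -[-> ->].
- by rewrite -[RHS]h1; apply: sphere_integral_ext => y _ /=; ring.
- by rewrite -[RHS]h2; apply: sphere_integral_ext => y _ /=; ring.
- by rewrite -[RHS]h3; apply: sphere_integral_ext => y _ /=; ring.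
Qed.

(** The Casimir operator is symmetric; transferred to a zonal function, it
    becomes the Legendre operator in the variable s = <w, y>. *)
Lemma casimir_by_parts P k dk ddk w : dot w w = 1 -> zonal_C1 k dk -> zonal_C1 dk ddk ->
  sphere_integral (fun y => eval (casimir P) y * k (dot w y)) =
  sphere_integral (fun y => eval P y *
    ((1 - dot w y ^+ 2) * ddk (dot w y) - 2 * dot w y * dk (dot w y))).
Proof.
move=> w1 hk hdk.
have zi Q f df (hf : zonal_C1 f df) : sphere_integrable (fun y => eval Q y * f (dot w y)).
  exact: zonal_integrable (zonal_meas hf) (zonal_bounded hf).
have zdi Q f df (hf : zonal_C1 f df) : sphere_integrable (fun y => eval Q y * df (dot w y)).
  exact: zonal_integrable (zonal_dmeas hf) (zonal_dbounded hf).
have step i j : [\/ (i = iy /\ j = iz), (i = iz /\ j = ix) | (i = ix /\ j = iy)] ->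
  sphere_integral (fun y => eval (rot i j (rot i j P)) y * k (dot w y)) =
  sphere_integral (fun y => eval (Mul P (rot i j (cross_pol w i j))) y * dk (dot w y)
    + eval (Mul (Mul P (cross_pol w i j)) (cross_pol w i j)) y * ddk (dot w y)).
  move=> ij; rewrite (rot_by_parts _ w1 hk ij).
  have := rot_by_parts (Mul P (cross_pol w i j)) w1 hdk ij.
  move/eqP; rewrite -subr_eq0 opprK -sphere_integralD; last 2 first.
  - exact: zonal_integrable (zonal_meas hdk) (zonal_bounded hdk).
  - exact: zonal_integrable (zonal_dmeas hdk) (zonal_dbounded hdk).
  move/eqP => e; apply/eqP; rewrite eq_sym -subr_eq0 opprK; apply/eqP; rewrite -[RHS]e.
  rewrite -sphere_integralD.
  - by apply: sphere_integral_ext => y _ /=; ring.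
  - by apply: sphere_integrableD; [exact: (zi _ _ _ hdk)|exact: (zdi _ _ _ hdk)].
  - exact: (zi _ _ _ hdk).
transitivity (sphere_integral (fun y => eval (rot iy iz (rot iy iz P)) y * k (dot w y)) +
  (sphere_integral (fun y => eval (rot iz ix (rot iz ix P)) y * k (dot w y)) +
   sphere_integral (fun y => eval (rot ix iy (rot ix iy P)) y * k (dot w y)))).
  rewrite -sphere_integralD; [|exact: (zi _ _ _ hk)..].
  rewrite -sphere_integralD; [|exact: (zi _ _ _ hk)|].
    by apply: sphere_integral_ext => y _ /=; ring.
  by apply: sphere_integrableD; exact: (zi _ _ _ hk).
rewrite !step; [|by constructor|by constructor|by constructor].
have int i j : sphere_integrable (fun y =>
    eval (Mul P (rot i j (cross_pol w i j))) y * dk (dot w y)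
    + eval (Mul (Mul P (cross_pol w i j)) (cross_pol w i j)) y * ddk (dot w y)).
  by apply: sphere_integrableD; [exact: (zi _ _ _ hdk)|exact: (zdi _ _ _ hdk)].
rewrite -sphere_integralD; [|exact: int..].
rewrite -sphere_integralD; [|exact: int|apply: sphere_integrableD; exact: int].
apply: sphere_integral_ext => y y1 /=; rewrite !eqxx !eq3E /=.
move: (dk _) (ddk _) w1 y1 => D1 D2; rewrite !dotE.
set a := w ix ord0; set b := w iy ord0; set c := w iz ord0.
set x := y ix ord0; set t := y iy ord0; set z := y iz ord0 => h1 h2.
transitivity (eval P y * (((a * a + b * b + c * c) * (x * x + t * t + z * z)
  - (a * x + b * t + c * z) ^+ 2) * D2 - 2 * (a * x + b * t + c * z) * D1)); first by ring.
by rewrite h1 h2; ring.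
Qed.

End zonal.

(** * Newtonian potentials of spherical polynomials *)

Section differentiation.
Variable R : realType.

(** Differentiation under the integral sign for a bounded derivative. *)
Lemma sphere_integral_derive (f df : R -> 'cV[R]_3 -> R) (a b r0 : R) : a < r0 < b ->
  (forall r, a < r < b -> sphere_measurable (f r)) ->
  (forall r, a < r < b -> sphere_bounded (f r)) ->
  (forall r y, a < r < b -> dot y y = 1 -> is_derive r 1 (f ^~ y) (df r y)) ->
  (exists M, forall r y, a < r < b -> dot y y = 1 -> `|df r y| <= M) ->
  is_derive r0 1 (fun r => sphere_integral (f r)) (sphere_integral (df r0)).
Proof.
move=> hr mf bf hd [M hM].
pose I : set R := [set` `]a, b[].
have inI r : I r -> a < r < b by rewrite /I /= in_itv.
pose g r (c : measurableTypeR R * measurableTypeR R) := f r (sphere_point c.1 c.2) * sin c.1.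
have dg r c : a < r < b -> is_derive r 1 (g ^~ c) (df r (sphere_point c.1 c.2) * sin c.1).
  move=> rI; have h := hd r _ rI (dot_sphere_point c.1 c.2).
  by apply: (is_derive_eq (derM h (dercst (sin c.1) r))); rewrite mulr0 addr0.
have r0I : I r0 by rewrite /I /= in_itv.
have p1 r : I r -> (@lebesgue_measure R \x @lebesgue_measure R)%E.-integrable
    (`[0, pi] `*` `[0, 2 * pi]) (EFin \o g r).
  by move=> /inI rI; apply: sphere_integrableP; [exact: mf|exact: bf].
have p2 r c : I r -> (`[0, pi] `*` `[0, 2 * pi])%classic c -> derivable (g ^~ c) r 1.
  by move=> /inI rI _; have [] := dg r c rI.
have p3 r c : a < r < b -> partial1of2 g r c = df r (sphere_point c.1 c.2) * sin c.1.
  by move=> rI; rewrite partial1of2E; have [_ ->] := dg r c rI.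
have p4 : (@lebesgue_measure R \x @lebesgue_measure R)%E.-integrable
    (`[0, pi] `*` `[0, 2 * pi]) (EFin \o (fun=> `|M|)).
  by apply: bounded_integrable; [exact: measurable_cst|exists `|M| => c _; rewrite normr_id].
have p5 r c : I r -> (`[0, pi] `*` `[0, 2 * pi])%classic c ->
    `|partial1of2 g r c| <= `|M|.
  move=> /inI rI _; rewrite p3// normrM (le_trans (ler_piMr _ (sin_le1 _)))//.
  by rewrite (le_trans (hM _ _ rI (dot_sphere_point _ _)))// ler_norm.
have hder := @derivable_under_integral R _ _ _ g _ (@measurable_chart R) r0 a b r0I p1 p2
  (fun=> `|M|) (fun=> normr_ge0 M) p4 p5.
have heq := @differentiation_under_integral R _ _ _ g _ (@measurable_chart R) r0 a b r0I p1 p2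
  (fun=> `|M|) (fun=> normr_ge0 M) p4 p5.
apply: DeriveDef; first exact: hder.
rewrite -derive1E heq; apply: eq_Rintegral => c _.
by rewrite p3.
Qed.

End differentiation.

Section newtonian.
Variable R : realType.
Implicit Types (r s : R) (y w : 'cV[R]_3) (P : pol R).

(** For unit vectors w and y, the inverse distance from r w to y, as a function
    of r and of s = <w, y>. *)
Definition newton r s : R := (Num.sqrt (1 - 2 * r * s + r ^+ 2))^-1.

Lemma newton_den_gt0 r s : -1 <= s <= 1 -> -1 < r < 1 -> 0 < 1 - 2 * r * s + r ^+ 2.
Proof.
move=> /andP[s0 s1] /andP[r0 r1].
(* Affine in s, hence a convex combination of the values at s = -1 and 1. *)
rewrite (_ : 1 - 2 * r * s + r ^+ 2 =
  (1 - s) / 2 * (1 + r) ^+ 2 + (1 + s) / 2 * (1 - r) ^+ 2); last by field.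
have a0 : 0 < (1 + r) ^+ 2 by rewrite exprn_gt0//; lra.
have b0 : 0 < (1 - r) ^+ 2 by rewrite exprn_gt0//; lra.
have [->|s1'] := eqVneq s 1; first by rewrite subrr !mul0r add0r mulr_gt0//; lra.
have {}s1 : 0 < 1 - s by rewrite subr_gt0 lt_neqAle s1'.
apply: ltr_pwDl; first by apply: mulr_gt0 => //; lra.
by apply: mulr_ge0; [lra|exact: ltW].
Qed.

Lemma newton_sqr r s : 0 < 1 - 2 * r * s + r ^+ 2 ->
  newton r s ^+ 2 * (1 - 2 * r * s + r ^+ 2) = 1.
Proof.
move=> q0; rewrite /newton exprVn sqr_sqrtr ?ltW// mulVf// gt_eqF//.
Qed.

Lemma newton_ge0 r s : 0 <= newton r s.
Proof. by rewrite invr_ge0 sqrtr_ge0. Qed.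

Lemma newton_der_r r s : 0 < 1 - 2 * r * s + r ^+ 2 ->
  is_derive r 1 (newton ^~ s) ((s - r) * newton r s ^+ 3).
Proof.
move=> q0.
pose q r := 1 - 2 * r * s + r ^+ 2.
have dq : is_derive r 1 q (2 * (r - s)).
  have h1 := derM (derZ 2 (derid r)) (dercst s r).
  have h2 := derX 2 (derid r).
  by apply: (is_derive_eq (derD (derB (dercst 1 r) h1) h2)) => /=; ring.
by apply: (is_derive_eq (@der_rsqrt R q r _ q0 dq)); rewrite /newton /q; set k := _^-1 ^+ 3; field.
Qed.

Lemma newton_der_s r s : 0 < 1 - 2 * r * s + r ^+ 2 ->
  is_derive s 1 (newton r) (r * newton r s ^+ 3).
Proof.
move=> q0.
pose q s := 1 - 2 * r * s + r ^+ 2.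
have dq : is_derive s 1 q (- (2 * r)).
  by apply: (is_derive_eq (derD (derB (dercst 1 s) (derZ (2 * r) (derid s))) (dercst _ s))); ring.
by apply: (is_derive_eq (@der_rsqrt R q s _ q0 dq)); rewrite /newton /q; set k := _^-1 ^+ 3; field.
Qed.

Lemma measurable_newton r : measurable_fun [set: R] (newton r).
Proof.
apply: (@measurableT_comp _ _ _ _ _ _ (fun q : R => (Num.sqrt q)^-1) _
  (fun s => 1 - 2 * r * s + r ^+ 2)); first exact: measurable_rsqrt.
by apply: measurable_funD => //; apply: measurable_funB => //; exact: measurable_funM.
Qed.

Lemma newton_zonal r : -1 < r < 1 -> zonal_C1 (newton r) (fun s => r * newton r s ^+ 3).
Proof.
move=> hr; have q0 s (hs : -1 <= s <= 1) := newton_den_gt0 hs hr.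
split.
- by move=> s /q0; exact: newton_der_s.
- by move=> s /q0 h; exact: der_cont (derZ r (derX 3 (newton_der_s h))).
- exact: measurable_newton.
- apply: measurable_funM; first exact: measurable_cst.
  by apply: measurable_funX; exact: measurable_newton.
Qed.

Lemma newton_zonal' r : -1 < r < 1 ->
  zonal_C1 (fun s => r * newton r s ^+ 3) (fun s => 3 * r ^+ 2 * newton r s ^+ 5).
Proof.
move=> hr; have q0 s (hs : -1 <= s <= 1) := newton_den_gt0 hs hr.
split.
- move=> s /q0 h; apply: (is_derive_eq (derZ r (derX 3 (newton_der_s h)))).
  by rewrite /=; ring.
- by move=> s /q0 h; exact: der_cont (derZ _ (derX 5 (newton_der_s h))).
- apply: measurable_funM; first exact: measurable_cst.
  by apply: measurable_funX; exact: measurable_newton.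
- apply: measurable_funM; first exact: measurable_cst.
  by apply: measurable_funX; exact: measurable_newton.
Qed.

(** The kernel r ^ (n + 1) (D - n) newton, where D = r d/dr.  Its r-derivative
    is r ^ n (D + n + 1) (D - n) newton, which the Legendre operator in s
    expresses: this is harmonicity of the Newtonian kernel. *)
Definition wronskian n r s : R :=
  r ^+ n.+1 * (r * (s - r) * newton r s ^+ 3 - n%:R * newton r s).

Definition newton_legendre r s : R :=
  (1 - s ^+ 2) * (3 * r ^+ 2 * newton r s ^+ 5) - 2 * s * (r * newton r s ^+ 3).

Lemma wronskian_der n r s : 0 < 1 - 2 * r * s + r ^+ 2 ->
  is_derive r 1 (wronskian n ^~ s)
    (- r ^+ n * (newton_legendre r s + n%:R * (n%:R + 1) * newton r s)).
Proof.
move=> q0; have dk := newton_der_r q0.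
have d1 := derM (derid r) (derB (dercst s r) (derid r)).
have d2 := derB (derM d1 (derX 3 dk)) (derZ n%:R dk).
apply: (is_derive_eq (derM (derX n.+1 (derid r)) d2)).
have := newton_sqr q0; rewrite /newton_legendre /=.
set k := newton r s => hk.
have -> : (1 - s ^+ 2) * (3 * r ^+ 2 * k ^+ 5) =
    3 * r ^+ 2 * k ^+ 3 * (k ^+ 2 * (1 - 2 * r * s + r ^+ 2)) - 3 * r ^+ 2 * (s - r) ^+ 2 * k ^+ 5.
  by ring.
by rewrite hk (_ : n.+1%:R = n%:R + 1) ?natr1// [r ^+ n.+1]exprS; ring.
Qed.


End newtonian.

Section potential.
Variable R : realType.
Implicit Types (r s : R) (y : 'cV[R]_3).
Variables (w : 'cV[R]_3) (w1 : dot w w = 1).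

Lemma newton_bounded (b : R) : b < 1 ->
  bounded_on (fun c : R * 'cV[R]_3 => - b < c.1 < b /\ dot c.2 c.2 = 1)
    (fun c => newton c.1 (dot w c.2)).
Proof.
move=> b1; exists (1 - b)^-1 => -[r y] /= [/andP[r0 r1] y1].
have /andP[s0 s1] := dot_le1 w1 y1; set s := dot w y in s0 s1 *.
rewrite ger0_norm ?newton_ge0// /newton.
have h : (1 - b) ^+ 2 <= 1 - 2 * r * s + r ^+ 2.
  rewrite (_ : 1 - 2 * r * s + r ^+ 2 =
    (1 - s) / 2 * (1 + r) ^+ 2 + (1 + s) / 2 * (1 - r) ^+ 2); last by field.
  rewrite (_ : (1 - b) ^+ 2 = (1 - s) / 2 * (1 - b) ^+ 2 + (1 + s) / 2 * (1 - b) ^+ 2);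
    last by field.
  by apply: lerD; apply: ler_wpM2l; do ?lra; apply: lerXn2r; rewrite ?nnegrE; lra.
rewrite lef_pV2 ?posrE; [|by rewrite sqrtr_gt0 (lt_le_trans _ h)// exprn_gt0//; lra|lra].
rewrite (_ : 1 - b = Num.sqrt ((1 - b) ^+ 2)) ?ler_wsqrtr//.
by rewrite sqrtr_sqr ger0_norm//; lra.
Qed.

Lemma zonal_potential_der (P : pol R) (h dh : R -> R -> R) r0 : -1 < r0 < 1 ->
  (forall r s, -1 < r < 1 -> -1 <= s <= 1 -> is_derive r 1 (h ^~ s) (dh r s)) ->
  (forall r, measurable_fun [set: R] (h r)) ->
  (forall b, b < 1 -> bounded_on (fun c : R * 'cV[R]_3 => - b < c.1 < b /\ dot c.2 c.2 = 1)
    (fun c => h c.1 (dot w c.2))) ->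
  (forall b, b < 1 -> bounded_on (fun c : R * 'cV[R]_3 => - b < c.1 < b /\ dot c.2 c.2 = 1)
    (fun c => dh c.1 (dot w c.2))) ->
  is_derive r0 1 (fun r => sphere_integral (fun y => eval P y * h r (dot w y)))
    (sphere_integral (fun y => eval P y * dh r0 (dot w y))).
Proof.
move=> hr0 hd mh bh bdh; pose b := (1 + `|r0|) / 2.
have r01 : `|r0| < 1 by rewrite ltr_norml.
have /andP[rb1 rb2] : - b < r0 < b by rewrite -ltr_norml /b; lra.
have b1 : b < 1 by rewrite /b; lra.
have bI r : - b < r < b -> -1 < r < 1 by move=> /andP[? ?]; apply/andP; split; lra.
apply: (@sphere_integral_derive R (fun r y => eval P y * h r (dot w y))
  (fun r y => eval P y * dh r (dot w y)) (- b) b); first by rewrite rb1.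
- by move=> r _; apply: smM; [exact: sm_eval|exact: sm_zonal].
- move=> r hr; apply: boM; first exact: sb_eval.
  by have [M hM] := bh b b1; exists M => y y1; exact: (hM (r, y)).
- move=> r y hr y1; apply: derZ; apply: hd; [exact: bI|exact: dot_le1].
- have [M hM] := bdh b b1; have [N hN] := sb_eval P.
  by exists (N * M) => r y hr y1; rewrite normrM ler_pM// ?hN// (hM (r, y)).
Qed.

Definition newton_potential P r :=
  sphere_integral (fun y => eval P y * newton r (dot w y)).

Lemma radius_bounded (b : R) :
  bounded_on (fun c : R * 'cV[R]_3 => - b < c.1 < b /\ dot c.2 c.2 = 1) (fun c => c.1).
Proof. by exists b => c [hc _]; rewrite ltW// ltr_norml. Qed.

Lemma cosine_bounded (b : R) :
  bounded_on (fun c : R * 'cV[R]_3 => - b < c.1 < b /\ dot c.2 c.2 = 1)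
    (fun c => dot w c.2).
Proof. by exists 1 => c [_ hc]; rewrite ler_norml dot_le1. Qed.

Lemma newton_potential_der P r : -1 < r < 1 ->
  is_derive r 1 (newton_potential P)
    (sphere_integral (fun y => eval P y * ((dot w y - r) * newton r (dot w y) ^+ 3))).
Proof.
move=> hr.
apply: (@zonal_potential_der P (@newton R) (fun r s => (s - r) * newton r s ^+ 3) r hr) => //.
- by move=> {hr}r s hr hs; exact: newton_der_r (newton_den_gt0 hs hr).
- exact: measurable_newton.
- exact: newton_bounded.
- move=> b b1; apply: boM; last by apply: boX; exact: newton_bounded.
  by apply: boB; [exact: cosine_bounded|exact: radius_bounded].
Qed.

Lemma newton_pow_int (Q : pol R) r m : -1 < r < 1 ->
  sphere_integrable (fun y => eval Q y * newton r (dot w y) ^+ m).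
Proof.
move=> hr; apply: (@zonal_integrable R Q (fun s => newton r s ^+ m)) => //.
  by apply: measurable_funX; exact: measurable_newton.
have [M hM] := zonal_bounded (newton_zonal hr).
by apply: (@boX _ _ (fun s : R => -1 <= s <= 1)); exists M.
Qed.

Definition dot_pol : pol R :=
  Add (Mul (Cst (w ix ord0)) (Var R ix))
    (Add (Mul (Cst (w iy ord0)) (Var R iy)) (Mul (Cst (w iz ord0)) (Var R iz))).

Section spherical.
Variables (P : pol R) (n : nat).
Hypothesis hP : forall y, dot y y = 1 ->
  eval (casimir P) y = - (n%:R * (n%:R + 1)) * eval P y.

Let q r := sphere_integral (fun y => eval P y * wronskian n r (dot w y)).

Let zi Q f df (hf : zonal_C1 f df) : sphere_integrable (fun y => eval Q y * f (dot w y)).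
Proof. exact: zonal_integrable (zonal_meas hf) (zonal_bounded hf). Qed.

Let zdi Q f df (hf : zonal_C1 f df) : sphere_integrable (fun y => eval Q y * df (dot w y)).
Proof. exact: zonal_integrable (zonal_dmeas hf) (zonal_dbounded hf). Qed.

Let legendre_int r : -1 < r < 1 ->
  sphere_integrable (fun y => eval P y * newton_legendre r (dot w y)).
Proof.
move=> hr; have hk := newton_zonal' hr.
apply: zonal_integrable => //.
  apply: measurable_funB.
    apply: measurable_funM; last exact: zonal_dmeas hk.
    by apply: measurable_funB => //; exact: measurable_funX.
  by apply: measurable_funM; [exact: measurable_funM|exact: zonal_meas hk].
have [M hM] := zonal_bounded hk; have [N hN] := zonal_dbounded hk.
have bs : bounded_on (fun s : R => -1 <= s <= 1) id by exists 1 => s; rewrite ler_norml.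
apply: (@boB R R (fun s : R => -1 <= s <= 1)); apply: boM.
- by apply: boB; [exact: bo_cst|exact: boX].
- by exists N.
- by apply: boM => //; exact: bo_cst.
- by exists M.
Qed.

Let q_der r : -1 < r < 1 -> is_derive r 1 q 0.
Proof.
move=> hr.
have -> : 0 = sphere_integral (fun y => eval P y *
    (- r ^+ n * (newton_legendre r (dot w y) + n%:R * (n%:R + 1) * newton r (dot w y)))).
  rewrite (@sphere_integral_ext _ _ (fun y =>
    - r ^+ n * (eval P y * newton_legendre r (dot w y)
     - eval (casimir P) y * newton r (dot w y)))); last first.
    by move=> y /hP ->; ring.
  rewrite sphere_integralZ ?sphere_integralB.
  - by rewrite (casimir_by_parts P w1 (newton_zonal hr) (newton_zonal' hr)) subrr mulr0.
  - exact: legendre_int.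
  - exact: zi (newton_zonal hr).
  - have := sphere_integrableD (legendre_int hr)
      (sphere_integrable_scale (-1) (zi (casimir P) (newton_zonal hr))).
    by congr sphere_integrable; apply/funext => y; rewrite mulN1r.
apply: (@zonal_potential_der P (@wronskian R n)
  (fun r s => - r ^+ n * (newton_legendre r s + n%:R * (n%:R + 1) * newton r s)) r hr) => //.
- by move=> {hr}r s hr hs; exact: wronskian_der (newton_den_gt0 hs hr).
- move=> {hr}r; apply: measurable_funM => //; apply: measurable_funB.
    apply: measurable_funM; last by apply: measurable_funX; exact: measurable_newton.
    by apply: measurable_funM => //; exact: measurable_funB.
  by apply: measurable_funM => //; exact: measurable_newton.
- move=> b b1; have := newton_bounded b1.
  move: (@radius_bounded b) (@cosine_bounded b) => br bs bk.
  by do ?[apply: boM | apply: boB | apply: boD | apply: boX | exact: bo_cst | exact: br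
    | exact: bs | exact: bk].
- move=> b b1; have := newton_bounded b1.
  move: (@radius_bounded b) (@cosine_bounded b) => br bs bk.
  by do ?[exact: br | exact: bs | exact: bk | exact: bo_cst | apply: boX | apply: boM
    | apply: boB | apply: boD | apply: boN].
Qed.

(** Along a ray the potential F of P solves (D + n + 1) (D - n) F = 0, with
    D = r d/dr.  Its r ^ n (D - n) F is thus a constant over r, which the value at
    the centre excludes unless it is zero; there remains D F = n F. *)
Lemma euler_potential r : 0 < r < 1 ->
  sphere_integral (fun y => eval P y * (r * (dot w y - r) * newton r (dot w y) ^+ 3)) =
  n%:R * newton_potential P r.
Proof.
move=> /andP[r0 r1]; have hr : -1 < r < 1 by apply/andP; split; lra.
have : q 0 = q r.
  apply: der0_const; first exact: ltW.
    apply: continuous_in_subspaceT => t; rewrite inE /= in_itv /= => /andP[t0 t1].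
    by apply: (der_cont (q_der (r := t) _)); apply/andP; split; lra.
  by move=> t /andP[t0 t1]; apply: q_der; apply/andP; split; lra.
rewrite /q (@sphere_integral_ext _ _ (fun y => 0 * 1)); last first.
  by move=> y _; rewrite /wronskian exprS !mul0r mulr0.
rewrite sphere_integralZ; last by apply: sphere_integrableP; [exact: sm_cst|exact: bo_cst].
have i1 := newton_pow_int P 1 hr.
have i3 := newton_pow_int (Mul P (Mul (Cst r) (Sub dot_pol (Cst r)))) 3 hr.
rewrite (@sphere_integral_ext _ (fun y => eval P y * wronskian n r (dot w y)) (fun y =>
    r ^+ n.+1 * (eval (Mul P (Mul (Cst r) (Sub dot_pol (Cst r)))) y * newton r (dot w y) ^+ 3
      - n%:R * (eval P y * newton r (dot w y) ^+ 1)))); last first.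
  by move=> y _; rewrite /wronskian /= dotE; ring.
rewrite mul0r sphere_integralZ; last first.
  have := sphere_integrableD i3 (sphere_integrable_scale (- n%:R) i1).
  by congr sphere_integrable; apply/funext => y; rewrite mulNr.
rewrite sphere_integralB//; last exact: sphere_integrable_scale.
rewrite sphere_integralZ// => /esym/eqP.
rewrite mulf_eq0 expf_eq0 /= (gt_eqF r0) /= subr_eq0 => /eqP h.
rewrite /newton_potential; under [X in n%:R * sphere_integral X]eq_fun do rewrite -[newton _ _]expr1.
rewrite -h; apply: sphere_integral_ext => y _ /=; rewrite dotE; ring.
Qed.

(** The operator 2 D + 1 turns the Newtonian kernel into the Poisson kernel, and
    acts on F as 2 n + 1. *)
Lemma potential_poisson r : 0 < r < 1 ->
  (2 * n%:R + 1) * newton_potential P r =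
  sphere_integral (fun y => eval P y * ((1 - r ^+ 2) * newton r (dot w y) ^+ 3)).
Proof.
move=> hr0; have /andP[r0 r1] := hr0; have hr : -1 < r < 1 by apply/andP; split; lra.
have i1 := newton_pow_int P 1 hr.
have i3 := newton_pow_int (Mul P (Mul (Cst r) (Sub dot_pol (Cst r)))) 3 hr.
have i3' : sphere_integrable (fun y => eval P y * (r * (dot w y - r) * newton r (dot w y) ^+ 3)).
  by move: i3; congr sphere_integrable; apply/funext => y; rewrite /= dotE; ring.
rewrite mulrDl mul1r -mulrA -(euler_potential hr0) -sphere_integralZ// /newton_potential.
rewrite -sphere_integralD.
- apply: sphere_integral_ext => y y1.
  have := newton_sqr (newton_den_gt0 (dot_le1 w1 y1) hr).
  set s := dot w y; set k := newton r s => hk.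
  transitivity (eval P y * (2 * (r * (s - r) * k ^+ 3) +
    k * (k ^+ 2 * (1 - 2 * r * s + r ^+ 2)))); first by rewrite hk; ring.
  by ring.
- exact: sphere_integrable_scale.
- by move: i1; congr sphere_integrable; apply/funext => y; rewrite expr1.
Qed.

Lemma potential_homogeneous r1 r2 : 0 < r1 -> r1 <= r2 -> r2 < 1 ->
  newton_potential P r1 / r1 ^+ n = newton_potential P r2 / r2 ^+ n.
Proof.
move=> r10 r12 r21.
pose G r := newton_potential P r * (r ^+ n)^-1.
have dG r : 0 < r < 1 -> is_derive r 1 G 0.
  move=> hr0; have /andP[r0 r1'] := hr0; have hr : -1 < r < 1 by apply/andP; split; lra.
  have rn0 : r ^+ n != 0 by rewrite expf_eq0 (gt_eqF r0) andbF.
  have dV := @derV _ (fun r => r ^+ n) r _ rn0 (derX n (derid r)).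
  apply: (is_derive_eq (derM (newton_potential_der P hr) dV)).
  have i3 := newton_pow_int (Mul P (Sub dot_pol (Cst r))) 3 hr.
  have e : r * sphere_integral (fun y => eval P y *
      ((dot w y - r) * newton r (dot w y) ^+ 3)) = n%:R * newton_potential P r.
    rewrite -(euler_potential hr0) -sphere_integralZ.
      by apply: sphere_integral_ext => y _; ring.
    by move: i3; congr sphere_integrable; apply/funext => y; rewrite /= dotE; ring.
  move: e; set I := sphere_integral _ => e.
  have {e}-> : I = n%:R * newton_potential P r / r by rewrite -e mulrAC mulfV ?mul1r// gt_eqF.
  have [->|n0] := posnP n; first by rewrite /=; ring.
  rewrite -(prednK n0) /= exprS; field.
  by rewrite (gt_eqF r0) expf_eq0 (gt_eqF r0) andbF.
apply: (@der0_const _ G) => //.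
- apply: continuous_in_subspaceT => t; rewrite inE /= in_itv /= => /andP[t0 t1].
  by apply: (der_cont (dG t _)); apply/andP; split; lra.
- by move=> t /andP[t0 t1]; apply: dG; apply/andP; split; lra.
Qed.

End spherical.

Lemma casimir_cst (c : R) y : eval (casimir (Cst c)) y = 0.
Proof. by rewrite casimirE /=; ring. Qed.

(** In degree 0 the relation D F = 0 says that the potential of a homogeneous
    shell is constant in the ball; at the centre it is the area. *)
Lemma newton_shell r : 0 < r < 1 ->
  sphere_integral (fun y => newton r (dot w y)) = 4 * pi.
Proof.
move=> /andP[r0 r1].
have hP y : dot y y = 1 -> eval (casimir (Cst 1)) y = - (0%:R * (0%:R + 1)) * eval (Cst (1 : R)) y.
  by rewrite casimir_cst !mul0r oppr0 mul0r.
have hI t : -1 < t < 1 -> {for t, continuous (newton_potential (Cst 1))}.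
  by move=> ht; exact: der_cont (newton_potential_der (Cst 1) ht).
have : newton_potential (Cst 1) 0 = newton_potential (Cst 1) r.
  apply: der0_const; first exact: ltW.
  - apply: continuous_in_subspaceT => t; rewrite inE /= in_itv /= => /andP[t0 t1].
    by apply: hI; apply/andP; split; lra.
  - move=> t /andP[t0 t1]; have ht : -1 < t < 1 by apply/andP; split; lra.
    have ht0 : 0 < t < 1 by apply/andP; split; lra.
    apply: (is_derive_eq (newton_potential_der (Cst 1) ht)).
    have i3 := newton_pow_int (Sub dot_pol (Cst t)) 3 ht.
    have := euler_potential hP ht0; rewrite mul0r => e.
    apply/eqP; suff : t * sphere_integral (fun y => eval (Cst 1) y *
        ((dot w y - t) * newton t (dot w y) ^+ 3)) = 0.
      by move/eqP; rewrite mulf_eq0 (gt_eqF t0).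
    rewrite -e -sphere_integralZ; first by apply: sphere_integral_ext => y _; ring.
    by move: i3; congr sphere_integrable; apply/funext => y; rewrite /= dotE; ring.
move=> e; transitivity (newton_potential (Cst 1) r).
  by apply: sphere_integral_ext => y _; rewrite mul1r.
rewrite -e -[RHS]sphere_area; apply: sphere_integral_ext => y _.
by rewrite /= /newton mulr0 mul0r subr0 expr0n /= addr0 sqrtr1 invr1 mulr1.
Qed.

Lemma poisson_mass r : 0 < r < 1 ->
  sphere_integral (fun y => (1 - r ^+ 2) * newton r (dot w y) ^+ 3) = 4 * pi.
Proof.
move=> hr.
have hP y : dot y y = 1 -> eval (casimir (Cst 1)) y = - (0%:R * (0%:R + 1)) * eval (Cst (1 : R)) y.
  by rewrite casimir_cst !mul0r oppr0 mul0r.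
have := potential_poisson hP hr; rewrite mulr0 add0r mul1r => e.
rewrite -[RHS](newton_shell hr).
transitivity (newton_potential (Cst 1) r).
  by rewrite e; apply: sphere_integral_ext => y _; rewrite mul1r.
by apply: sphere_integral_ext => y _; rewrite mul1r.
Qed.

End potential.

Section potential_value.
Variable R : realType.
Implicit Types (r s : R) (y w : 'cV[R]_3) (P : pol R).

Lemma dot_subr w y : dot w w = 1 -> dot y y = 1 -> dot (y - w) (y - w) = 2 - 2 * dot w y.
Proof.
rewrite !dotE !mxE => hw hy.
set a := w ix ord0 in hw *; set b := w iy ord0 in hw *; set c := w iz ord0 in hw *.
set x := y ix ord0 in hy *; set t := y iy ord0 in hy *; set z := y iz ord0 in hy *.
transitivity ((a * a + b * b + c * c) + (x * x + t * t + z * z)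
  - 2 * (a * x + b * t + c * z)); first by ring.
by rewrite hw hy; ring.
Qed.

Lemma sphere_lipschitz P : exists C, forall y w, dot y y = 1 -> dot w w = 1 ->
  `|eval P y - eval P w| <= C * Num.sqrt (2 - 2 * dot w y).
Proof.
elim: P => [c|i|P [C hC] Q [D hD]|P [C hC] Q [D hD]].
- by exists 0 => y w _ _; rewrite subrr normr0 mul0r.
- exists 1 => y w hy hw; rewrite mul1r -dot_subr//= -sqrtr_sqr ler_wsqrtr//.
  by have := coord_sqr_le (y - w) i; rewrite !mxE.
- exists (C + D) => y w hy hw /=; rewrite mulrDl.
  rewrite (_ : _ - _ = (eval P y - eval P w) + (eval Q y - eval Q w)); last by ring.
  by rewrite (le_trans (ler_normD _ _))// lerD ?hC ?hD.
- have [M hM] := sb_eval P; have [N hN] := sb_eval Q.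
  exists (C * N + M * D) => y w hy hw /=; rewrite mulrDl.
  rewrite (_ : _ - _ = (eval P y - eval P w) * eval Q y
    + eval P w * (eval Q y - eval Q w)); last by ring.
  rewrite (le_trans (ler_normD _ _))// !normrM lerD//.
    by rewrite mulrAC ler_pM ?hC ?hN.
  by rewrite -mulrA ler_pM ?hD ?hM.
Qed.

(** The distance from w to y is at most twice the distance from r w to y, as r w
    is no closer to y than to the sphere. *)
Lemma chord_newton r s : -1 <= s <= 1 -> 0 < r -> 0 < 1 - 2 * r * s + r ^+ 2 ->
  Num.sqrt (2 - 2 * s) * newton r s <= 2.
Proof.
move=> /andP[s0 s1] r0 q0; rewrite /newton ler_pdivrMr ?sqrtr_gt0//.
have e q : 2 * Num.sqrt q = Num.sqrt (2 ^+ 2 * q) :> R.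
  by rewrite sqrtrM ?sqr_ge0// sqrtr_sqr ger0_norm.
rewrite e ler_wsqrtr//.
have h1 : 0 <= (1 + s) * (1 - r) ^+ 2 by rewrite mulr_ge0 ?sqr_ge0//; lra.
have h2 : 0 <= (1 - s) * (r * (r + 2)) by rewrite mulr_ge0// ?mulr_ge0//; lra.
lra.
Qed.

Section interior.
Variables (w : 'cV[R]_3) (w1 : dot w w = 1) (P : pol R).

(** The Poisson kernel concentrates at w.  Its mass and that of the Newtonian
    kernel k are known exactly; the Lipschitz bound costs one power of k, and
    k ^ 2 is at most (e k ^ 3 + k / e) / 2 with e ^ 2 = 1 - r ^ 2. *)
Lemma poisson_error : exists K, forall r, 0 < r < 1 ->
  `|sphere_integral (fun y => eval P y * ((1 - r ^+ 2) * newton r (dot w y) ^+ 3))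
    - 4 * pi * eval P w| <= K * Num.sqrt (1 - r ^+ 2).
Proof.
have [C hC] := sphere_lipschitz P.
exists (`|C| * (8 * pi)) => r hr0; have /andP[r0 r1] := hr0.
have hr : -1 < r < 1 by apply/andP; split; lra.
pose e := Num.sqrt (1 - r ^+ 2); rewrite -/e.
have r2 : 0 < 1 - r ^+ 2 by rewrite subr_gt0 expr_lt1// ltW.
have e0 : 0 < e by rewrite sqrtr_gt0.
have ee : e ^+ 2 = 1 - r ^+ 2 by rewrite sqr_sqrtr// ltW.
have i1 := newton_pow_int w1 (Cst 1) 1 hr.
have i3 := newton_pow_int w1 (Cst (1 - r ^+ 2)) 3 hr.
have iP := newton_pow_int w1 (Mul (Sub P (Cst (eval P w))) (Cst (1 - r ^+ 2))) 3 hr.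
have -> : sphere_integral (fun y => eval P y * ((1 - r ^+ 2) * newton r (dot w y) ^+ 3))
    - 4 * pi * eval P w = sphere_integral (fun y =>
      eval (Mul (Sub P (Cst (eval P w))) (Cst (1 - r ^+ 2))) y * newton r (dot w y) ^+ 3).
  rewrite -(poisson_mass w1 hr0) mulrC -sphere_integralZ// -sphere_integralB.
  - by apply: sphere_integral_ext => y _ /=; ring.
  - have := newton_pow_int w1 (Mul P (Cst (1 - r ^+ 2))) 3 hr.
    by congr sphere_integrable; apply/funext => y /=; ring.
  - exact: sphere_integrable_scale.
have -> : `|C| * (8 * pi) * e = sphere_integral (fun y =>
    `|C| * e * (eval (Cst (1 - r ^+ 2)) y * newton r (dot w y) ^+ 3
      + eval (Cst 1) y * newton r (dot w y) ^+ 1)).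
  rewrite sphere_integralZ; last exact: sphere_integrableD.
  rewrite sphere_integralD// (_ : sphere_integral _ = 4 * pi); last exact: poisson_mass.
  rewrite (_ : sphere_integral _ = 4 * pi); first by ring.
  by rewrite -(newton_shell w1 hr0); apply: sphere_integral_ext => y _; rewrite mul1r.
apply: sphere_integral_norm_le => //.
  by apply: sphere_integrable_scale; exact: sphere_integrableD.
move=> y y1 /=; have hs := dot_le1 w1 y1.
have q0 := newton_den_gt0 hs hr; have k0 := newton_ge0 r (dot w y).
have hk := chord_newton hs r0 q0.
set s := dot w y in hs q0 k0 hk *; set k := newton r s in k0 hk *.
rewrite mulN1r -ee normrM normrM [`|e ^+ 2|]ger0_norm ?sqr_ge0// [`|k ^+ 3|]ger0_norm ?exprn_ge0//.
have h1 : `|eval P y - eval P w| * k <= `|C| * 2.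
  apply: (@le_trans _ _ (`|C| * Num.sqrt (2 - 2 * s) * k)).
    rewrite ler_wpM2r// (le_trans (hC y w y1 w1))// ler_wpM2r ?sqrtr_ge0// ler_norm//.
  by rewrite -mulrA ler_wpM2l.
apply: (@le_trans _ _ (`|C| * 2 * (e ^+ 2 * k ^+ 2))).
  rewrite (_ : _ * _ * k ^+ 3 = `|eval P y - eval P w| * k * (e ^+ 2 * k ^+ 2)); last by ring.
  by rewrite ler_wpM2r// mulr_ge0 ?sqr_ge0.
rewrite -subr_ge0 (_ : _ - _ = `|C| * (e * k * (e * k - 1) ^+ 2)); last by ring.
by rewrite mulr_ge0// mulr_ge0 ?sqr_ge0// mulr_ge0// ltW.
Qed.

Variable n : nat.
Hypothesis hP : forall y, dot y y = 1 ->
  eval (casimir P) y = - (n%:R * (n%:R + 1)) * eval P y.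

(** F / r ^ n is constant on the ray, and the Poisson integral evaluates it in
    the limit r = 1. *)
Lemma newton_potential_in r : 0 < r < 1 ->
  newton_potential w P r = 4 * pi / (2 * n%:R + 1) * r ^+ n * eval P w.
Proof.
move=> /andP[r0 r1].
pose G := newton_potential w P r / r ^+ n.
have n0 : 2 * n%:R + 1 != 0 :> R by rewrite gt_eqF// ltr_wpDl// mulr_ge0.
have hG t : 0 < t < 1 -> newton_potential w P t = G * t ^+ n.
  move=> /andP[t0 t1]; have tn : t ^+ n != 0 by rewrite expf_eq0 (gt_eqF t0) andbF.
  have -> : G = newton_potential w P t / t ^+ n.
    by case/orP: (le_total t r) => h; rewrite /G;
      [rewrite -(potential_homogeneous w1 hP t0 h r1)
      |rewrite (potential_homogeneous w1 hP r0 h t1)].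
  by rewrite mulfVK.
have [K hK] := poisson_error.
have hGK t : 0 < t < 1 ->
    0 <= K * Num.sqrt (1 - t ^+ 2) - `|(2 * n%:R + 1) * (G * t ^+ n) - 4 * pi * eval P w|.
  by move=> ht; rewrite -hG// subr_ge0 (potential_poisson w1 hP ht) hK.
pose phi t := K * Num.sqrt (1 - t ^+ 2) - `|(2 * n%:R + 1) * (G * t ^+ n) - 4 * pi * eval P w|.
have cphi : phi t @[t --> 1^'-] --> phi 1.
  apply: cvg_at_left_filter; rewrite /phi; apply: cvgB.
    apply: cvgM; first exact: cvg_cst.
    apply: (@continuous_comp _ _ _ (fun t : R => 1 - t ^+ 2) Num.sqrt); last exact: sqrt_continuous.
    by apply: cvgB; [exact: cvg_cst|exact: exprn_continuous].
  apply: cvg_norm; apply: cvgB; last exact: cvg_cst.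
  apply: cvgM; first exact: cvg_cst.
  by apply: cvgM; [exact: cvg_cst|exact: exprn_continuous].
have : 0 <= phi 1.
  apply: (closed_cvg (fun x : R => 0 <= x) _ _ _ cphi); first exact: closed_ge.
  near=> t; apply: hGK; apply/andP; split; near: t.
    by apply: nbhs_left_gt; lra.
  exact: nbhs_left_lt.
rewrite /phi !expr1n subrr sqrtr0 mulr0 mulr1 sub0r oppr_ge0 normr_le0 subr_eq0 => /eqP hG1.
rewrite hG ?r0//; have -> : G = 4 * pi * eval P w / (2 * n%:R + 1) by rewrite -hG1; field.
by ring.
Unshelve. all: by end_near. Qed.

(** Inversion in the sphere exchanges the interior and the exterior. *)
Lemma newton_potential_out r : 1 < r ->
  newton_potential w P r = 4 * pi / (2 * n%:R + 1) * (r ^+ n.+1)^-1 * eval P w.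
Proof.
move=> r1; have r0 : 0 < r by lra.
have hr : 0 < r^-1 < 1 by rewrite invr_gt0 r0 invf_lt1.
transitivity (r^-1 * newton_potential w P r^-1).
  have hr' : -1 < r^-1 < 1 by have /andP[? ?] := hr; apply/andP; split; lra.
  rewrite /newton_potential -sphere_integralZ; last first.
    by have := newton_pow_int w1 P 1 hr'; congr sphere_integrable; apply/funext => y; rewrite expr1.
  apply: sphere_integral_ext => y _; rewrite mulrCA; congr (_ * _).
  rewrite /newton -invfM; congr _^-1.
  have e q : r * Num.sqrt q = Num.sqrt (r ^+ 2 * q).
    by rewrite sqrtrM ?sqr_ge0// sqrtr_sqr ger0_norm ?ltW.
  by rewrite e; congr Num.sqrt; field; rewrite gt_eqF.
rewrite newton_potential_in// exprVn exprS; field.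
rewrite (gt_eqF r0) expf_eq0 (gt_eqF r0) andbF /= gt_eqF// ltr_wpDl// mulr_ge0//.
Qed.

End interior.
End potential_value.

(** * The Kelvin kernel off the sphere *)

Section kelvin_potential.
Variable R : realType.
Implicit Types (r s h : R) (x y w : 'cV[R]_3) (P Y : pol R) (i j : 'I_3).

Definition idist x y : R := (enorm (x - y))^-1.

Definition dist_pol x : pol R :=
  let d i := Sub (Cst (x i ord0)) (Var R i) in
  Add (Mul (d ix) (d ix)) (Add (Mul (d iy) (d iy)) (Mul (d iz) (d iz))).

Lemma eval_dist_pol x y : eval (dist_pol x) y = dot (x - y) (x - y).
Proof. by rewrite dotE !mxE /=; ring. Qed.

Lemma idistE x y : idist x y = (Num.sqrt (eval (dist_pol x) y))^-1.
Proof. by rewrite /idist enormE eval_dist_pol. Qed.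

Lemma sm_idist x : sphere_measurable (idist x).
Proof.
rewrite (_ : idist x = fun y => (Num.sqrt (eval (dist_pol x) y))^-1).
  exact: (sm_comp (@measurable_rsqrt R) (@sm_eval R (dist_pol x))).
by apply/funext => y; rewrite idistE.
Qed.

Lemma idist_newton r w y : dot w w = 1 -> dot y y = 1 ->
  idist (r *: w) y = newton r (dot w y).
Proof.
move=> w1 y1; rewrite /idist /newton enormE; congr (Num.sqrt _)^-1.
rewrite !dotE !mxE in w1 y1 *.
transitivity (r ^+ 2 * (w ix ord0 * w ix ord0 + w iy ord0 * w iy ord0 + w iz ord0 * w iz ord0)
  + (y ix ord0 * y ix ord0 + y iy ord0 * y iy ord0 + y iz ord0 * y iz ord0)
  - 2 * r * (w ix ord0 * y ix ord0 + w iy ord0 * y iy ord0 + w iz ord0 * y iz ord0)); first by ring.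
by rewrite w1 y1; ring.
Qed.

Lemma dist_ge x y : dot y y = 1 -> `|enorm x - 1| <= enorm (x - y).
Proof.
move=> y1; rewrite [leRHS]enormE -sqrtr_sqr ler_wsqrtr//.
have cs := cauchy_schwarz x y; rewrite y1 mulr1 -enorm_sqr in cs.
have {}cs : dot x y <= enorm x.
  rewrite (le_trans (ler_norm _))// -(ler_pXn2r (ltn0Sn 1)) ?nnegrE ?enorm_ge0//.
  by rewrite real_normK// num_real.
have -> : dot (x - y) (x - y) = enorm x ^+ 2 + dot y y - 2 * dot x y.
  by rewrite enorm_sqr !dotE !mxE; ring.
by rewrite y1; nra.
Qed.

(** The bound of [dist_ge] is stable under small displacements along an axis. *)
Lemma dist_axis_ge x y i h (d : R) : dot y y = 1 -> 0 < d -> 2 * d <= `|enorm x - 1| ->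
  - d < h < d -> d ^+ 2 <= dot (axis_line i x h - y) (axis_line i x h - y).
Proof.
move=> y1 d0 dx hd; have := dist_ge x y1; set D := enorm (x - y) => hD.
have hd' : `|h| < d by rewrite ltr_norml.
have -> : dot (axis_line i x h - y) (axis_line i x h - y) =
    D ^+ 2 + 2 * (h * (x - y) i ord0) + h ^+ 2.
  rewrite /D enorm_sqr !dotE !mxE.
  by have [->|->|->] := ord3P i; rewrite ?eqxx ?eq3E /=; ring.
have hc : `|h * (x - y) i ord0| <= `|h| * D.
  rewrite normrM ler_wpM2l// -(ler_pXn2r (ltn0Sn 1)) ?nnegrE ?enorm_ge0//.
  by rewrite real_normK ?num_real// enorm_sqr coord_sqr_le.
have h2 : h ^+ 2 = `|h| ^+ 2 by rewrite real_normK ?num_real.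
rewrite h2; move: hc; rewrite ler_norml => /andP[hc _].
apply: (@le_trans _ _ ((D - `|h|) ^+ 2)); last by lra.
by rewrite (ler_pXn2r (ltn0Sn 1)) ?nnegrE; lra.
Qed.

Lemma idist_axis_der x y i h :
  0 < dot (axis_line i x h - y) (axis_line i x h - y) ->
  is_derive h 1 (fun h => idist (axis_line i x h) y)
    (- (axis_line i x h i ord0 - y i ord0) * idist (axis_line i x h) y ^+ 3).
Proof.
move=> q0; pose q h := dot (axis_line i x h - y) (axis_line i x h - y).
have dq : is_derive h 1 q (2 * (axis_line i x h i ord0 - y i ord0)).
  have dl k := derB (axis_line_der i x h k) (dercst (y k ord0) h).
  rewrite (_ : q = fun h => (axis_line i x h ix ord0 - y ix ord0) ^+ 2 +
    (axis_line i x h iy ord0 - y iy ord0) ^+ 2 + (axis_line i x h iz ord0 - y iz ord0) ^+ 2).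
    apply: (is_derive_eq (derD (derD (derX 2 (dl ix)) (derX 2 (dl iy))) (derX 2 (dl iz)))).
    by rewrite !mxE; have [->|->|->] := ord3P i; rewrite !eqxx ?eq3E /=; ring.
  by apply/funext => t; rewrite /q dotE !mxE; ring.
rewrite (_ : (fun h => _) = (fun h => (Num.sqrt (q h))^-1)); last first.
  by apply/funext => t; rewrite /idist enormE.
apply: (is_derive_eq (@der_rsqrt R q h _ q0 dq)).
by rewrite /idist enormE -/(q h); set k := _^-1 ^+ 3; field.
Qed.

Lemma enorm_axis_der x i : 0 < enorm x ->
  is_derive (0 : R) 1 (fun h => enorm (axis_line i x h)) (normalize x i ord0).
Proof.
move=> x0; pose q h := dot (axis_line i x h) (axis_line i x h).
have dq : is_derive (0 : R) 1 q (2 * x i ord0).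
  have dl k := axis_line_der i x 0 k.
  rewrite (_ : q = fun h => axis_line i x h ix ord0 ^+ 2 +
    axis_line i x h iy ord0 ^+ 2 + axis_line i x h iz ord0 ^+ 2).
    apply: (is_derive_eq (derD (derD (derX 2 (dl ix)) (derX 2 (dl iy))) (derX 2 (dl iz)))).
    by rewrite !mxE; have [->|->|->] := ord3P i; rewrite !eqxx ?eq3E /=; ring.
  by apply/funext => t; rewrite /q dotE; ring.
have q0 : 0 < q 0 by rewrite /q axis_line0 -enorm_sqr exprn_gt0.
rewrite (_ : (fun h => _) = (fun h => Num.sqrt (q h))); last first.
  by apply/funext => t; rewrite enormE.
apply: (is_derive_eq (dercomp (is_derive1_sqrt q0) dq)).
by rewrite /q axis_line0 -enormE !mxE; field; rewrite gt_eqF.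
Qed.

(** A function constant along rays varies tangentially only, at a rate inversely
    proportional to the radius. *)
Lemma normalize_axis_der Y x i : 0 < enorm x ->
  is_derive (0 : R) 1 (fun h => eval Y (normalize (axis_line i x h)))
    ((enorm x)^-1 * eval (sgrad i Y) (normalize x)).
Proof.
move=> x0; have xn : enorm x != 0 by rewrite gt_eqF.
have dN : is_derive (0 : R) 1 (fun h => (enorm (axis_line i x h))^-1)
    (- (enorm x ^- 2) * normalize x i ord0).
  have xn0 : enorm (axis_line i x 0) != 0 by rewrite axis_line0.
  apply: (is_derive_eq (@derV R (fun h => enorm (axis_line i x h)) 0 _ xn0
    (enorm_axis_der i x0))).
  by rewrite /= axis_line0; ring.
pose dc : 'cV[R]_3 := \col_j ((- (enorm x ^- 2) * normalize x i ord0) * x j ord0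
  + (enorm x)^-1 * (delta_mx i ord0 : 'cV[R]_3) j ord0).
have hc j : is_derive (0 : R) 1 (fun h => normalize (axis_line i x h) j ord0)
    (dc j ord0).
  rewrite (_ : (fun h => _) = (fun h => (enorm (axis_line i x h))^-1 * axis_line i x h j ord0));
    last by apply/funext => h; rewrite mxE.
  apply: (is_derive_eq (derM dN (axis_line_der i x 0 j))).
  by rewrite /= axis_line0 [RHS]mxE.
have h1 := @eval_curve R Y (fun h => normalize (axis_line i x h)) (fun=> dc) 0 hc.
refine (is_derive_eq h1 _).
rewrite sgradE dot_normalize// mul1r /= axis_line0.
have e j : x j ord0 = enorm x * normalize x j ord0 by rewrite mxE mulrA mulfV ?mul1r.
rewrite !sum3 !mxE !e !eqxx.
have [->|->|->] := ord3P i; rewrite ?eqxx ?eq3E /=; by field.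
Qed.

Lemma surf_grad_eval Y x i : dot x x = 1 ->
  surf_grad (eval Y) x i ord0 = eval (sgrad i Y) x.
Proof.
move=> x1; have ex := enorm1 x1.
have x0 : 0 < enorm x by rewrite ex.
have := normalize_axis_der Y i x0; rewrite ex.
have -> : normalize x = x by rewrite /normalize ex invr1 scale1r.
rewrite invr1 mul1r => hd; rewrite -(@derive_val _ _ _ _ _ _ _ hd) mxE.
rewrite /derive; set f1 := (X in fmap X _); set f2 := (X in _ = lim (fmap X _)).
suff -> : f1 = f2 by [].
apply/funext => h; rewrite /f1 /f2 /= /axis_line scale0r addr0 addr0.
by rewrite /GRing.scale /= mulr1 [x + _]addrC.
Qed.

(** The decay along rays of the Newtonian potential of a spherical polynomial of
    degree n, inside and outside the sphere. *)
Definition radial n r : R := if r < 1 then r ^+ n else (r ^+ n.+1)^-1.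

(** The exponent of the power that [radial] is near r. *)
Definition growth n r : R := if r < 1 then n%:R else - (n%:R + 1).

Lemma radial_der n r : 0 < r -> r != 1 ->
  is_derive r 1 (radial n) (growth n r * radial n r / r).
Proof.
move=> r0 r1; have rn0 : r != 0 by rewrite gt_eqF.
rewrite /growth /radial; case: (ltP r 1) => hr.
  have dr : is_derive r 1 (fun z => z ^+ n) (n%:R * r ^+ n / r).
    apply: (is_derive_eq (derX n (derid r))).
    by case: n => [|n] /=; rewrite ?mul0r// exprS mulr1; field.
  apply: near_eq_is_derive dr; near=> z.
  by rewrite ifT//; near: z; exact: lt_nbhsl.
have {hr}r1' : 1 < r by rewrite lt_neqAle eq_sym r1.
have rn : r ^+ n.+1 != 0 by rewrite expf_eq0 (negbTE rn0) andbF.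
have dr : is_derive r 1 (fun z => (z ^+ n.+1)^-1) (- (n%:R + 1) * (r ^+ n.+1)^-1 / r).
  apply: (is_derive_eq (@derV R (fun z => z ^+ n.+1) r _ rn (derX n.+1 (derid r)))).
  by rewrite /= -natr1 [r ^+ n.+1]exprS; field; rewrite rn0 expf_eq0 (negbTE rn0) andbF.
apply: near_eq_is_derive dr; near=> z.
by rewrite ifF//; apply/negbTE; rewrite -leNgt ltW//; near: z; exact: lt_nbhsr.
Unshelve. all: by end_near. Qed.

Definition spherical n P := forall y, dot y y = 1 ->
  eval (casimir P) y = - (n%:R * (n%:R + 1)) * eval P y.

Lemma potential_off n P x : spherical n P -> 0 < enorm x -> enorm x != 1 ->
  sphere_integral (fun y => eval P y * idist x y) =
  4 * pi / (2 * n%:R + 1) * radial n (enorm x) * eval P (normalize x).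
Proof.
move=> hP x0 x1; have w1 := dot_normalize x0.
transitivity (newton_potential (normalize x) P (enorm x)).
  apply: sphere_integral_ext => y y1.
  by rewrite {1}(scale_normalize x0) idist_newton.
rewrite /radial; case: ltP => hx.
  by rewrite (newton_potential_in w1 hP)// x0.
by rewrite (newton_potential_out w1 hP)// lt_neqAle eq_sym x1.
Qed.

Lemma idist_bounded x : enorm x != 1 -> sphere_bounded (idist x).
Proof.
move=> x1; exists (`|enorm x - 1|^-1) => y y1.
have h0 : 0 < `|enorm x - 1| by rewrite normr_gt0 subr_eq0.
rewrite ger0_norm /idist ?invr_ge0 ?enorm_ge0// lef_pV2 ?posrE ?dist_ge//.
exact: lt_le_trans (dist_ge x y1).
Qed.

Lemma idist_integrable P x m : enorm x != 1 ->
  sphere_integrable (fun y => eval P y * idist x y ^+ m).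
Proof.
move=> x1; apply: sphere_integrableP.
  by apply: smM; [exact: sm_eval|apply: smX; exact: sm_idist].
by apply: boM; [exact: sb_eval|apply: boX; exact: idist_bounded].
Qed.

Section vector_density.
Variables (n l : nat) (c : R) (phi : 'I_3 -> pol R) (Y : pol R).
Hypothesis phi_sph : forall i, spherical n (phi i).
Hypothesis Y_sph : spherical l Y.
Hypothesis phi_normal : forall y, dot y y = 1 ->
  \sum_j y j ord0 * eval (phi j) y = c * eval Y y.

Definition diff_pol x : pol R :=
  Add (Mul (Sub (Cst (x ix ord0)) (Var R ix)) (phi ix))
    (Add (Mul (Sub (Cst (x iy ord0)) (Var R iy)) (phi iy))
       (Mul (Sub (Cst (x iz ord0)) (Var R iz)) (phi iz))).

(** A scalar potential whose gradient contains the non-isotropic part of the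
    Kelvin kernel applied to phi. *)
Definition Psi x := sphere_integral (fun y => eval (diff_pol x) y * idist x y).

Lemma Psi_off x : 0 < enorm x -> enorm x != 1 ->
  Psi x = c * (4 * pi / (2 * n%:R + 1) * (radial n (enorm x) * enorm x)
    - 4 * pi / (2 * l%:R + 1) * radial l (enorm x)) * eval Y (normalize x).
Proof.
move=> x0 x1.
have i1 P : sphere_integrable (fun y => eval P y * idist x y).
  by have := idist_integrable P 1 x1; congr sphere_integrable; apply/funext => y; rewrite expr1.
rewrite /Psi (@sphere_integral_ext _ _ (fun y => (x ix ord0 * (eval (phi ix) y * idist x y)
   + (x iy ord0 * (eval (phi iy) y * idist x y) + x iz ord0 * (eval (phi iz) y * idist x y)))
   - c * (eval Y y * idist x y))); last first.
  by move=> y y1; rewrite [c * (_ * _)]mulrA -phi_normal// sum3 /=; ring.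
have sI j := sphere_integrable_scale (x j ord0) (i1 (phi j)).
rewrite sphere_integralB; [|by do 2 (apply: sphere_integrableD => //)
  |exact: sphere_integrable_scale].
rewrite sphere_integralD//; last exact: sphere_integrableD.
rewrite sphere_integralD// !sphere_integralZ//.
rewrite !(potential_off (phi_sph _) x0 x1) (potential_off Y_sph x0 x1).
have := phi_normal (dot_normalize x0); rewrite sum3.
have e j : x j ord0 = enorm x * normalize x j ord0.
  by rewrite mxE mulrA mulfV ?mul1r// gt_eqF.
rewrite !e; set A := normalize x ix ord0; set B := normalize x iy ord0.
set C := normalize x iz ord0 => h.
transitivity (4 * pi / (2 * n%:R + 1) * (radial n (enorm x) * enorm x) *
  (A * eval (phi ix) (normalize x) + B * eval (phi iy) (normalize x)
   + C * eval (phi iz) (normalize x)) - c * (4 * pi / (2 * l%:R + 1) * radial l (enorm x) *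
  eval Y (normalize x))); first by ring.
by rewrite h; ring.
Qed.

(** The part (x - y) (x - y)^T / |x - y| ^ 3 of the Kelvin kernel. *)
Definition double_kernel x i := sphere_integral (fun y =>
  (x i ord0 - y i ord0) * eval (diff_pol x) y * idist x y ^+ 3).

Lemma Psi_axis_der x i : enorm x != 1 ->
  is_derive (0 : R) 1 (fun h => Psi (axis_line i x h))
    (sphere_integral (fun y => eval (phi i) y * idist x y) - double_kernel x i).
Proof.
move=> x1; pose d := `|enorm x - 1| / 2.
have d0 : 0 < d by rewrite divr_gt0// normr_gt0 subr_eq0.
have dd : 2 * d <= `|enorm x - 1| by rewrite /d; lra.
pose df h y := eval (phi i) y * idist (axis_line i x h) y - eval (diff_pol (axis_line i x h)) y *
  ((axis_line i x h i ord0 - y i ord0) * idist (axis_line i x h) y ^+ 3).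
have -> : sphere_integral (fun y => eval (phi i) y * idist x y) - double_kernel x i =
    sphere_integral (df 0).
  rewrite -sphere_integralB.
  - by apply: sphere_integral_ext => y _; rewrite /df axis_line0; ring.
  - by have := idist_integrable (phi i) 1 x1; congr sphere_integrable; apply/funext => y; rewrite expr1.
  - have := idist_integrable (Mul (Sub (Cst (x i ord0)) (Var R i)) (diff_pol x)) 3 x1.
    by congr sphere_integrable; apply/funext => y /=; ring.
have qd h y : - d < h < d -> dot y y = 1 ->
    d ^+ 2 <= dot (axis_line i x h - y) (axis_line i x h - y).
  by move=> hd y1; exact: dist_axis_ge dd hd.
have bi : bounded_on (fun p : R * 'cV[R]_3 => - d < p.1 < d /\ dot p.2 p.2 = 1)
    (fun p => idist (axis_line i x p.1) p.2).
  exists d^-1 => -[h y] /= [hd y1]; have := qd h y hd y1 => hq.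
  have : d <= enorm (axis_line i x h - y).
    rewrite -(ler_pXn2r (ltn0Sn 1)) ?nnegrE ?enorm_ge0 ?(ltW d0)// enorm_sqr.
    exact: hq.
  move=> hq'; rewrite /idist ger0_norm ?invr_ge0 ?enorm_ge0//.
  by rewrite lef_pV2 ?posrE// (lt_le_trans d0).
have bc j : bounded_on (fun p : R * 'cV[R]_3 => - d < p.1 < d /\ dot p.2 p.2 = 1)
    (fun p => axis_line i x p.1 j ord0 - p.2 j ord0).
  exists (`|x j ord0| + d + 1) => -[h y] /= [hd y1].
  rewrite axis_lineE (le_trans (ler_normB _ _))// lerD ?coord_le1//.
  rewrite (le_trans (ler_normD _ _))// lerD// normrM.
  apply: (@le_trans _ _ `|h|); last by rewrite ltW// ltr_norml.
  by apply: ler_piMr => //; case: (j == i); rewrite ?normr1 ?normr0.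
have bP P : bounded_on (fun p : R * 'cV[R]_3 => - d < p.1 < d /\ dot p.2 p.2 = 1)
    (fun p => eval P p.2).
  by have [M hM] := sb_eval P; exists M => p [_ hp]; exact: hM.
have bd : bounded_on (fun p : R * 'cV[R]_3 => - d < p.1 < d /\ dot p.2 p.2 = 1)
    (fun p => eval (diff_pol (axis_line i x p.1)) p.2).
  have b j : bounded_on (fun p : R * 'cV[R]_3 => - d < p.1 < d /\ dot p.2 p.2 = 1)
    (fun p => (axis_line i x p.1 j ord0 - p.2 j ord0) * eval (phi j) p.2) by exact: boM.
  have [M hM] := boD (boD (b ix) (b iy)) (b iz).
  by exists M => p /hM; rewrite /= !mulN1r addrA.
apply: (@sphere_integral_derive R (fun h y => eval (diff_pol (axis_line i x h)) y *
  idist (axis_line i x h) y) df (- d) d).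
- by rewrite d0 oppr_lt0 d0.
- by move=> h _; apply: smM; [exact: sm_eval|exact: sm_idist].
- move=> h hd; have [M hM] := boM bd bi.
  by exists M => y y1; exact: (hM (h, y) (conj hd y1)).
- move=> h y hd y1; have q0 := lt_le_trans (exprn_gt0 2 d0) (qd h y hd y1).
  have dl k := derB (axis_line_der i x h k) (dercst (y k ord0) h).
  have dm k := derM (dl k) (dercst (eval (phi k) y) h).
  have := derM (derD (derD (dm ix) (dm iy)) (dm iz)) (idist_axis_der q0).
  rewrite (_ : (fun s => _ * _) = (fun h => eval (diff_pol (axis_line i x h)) y *
    idist (axis_line i x h) y)).
    move=> hder; apply: (is_derive_eq hder); rewrite /df /= !mxE.
    by have [->|->|->] := ord3P i; rewrite !eqxx ?eq3E /=; ring.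
  by apply/funext => t /=; ring.
- have [M hM] := boB (boM (bP (phi i)) bi) (boM bd (boM (bc i) (boX 3 bi))).
  by exists M => h y hd y1; exact: (hM (h, y) (conj hd y1)).
Qed.

(** On the rays, Psi is a radial profile g times Y, so its gradient is known; the
    second-order part of the Kelvin kernel follows. *)
Lemma double_kernel_off x i : 0 < enorm x -> enorm x != 1 ->
  double_kernel x i =
  4 * pi / (2 * n%:R + 1) * radial n (enorm x) * eval (phi i) (normalize x)
  - c * ((4 * pi / (2 * n%:R + 1) * (growth n (enorm x) + 1) * radial n (enorm x)
      - 4 * pi / (2 * l%:R + 1) * growth l (enorm x) * radial l (enorm x) / enorm x)
        * (normalize x i ord0 * eval Y (normalize x))
    + (4 * pi / (2 * n%:R + 1) * radial n (enorm x)
      - 4 * pi / (2 * l%:R + 1) * radial l (enorm x) / enorm x)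
        * eval (sgrad i Y) (normalize x)).
Proof.
move=> x0 x1.
pose g z := c * (4 * pi / (2 * n%:R + 1) * (radial n z * z)
  - 4 * pi / (2 * l%:R + 1) * radial l z).
have hg := derZ c (derB (derZ (4 * pi / (2 * n%:R + 1)) (derM (radial_der n x0 x1) (derid _)))
  (derZ (4 * pi / (2 * l%:R + 1)) (radial_der l x0 x1))).
move: hg; set dg := (X in is_derive _ _ _ X) => hg.
have ce : {for 0, continuous (fun h => enorm (axis_line i x h))}.
  exact: der_cont (enorm_axis_der i x0).
have near0 (A : set R) : nbhs (enorm x) A -> \forall h \near 0, A (enorm (axis_line i x h)).
  by move=> hA; apply: ce; rewrite /= axis_line0.
have dG : is_derive (0 : R) 1 (fun h => g (enorm (axis_line i x h)) *
    eval Y (normalize (axis_line i x h)))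
    (dg * normalize x i ord0 * eval Y (normalize x)
     + g (enorm x) / enorm x * eval (sgrad i Y) (normalize x)).
  have hg' : is_derive (enorm (axis_line i x 0)) 1 g dg by rewrite axis_line0.
  have hge := @dercomp R g (fun h => enorm (axis_line i x h)) 0 _ _ hg' (enorm_axis_der i x0).
  apply: (is_derive_eq (derM hge (normalize_axis_der Y i x0))).
  by rewrite axis_line0 mulrA.
have PsiG : \forall h \near 0, g (enorm (axis_line i x h)) *
    eval Y (normalize (axis_line i x h)) = Psi (axis_line i x h).
  near=> h; rewrite Psi_off.
  - by [].
  - near: h; apply: (near0 (fun z => 0 < z)); exact: lt_nbhsr.
  - near: h; apply: (near0 (fun z => z != 1)).
    by apply: open_nbhs_nbhs; split; [exact: open_neq|].
have dPsi := near_eq_is_derive PsiG dG.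
have := der_unique (Psi_axis_der i x1) dPsi.
rewrite (potential_off (phi_sph i) x0 x1) /dg /g => e.
have -> : double_kernel x i = 4 * pi / (2 * n%:R + 1) * radial n (enorm x) *
    eval (phi i) (normalize x) - (4 * pi / (2 * n%:R + 1) * radial n (enorm x) *
    eval (phi i) (normalize x) - double_kernel x i) by ring.
rewrite e; field; rewrite !gt_eqF//.
Unshelve. all: by end_near. Qed.

End vector_density.
End kelvin_potential.

Section layer.
Variable R : realType.
Implicit Types (r s : R) (x y w v : 'cV[R]_3) (i j : 'I_3).
Variables (mu lambda : R) (hmu : 0 < mu) (hlambda : 0 < 2 * mu + 3 * lambda).

Lemma lame_gt0 : 0 < lambda + 2 * mu.
Proof. by move: hmu hlambda => h1 h2; lra. Qed.

Let A := (lambda + 3 * mu) / (lambda + 2 * mu).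
Let B := (lambda + mu) / (lambda + 2 * mu).

Lemma kelvinE x y v i : (kelvin mu lambda (x - y) *m v) i ord0 =
  (8 * pi * mu)^-1 * (A * (v i ord0 * idist x y)
    + B * ((x i ord0 - y i ord0) * (\sum_j (x j ord0 - y j ord0) * v j ord0) * idist x y ^+ 3)).
Proof.
rewrite mxE !sum3 !mxE ![(8 * pi * mu * _)^-1]invfM -!exprVn -/(idist x y) -/A -/B.
by have [->|->|->] := ord3P i; rewrite !eqxx ?eq3E /=; ring.
Qed.

Section density.
Variables (phi : 'I_3 -> pol R) (phi0 : 'cV[R]_3 -> 'cV[R]_3).
Hypothesis phiE : forall y, dot y y = 1 -> forall j, phi0 y j ord0 = eval (phi j) y.

Let K x i y := (8 * pi * mu)^-1 * (A * (eval (phi i) y * idist x y)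
  + B * ((x i ord0 - y i ord0) * eval (diff_pol phi x) y * idist x y ^+ 3)).

Lemma layer_integralE x i :
  layer_integral mu lambda phi0 x i ord0 = sphere_integral (K x i).
Proof.
rewrite mxE; apply: sphere_integral_ext => y y1.
by rewrite kelvinE /K !phiE// sum3 /= !phiE//; congr (_ * (_ + _ * (_ * _ * _))); ring.
Qed.

Lemma layer_off n l (c : R) (Y : pol R) x i :
  (forall j, spherical n (phi j)) -> spherical l Y ->
  (forall y, dot y y = 1 -> \sum_j y j ord0 * eval (phi j) y = c * eval Y y) ->
  0 < enorm x -> enorm x != 1 ->
  layer_integral mu lambda phi0 x i ord0 =
  (8 * pi * mu)^-1 * (2 * (4 * pi / (2 * n%:R + 1) * radial n (enorm x))
      * eval (phi i) (normalize x)
    - B * (c * ((4 * pi / (2 * n%:R + 1) * (growth n (enorm x) + 1) * radial n (enorm x)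
      - 4 * pi / (2 * l%:R + 1) * growth l (enorm x) * radial l (enorm x) / enorm x)
        * (normalize x i ord0 * eval Y (normalize x))
    + (4 * pi / (2 * n%:R + 1) * radial n (enorm x)
      - 4 * pi / (2 * l%:R + 1) * radial l (enorm x) / enorm x)
        * eval (sgrad i Y) (normalize x)))).
Proof.
move=> hphi hY hn x0 x1.
have i1 := idist_integrable (phi i) 1 x1.
have i3 := idist_integrable (Mul (Sub (Cst (x i ord0)) (Var R i)) (diff_pol phi x)) 3 x1.
rewrite layer_integralE (@sphere_integral_ext _ _ (fun y => (8 * pi * mu)^-1 *
  (A * (eval (phi i) y * idist x y ^+ 1) + B * (eval (Mul (Sub (Cst (x i ord0)) (Var R i))
     (diff_pol phi x)) y * idist x y ^+ 3)))); last first.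
  by move=> y _; rewrite /K expr1 /=; ring.
rewrite sphere_integralZ; last by apply: sphere_integrableD; exact: sphere_integrable_scale.
rewrite sphere_integralD; [|exact: sphere_integrable_scale..].
rewrite !sphere_integralZ//; congr (_ * _).
have -> : sphere_integral (fun y => eval (phi i) y * idist x y ^+ 1) =
    4 * pi / (2 * n%:R + 1) * radial n (enorm x) * eval (phi i) (normalize x).
  by rewrite -(potential_off (hphi i) x0 x1); apply: sphere_integral_ext => y _; rewrite expr1.
have -> : sphere_integral (fun y => eval (Mul (Sub (Cst (x i ord0)) (Var R i))
     (diff_pol phi x)) y * idist x y ^+ 3) = double_kernel phi x i.
  by apply: sphere_integral_ext => y _ /=; ring.
rewrite (double_kernel_off hphi hY hn i x0 x1).
have -> : A = 2 - B by rewrite /A /B; field; rewrite gt_eqF// lame_gt0.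
by ring.
Qed.

Section boundary.
Variables (w : 'cV[R]_3) (w1 : dot w w = 1).

Lemma newton_lim r s : -1 <= s < 1 -> 0 < r -> 0 < 1 - 2 * r * s + r ^+ 2.
Proof.
move=> /andP[s0 s1] r0; have h1 : 0 < r * (1 - s) by rewrite mulr_gt0// subr_gt0.
by have h2 := sqr_ge0 (1 - r); lra.
Qed.

(** Fatou's lemma along r -> 1, where the integrals keep the value 4 pi. *)
Lemma newton1_integrable : sphere_integrable (fun y => newton 1 (dot w y)).
Proof.
pose rk k : R := 1 - k.+2%:R^-1.
have rk01 k : 0 < rk k < 1.
  rewrite /rk subr_gt0 invf_lt1 ?ltr0n// ltr1n/=.
  by rewrite gtrDl oppr_lt0 invr_gt0 ltr0n.
have rkr k : -1 < rk k < 1 by have /andP[? ?] := rk01 k; apply/andP; split; lra.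
have rk1 : rk k @[k --> \oo] --> (1 : R).
  rewrite -[X in _ --> X]subr0; apply: cvgB; first exact: cvg_cst.
  by have := @cvg_harmonic R; rewrite -(cvg_shiftS (@harmonic R : nat -> R^o)).
pose F k (a : measurableTypeR R * measurableTypeR R) :=
  (newton (rk k) (dot w (sphere_point a.1 a.2)) * sin a.1)%:E.
have mF r : measurable_fun [set: measurableTypeR R * measurableTypeR R] (fun a =>
    newton r (dot w (sphere_point a.1 a.2)) * sin a.1).
  by apply: measurable_funM; [exact: (sm_zonal w (measurable_newton r))|exact: measurable_sin_fst].
have F0 k a : (`[0, pi] `*` `[0, 2 * pi])%classic a -> (0 <= F k a)%E.
  by move=> ha; rewrite lee_fin mulr_ge0 ?newton_ge0 ?(sin_chart ha).
have intF k : (\int[(@lebesgue_measure R \x @lebesgue_measure R)]_(a in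
    `[0%R, pi] `*` `[0%R, (2 * pi)%R]) F k a = (4 * pi)%:E)%E.
  have i1 := newton_pow_int w1 (Cst 1) 1 (rkr k).
  have {}i1 : sphere_integrable (fun y => newton (rk k) (dot w y)).
    by move: i1; congr sphere_integrable; apply/funext => y; rewrite expr1 mul1r.
  rewrite -(newton_shell w1 (rk01 k)) /sphere_integral /Rintegral fineK//.
  exact: (integrable_fin_num (@measurable_chart R) i1).
apply/integrableP; split.
  by apply/measurable_EFinP/measurable_funTS; exact: mF.
apply: (@le_lt_trans _ _ (4 * pi)%:E); last exact: ltry.
have mFE k : measurable_fun (`[0, pi] `*` `[0, 2 * pi])%classic (F k).
  by apply/measurable_EFinP/measurable_funTS; exact: mF.
have := fatou (@lebesgue_measure R \x @lebesgue_measure R)%E (@measurable_chart R) mFE F0.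
under [X in (_ <= limn_einf X)%E -> _]eq_fun do rewrite intF.
rewrite (cvg_limn_einf_sup (cvg_cst _)).1 => /(le_trans _); apply.
apply: ge0_le_integral => //.
- exact: measurable_chart.
- apply: measurableT_comp => //; apply/measurable_EFinP/measurable_funTS; exact: mF.
- apply: (@measurableT_comp _ _ _ _ _ _ (@oppe R)); first exact: oppe_measurable.
  apply: (@measurable_fun_limn_esup _ _ _ _ (fun k a => - F k a)%E) => k.
  exact: (measurableT_comp (@oppe_measurable R _) (mFE k)).
move=> a ha; rewrite /= ger0_norm ?mulr_ge0 ?newton_ge0 ?(sin_chart ha)//.
have /andP[s0] := dot_le1 w1 (dot_sphere_point a.1 a.2).
rewrite le_eqVlt => /predU1P[s1|s1].
  rewrite s1 {1}/newton (_ : 1 - 2 * 1 * 1 + 1 ^+ 2 = 0) ?sqrtr0 ?invr0 ?mul0r; last by ring.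
  rewrite limn_einf_lim; apply: lime_ge.
    by apply: ereal_nondecreasing_is_cvgn; exact: nondecreasing_einfs.
  apply: nearW => k; apply: le_ereal_inf_tmp => _ [m /= _ <-]; exact: F0.
suff hc : F k a @[k --> \oo] --> (newton 1 (dot w (sphere_point a.1 a.2)) * sin a.1)%:E.
  by rewrite (cvg_limn_einf_sup hc).1.
apply: cvg_EFin; first exact: nearW.
apply: cvgM; last exact: cvg_cst.
have hs : -1 <= dot w (sphere_point a.1 a.2) < 1 by rewrite s0.
exact: (cvg_comp _ _ rk1 (der_cont (newton_der_r (newton_lim hs ltr01)))).
Qed.

(** A chart point over w has the polar angle of w, hence lies on a null line. *)
Lemma ae_off_pole : {ae (@lebesgue_measure R \x @lebesgue_measure R)%E,
  forall a : measurableTypeR R * measurableTypeR R,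
  (`[0, pi] `*` `[0, 2 * pi])%classic a -> dot w (sphere_point a.1 a.2) < 1}.
Proof.
exists ([set acos (w iz ord0)] `*` setT); split.
- by apply: measurableX; [exact: measurable_set1|exact: measurableT].
- by rewrite product_measure1E//= lebesgue_measure_set1 mul0e.
move=> a /= /not_implyP[[ha _] /negP]; rewrite -leNgt => s1; split=> //=.
have /andP[_ s1'] := dot_le1 w1 (dot_sphere_point a.1 a.2).
have e : dot w (sphere_point a.1 a.2) = 1 by apply/eqP; rewrite eq_le s1' s1.
have := coord_sqr_le (sphere_point a.1 a.2 - w) iz.
rewrite dot_subr ?dot_sphere_point// e mulr1 subrr => h.
have : (sphere_point a.1 a.2 - w) iz ord0 == 0.
  by rewrite -sqrf_eq0 eq_le h sqr_ge0.
rewrite !mxE val_iz /= subr_eq0 => /eqP <-.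
by rewrite cosK// inE.
Qed.

Lemma idist_coord_le x y j : `|x j ord0 - y j ord0| * idist x y <= 1.
Proof.
have [d0|d0] := eqVneq (enorm (x - y)) 0; first by rewrite /idist d0 invr0 mulr0.
have {}d0 : 0 < enorm (x - y) by rewrite lt_neqAle eq_sym d0 enorm_ge0.
rewrite /idist ler_pdivrMr// mul1r -(ler_pXn2r (ltn0Sn 1)) ?nnegrE ?enorm_ge0//.
by rewrite real_normK ?num_real// enorm_sqr; have := coord_sqr_le (x - y) j; rewrite !mxE.
Qed.

(** Each factor of x - y cancels one power of the inverse distance. *)
Lemma kelvin_bound i : exists C, forall x y, dot y y = 1 -> `|K x i y| <= C * idist x y.
Proof.
have [M hM] : exists M, forall j y, dot y y = 1 -> `|eval (phi j) y| <= M.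
  have [[M1 h1] [M2 h2] [M3 h3]] := And3 (sb_eval (phi ix)) (sb_eval (phi iy)) (sb_eval (phi iz)).
  exists (`|M1| + `|M2| + `|M3|) => j y y1.
  have [->|->|->] := ord3P j; [have := h1 y y1|have := h2 y y1|have := h3 y y1];
    have := (ler_norm M1, ler_norm M2, ler_norm M3);
    have := (normr_ge0 M1, normr_ge0 M2, normr_ge0 M3); move=> [[? ?] ?] [[? ?] ?] ?; lra.
exists (`|(8 * pi * mu)^-1| * (`|A| * M + `|B| * (M + M + M))) => x y y1.
have k0 : 0 <= idist x y by rewrite invr_ge0 enorm_ge0.
have M0 : 0 <= M by apply: le_trans (hM ix y y1).
rewrite /K normrM -[leRHS]mulrA ler_wpM2l// (le_trans (ler_normD _ _))// [leRHS]mulrDl lerD//.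
  by rewrite !normrM [`|idist x y|]ger0_norm// -[leRHS]mulrA ler_wpM2l// ler_wpM2r// hM.
rewrite normrM -[leRHS]mulrA ler_wpM2l//.
set S := eval (diff_pol phi x) y.
rewrite (_ : _ * _ ^+ 3 = (x i ord0 - y i ord0) * idist x y * (S * idist x y) * idist x y);
  last by ring.
rewrite normrM [`|idist x y|]ger0_norm// ler_wpM2r// normrM.
have h j : `|(x j ord0 - y j ord0) * idist x y| <= 1.
  by rewrite normrM [`|idist x y|]ger0_norm// idist_coord_le.
have hj j : `|(x j ord0 - y j ord0) * eval (phi j) y * idist x y| <= M.
  by rewrite mulrAC normrM -[leRHS]mul1r ler_pM ?h ?hM.
rewrite -[leRHS]mul1r ler_pM//.
rewrite (_ : S * _ = (x ix ord0 - y ix ord0) * eval (phi ix) y * idist x y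
  + (x iy ord0 - y iy ord0) * eval (phi iy) y * idist x y
  + (x iz ord0 - y iz ord0) * eval (phi iz) y * idist x y); last by rewrite /S /=; ring.
by rewrite (le_trans (ler_normD _ _))// lerD// (le_trans (ler_normD _ _))// lerD.
Qed.

Lemma sm_kelvin x i : sphere_measurable (K x i).
Proof.
have mi := sm_idist x.
apply: smM; first exact: sm_cst.
apply: smD; apply: smM; (try exact: sm_cst).
  by apply: smM => //; exact: sm_eval.
apply: smM; last exact: smX.
apply: smM; last exact: sm_eval.
by apply: smB; [exact: sm_cst|exact: sm_coord].
Qed.

Lemma idist_ray_integrable r : 0 < r -> sphere_integrable (idist (r *: w)).
Proof.
move=> r0; have [->|r1] := eqVneq r 1.
  apply: (sphere_integrable_le (sm_idist _) newton1_integrable) => y y1.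
  by rewrite idist_newton// ger0_norm ?newton_ge0.
apply: sphere_integrableP; first exact: sm_idist.
by apply: idist_bounded; rewrite enormZ1// ltW.
Qed.

(** Along the ray through a boundary point w the integrand is dominated by a
    multiple of the inverse distance from w, so the potential is continuous
    across the sphere. *)
Lemma layer_continuous i :
  {for 1, continuous (fun r => layer_integral mu lambda phi0 (r *: w) i ord0)}.
Proof.
rewrite (_ : (fun r => _) = (fun r => sphere_integral (K (r *: w) i))); last first.
  by apply/funext => r; exact: layer_integralE.
have [C hC] := kelvin_bound i.
pose f r (a : measurableTypeR R * measurableTypeR R) :=
  K (r *: w) i (sphere_point a.1 a.2) * sin a.1.
pose I : set R := [set` `]2^-1, 2[].
have I0 r : I r -> 0 < r by rewrite /I /= in_itv /= => /andP[h _]; lra.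
have intf r : I r -> (@lebesgue_measure R \x @lebesgue_measure R)%E.-integrable
    (`[0, pi] `*` `[0, 2 * pi]) (EFin \o f r).
  move=> /I0 r0; apply: (sphere_integrable_le (sm_kelvin _ i)
    (sphere_integrable_scale C (idist_ray_integrable r0))) => y; exact: hC.
have cf : {ae (@lebesgue_measure R \x @lebesgue_measure R)%E,
  forall a : measurableTypeR R * measurableTypeR R,
  (`[0, pi] `*` `[0, 2 * pi])%classic a -> {in I, continuous (f ^~ a)}}.
  apply: filterS ae_off_pole => a h ha r /set_mem /I0 r0.
  have s1 := h ha; have y1 := dot_sphere_point a.1 a.2.
  set y := sphere_point a.1 a.2 in s1 y1.
  have hs : -1 <= dot w y < 1 by rewrite s1 andbT; have /andP[] := dot_le1 w1 y1.
  have ck : {for r, continuous (fun r => idist (r *: w) y)}.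
    rewrite (_ : (fun r => _) = (fun r => newton r (dot w y))); last first.
      by apply/funext => t; rewrite idist_newton.
    exact: der_cont (newton_der_r (newton_lim hs r0)).
  have cd j : {for r, continuous (fun r => (r *: w) j ord0 - y j ord0)}.
    apply: cvgB; last exact: cvg_cst.
    under eq_fun do rewrite mxE.
    by rewrite mxE; apply: cvgM; [exact: cvg_id|exact: cvg_cst].
  have cS : {for r, continuous (fun r => eval (diff_pol phi (r *: w)) y)}.
    rewrite (_ : (fun r => _) = (fun r => ((r *: w) ix ord0 - y ix ord0) * eval (phi ix) y
      + ((r *: w) iy ord0 - y iy ord0) * eval (phi iy) y
      + ((r *: w) iz ord0 - y iz ord0) * eval (phi iz) y)).
      exact: (cvgD (cvgD (cvgM (cd ix) (cvg_cst _)) (cvgM (cd iy) (cvg_cst _)))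
        (cvgM (cd iz) (cvg_cst _))).
    by apply/funext => t /=; ring.
  apply: cvgM; last exact: cvg_cst.
  apply: cvgM; first exact: cvg_cst.
  apply: cvgD; apply: cvgM; (try exact: cvg_cst).
    by apply: cvgM; [exact: cvg_cst|exact: ck].
  apply: cvgM; first by apply: cvgM; [exact: cd|exact: cS].
  by apply: (@continuous_comp _ _ _ (fun r => idist (r *: w) y) (fun z => z ^+ 3));
    [exact: ck|exact: exprn_continuous].
have hg r : I r -> {ae (@lebesgue_measure R \x @lebesgue_measure R)%E,
  forall a : measurableTypeR R * measurableTypeR R,
  (`[0, pi] `*` `[0, 2 * pi])%classic a ->
  `|f r a| <= (`|C| * 2 * newton 1 (dot w (sphere_point a.1 a.2))) * sin a.1}.
  move=> /I0 r0; apply: filterS ae_off_pole => a h ha.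
  have s1 := h ha; have y1 := dot_sphere_point a.1 a.2.
  rewrite /f normrM [`|sin _|]ger0_norm ?(sin_chart ha)// ler_wpM2r ?(sin_chart ha)//.
  set y := sphere_point a.1 a.2 in s1 y1 *.
  have hs : -1 <= dot w y <= 1 := dot_le1 w1 y1.
  have hs' : -1 <= dot w y < 1 by rewrite s1 andbT; have /andP[] := hs.
  apply: (le_trans (hC _ _ y1)); rewrite idist_newton//.
  apply: (@le_trans _ _ (`|C| * newton r (dot w y))).
    by rewrite ler_wpM2r ?newton_ge0// ler_norm.
  rewrite -mulrA ler_wpM2l//.
  have := chord_newton hs r0 (newton_lim hs' r0).
  rewrite [newton 1 _]/newton (_ : 1 - 2 * 1 * dot w y + 1 ^+ 2 = 2 - 2 * dot w y); last by ring.
  by rewrite ler_pdivlMr ?sqrtr_gt0 ?subr_gt0 1?mulrC//; lra.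
have intg := sphere_integrable_scale (`|C| * 2) newton1_integrable.
have I1 : (1 : R) \in I by rewrite inE /I /= in_itv /=; lra.
exact: (@continuity_under_integral R _ _ _ f _ (@measurable_chart R) 2^-1 2 intf cf _ intg hg 1 I1).
Qed.

Lemma layer_boundary i (G : R -> R) : {for 1, continuous G} ->
  (forall r, 0 < r < 1 -> layer_integral mu lambda phi0 (r *: w) i ord0 = G r) ->
  layer_integral mu lambda phi0 w i ord0 = G 1.
Proof.
move=> cG JG; have cJ := @layer_continuous i.
have h1 := cvg_at_left_filter cJ; have h2 := cvg_at_left_filter cG.
rewrite scale1r in h1.
apply: (cvg_unique _ h1); first exact: Rhausdorff.
apply: cvg_trans h2; apply: near_eq_cvg; near=> r.
symmetry; apply: JG; apply/andP; split; near: r.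
  by apply: nbhs_left_gt; lra.
exact: nbhs_left_lt.
Unshelve. all: by end_near. Qed.

End boundary.
End density.
End layer.

(** * Spherical polynomials and the vector harmonics *)

Section eigen.
Variable R : realType.
Implicit Types (y : 'cV[R]_3) (P Q : pol R) (i j k : 'I_3).

(** Being an eigenfunction of the Casimir operator on the sphere, with a
    polynomial error factor: unlike the bare identity on the sphere, this form
    can be differentiated. *)
Definition eigen n P := exists Q, forall y,
  eval (casimir P) y = - (n%:R * (n%:R + 1)) * eval P y + (dot y y - 1) * eval Q y.

Lemma eigen_spherical n P : eigen n P -> spherical n P.
Proof. by move=> [Q hQ] y y1; rewrite hQ y1 subrr mul0r addr0. Qed.

Definition sqnorm_pol : pol R := Add (Mul (Var R ix) (Var R ix))
  (Add (Mul (Var R iy) (Var R iy)) (Mul (Var R iz) (Var R iz))).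

Lemma eigen_ext n P Q :
  (forall y, eval (casimir P) y = - (n%:R * (n%:R + 1)) * eval P y + (dot y y - 1) * eval Q y) ->
  eval (casimir P) =1 eval (Add (Mul (Cst (- (n%:R * (n%:R + 1)))) P)
    (Mul (Sub sqnorm_pol (Cst 1)) Q)).
Proof. by move=> hQ y; rewrite hQ dotE /=; ring. Qed.

Lemma eigen_rot n P j k : eigen n P -> eigen n (rot j k P).
Proof.
move=> [Q hQ]; exists (rot j k Q) => y.
rewrite casimir_rot !rotE !(pd_ext _ (eigen_ext hQ)) /= dotE.
by have [->|->|->] := ord3P j; have [->|->|->] := ord3P k; rewrite ?eqxx ?eq3E /=; ring.
Qed.

(** The surface gradient and the radial field of an eigenfunction span a space
    which the Casimir operator preserves, acting on it by a 2 x 2 matrix; these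
    are its two eigenvectors, of degrees n - 1 and n + 1. *)
Lemma eigen_comb n m (c : R) P i : eigen n P ->
  (c = n%:R /\ n = m.+1) \/ (c = - (n%:R + 1) /\ m = n.+1) ->
  eigen m (Add (sgrad i P) (Mul (Cst c) (Mul (Var R i) P))).
Proof.
move=> [Q hQ] hc.
have hext := eigen_ext hQ.
have hs y : eval (sgrad i (casimir P)) y = - (n%:R * (n%:R + 1)) * eval (sgrad i P) y
    + (dot y y - 1) * eval (sgrad i Q) y.
  rewrite !sgradE !sum3 !dotE !(pd_ext _ hext) /=.
  by have [->|->|->] := ord3P i; rewrite ?eqxx ?eq3E /=; ring.
exists (Add (sgrad i Q) (Mul (Cst (c - 2)) (Mul (Var R i) Q))) => y.
rewrite casimirD casimirZ casimir_sgrad casimir_var hs hQ /=.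
have [[-> ->]|[-> ->]] := hc; rewrite -natr1; ring.
Qed.

End eigen.

Section harmonics.
Variable R : realType.
Implicit Types (y : 'cV[R]_3) (P : pol R) (q : {poly R}).

Definition pol_of_poly q : pol R :=
  foldr (fun c P => Add (Mul P (Var R iz)) (Cst c)) (Cst 0) q.

Lemma eval_pol_of_poly q y : eval (pol_of_poly q) y = q.[y iz ord0].
Proof.
by rewrite /pol_of_poly /horner; elim: (polyseq q) => //= a s ->.
Qed.

Lemma pd_pol_of_poly q i y : eval (pd i (pol_of_poly q)) y =
  (if i == iz then (q^`()).[y iz ord0] else 0).
Proof.
have h := eval_pd (pol_of_poly q) i y 0; rewrite axis_line0 in h.
apply: (der_unique h).
under eq_fun do rewrite eval_pol_of_poly axis_lineE.
have d0 : is_derive (0 : R) 1 (fun h => y iz ord0 + h * (iz == i)%:R) ((iz == i)%:R).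
  by apply: (is_derive_eq (derD (dercst _ _) (derM (derid _) (dercst _ _)))); ring.
have dq : is_derive (y iz ord0 + 0 * (iz == i)%:R) 1 (horner q) (q^`()).[y iz ord0].
  by rewrite mul0r addr0; exact: is_derive_poly.
apply: (is_derive_eq (@dercomp R (horner q) _ 0 _ _ dq d0)).
by rewrite [iz == i]eq_sym; case: (i == iz); rewrite ?mulr1 ?mulr0.
Qed.

(** Homogeneous harmonic polynomials of degree k in the first two variables. *)
Record plane_harmonic (k : nat) (C : pol R) : Prop := PlaneHarmonic {
  plane_z : forall y, eval (pd iz C) y = 0;
  plane_euler : forall y, y ix ord0 * eval (pd ix C) y + y iy ord0 * eval (pd iy C) y
    = k%:R * eval C y;
  plane_laplace : forall y, eval (pd ix (pd ix C)) y + eval (pd iy (pd iy C)) y = 0 }.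

(** The associated Legendre operator, in the variable z. *)
Lemma casimir_plane_mul k C q y : plane_harmonic k C ->
  eval (casimir (Mul C (pol_of_poly q))) y = eval C y *
    ((dot y y - y iz ord0 ^+ 2) * (q^`()^`()).[y iz ord0]
     - 2 * (k%:R + 1) * y iz ord0 * (q^`()).[y iz ord0]
     - k%:R * (k%:R + 1) * q.[y iz ord0]).
Proof.
move=> [Cz Ce Cl].
have Qd i : eval (pd i (pol_of_poly q)) =1
    eval (if i == iz then pol_of_poly q^`() else Cst 0).
  by move=> z; rewrite pd_pol_of_poly; case: ifP => _ //; rewrite eval_pol_of_poly.
have Qdd i j z : eval (pd i (pd j (pol_of_poly q))) z =
    if j == iz then (if i == iz then (q^`()^`()).[z iz ord0] else 0) else 0.
  by rewrite (pd_ext i (Qd j)); case: (j == iz); rewrite // pd_pol_of_poly.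
have Czz i z : eval (pd i (pd iz C)) z = 0.
  by rewrite (@pd_ext _ i (pd iz C) (Cst 0)).
have Czz' i z : eval (pd iz (pd i C)) z = 0 by rewrite pdC.
have Ex : y ix ord0 * eval (pd ix (pd ix C)) y + y iy ord0 * eval (pd ix (pd iy C)) y
    = (k%:R - 1) * eval (pd ix C) y.
  have := @pd_ext _ ix (Add (Mul (Var R ix) (pd ix C)) (Mul (Var R iy) (pd iy C)))
    (Mul (Cst k%:R) C) Ce y.
  by rewrite /= !eqxx !eq3E /= => h; lra.
have Ey : y ix ord0 * eval (pd ix (pd iy C)) y + y iy ord0 * eval (pd iy (pd iy C)) y
    = (k%:R - 1) * eval (pd iy C) y.
  have := @pd_ext _ iy (Add (Mul (Var R ix) (pd ix C)) (Mul (Var R iy) (pd iy C)))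
    (Mul (Cst k%:R) C) Ce y.
  by rewrite /= !eqxx !eq3E /= pdCE => h; lra.
rewrite casimirE /= !Qdd !Czz ?Czz' !pd_pol_of_poly !eval_pol_of_poly Cz !eqxx !eq3E /= dotE.
move: (Ce y) (Cl y) Ex Ey.
set c := eval C y; set cx := eval (pd ix C) y; set cy := eval (pd iy C) y.
set cxx := eval (pd ix (pd ix C)) y; set cyy := eval (pd iy (pd iy C)) y.
set cxy := eval (pd ix (pd iy C)) y.
set X := y ix ord0; set Y := y iy ord0; set Z := y iz ord0.
set q0 := q.[Z]; set q1 := (q^`()).[Z]; set q2 := (q^`()^`()).[Z] => e1 e2 e3 e4.
transitivity ((X * X + Y * Y + Z * Z) * q0 * (cxx + cyy)
  + (X * X + Y * Y + Z * Z - Z ^+ 2) * c * q2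
  - q0 * (X * (X * cxx + Y * cxy) + Y * (X * cxy + Y * cyy))
  - 2 * Z * q1 * (X * cx + Y * cy) - 2 * q0 * (X * cx + Y * cy) - 2 * Z * c * q1); first by ring.
rewrite e2 e3 e4.
transitivity ((X * X + Y * Y + Z * Z - Z ^+ 2) * c * q2 - q0 * (k%:R - 1) * (X * cx + Y * cy)
  - 2 * Z * q1 * (X * cx + Y * cy) - 2 * q0 * (X * cx + Y * cy) - 2 * Z * c * q1); first by ring.
by rewrite e1; ring.
Qed.

(** The real and imaginary parts of (x + i y) ^ k. *)
Fixpoint plane_power k : pol R * pol R :=
  if k is k'.+1 then
    let (a, b) := plane_power k' in
    (Sub (Mul a (Var R ix)) (Mul b (Var R iy)), Add (Mul a (Var R iy)) (Mul b (Var R ix)))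
  else (Cst 1, Cst 0).

Lemma eval_plane_power k y :
  Complex (y ix ord0) (y iy ord0) ^+ k =
  Complex (eval (plane_power k).1 y) (eval (plane_power k).2 y).
Proof.
elim: k => [|k IH]; first by rewrite expr0.
rewrite exprSr IH /=; case: (plane_power k) => a b /=.
by rewrite {1}/GRing.mul /=; congr Complex; ring.
Qed.

(** The Cauchy-Riemann equations give harmonicity. *)
Lemma plane_power_harmonic k :
  plane_harmonic k (plane_power k).1 /\ plane_harmonic k (plane_power k).2.
Proof.
have [cr1 cr2 [z1 z2] [e1 e2]] :
  [/\ forall y, eval (pd ix (plane_power k).1) y = eval (pd iy (plane_power k).2) y,
      forall y, eval (pd iy (plane_power k).1) y = - eval (pd ix (plane_power k).2) y,
      (forall y, eval (pd iz (plane_power k).1) y = 0) /\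
      (forall y, eval (pd iz (plane_power k).2) y = 0)
    & (forall y, y ix ord0 * eval (pd ix (plane_power k).1) y
         + y iy ord0 * eval (pd iy (plane_power k).1) y = k%:R * eval (plane_power k).1 y) /\
      (forall y, y ix ord0 * eval (pd ix (plane_power k).2) y
         + y iy ord0 * eval (pd iy (plane_power k).2) y = k%:R * eval (plane_power k).2 y)].
  elim: k => [|k IH]; first by split=> [y|y||] /=; rewrite ?oppr0//; split=> y /=; ring.
  move: IH => /=; case: (plane_power k) => a b /= [cr1 cr2 [z1 z2] [e1 e2]].
  rewrite !eqxx !eq3E /=; split.
  - by move=> y; rewrite cr1 cr2; ring.
  - by move=> y; rewrite cr1 cr2; ring.
  - by split=> y; rewrite z1 z2; ring.
  - split=> y; rewrite -natr1.
      transitivity ((y ix ord0 * eval (pd ix a) y + y iy ord0 * eval (pd iy a) y) * y ix ord0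
        - (y ix ord0 * eval (pd ix b) y + y iy ord0 * eval (pd iy b) y) * y iy ord0
        + eval a y * y ix ord0 - eval b y * y iy ord0); first by ring.
      by rewrite e1 e2; ring.
    transitivity ((y ix ord0 * eval (pd ix a) y + y iy ord0 * eval (pd iy a) y) * y iy ord0
        + (y ix ord0 * eval (pd ix b) y + y iy ord0 * eval (pd iy b) y) * y ix ord0
        + eval a y * y iy ord0 + eval b y * y ix ord0); first by ring.
    by rewrite e1 e2; ring.
have cr2' y : eval (pd iy (plane_power k).1) y = eval (Opp (pd ix (plane_power k).2)) y.
  by rewrite cr2 /= mulN1r.
have cr1' y : eval (pd iy (plane_power k).2) y = eval (pd ix (plane_power k).1) y.
  by rewrite cr1.
split; split=> // y.
  by rewrite (pd_ext ix cr1) (pd_ext iy cr2') /= pdCE; ring.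
have cr3 z : eval (pd ix (plane_power k).2) z = eval (Opp (pd iy (plane_power k).1)) z.
  by rewrite /= cr2 mulN1r opprK.
by rewrite (pd_ext ix cr3) (pd_ext iy cr1') /= pdCE; ring.
Qed.

Lemma plane_harmonicZ (c : R) k C : plane_harmonic k C -> plane_harmonic k (Mul (Cst c) C).
Proof.
move=> [h1 h2 h3]; split=> y /=.
- by rewrite h1; ring.
- transitivity (c * (y ix ord0 * eval (pd ix C) y + y iy ord0 * eval (pd iy C) y)); first by ring.
  by rewrite h2; ring.
- transitivity (c * (eval (pd ix (pd ix C)) y + eval (pd iy (pd iy C)) y)); first by ring.
  by rewrite h3 mulr0.
Qed.

(** Successive derivatives of (X ^ 2 - 1) u' = 2 l X u for u = (X ^ 2 - 1) ^ l. *)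
Lemma rodrigues_ode (l j : nat) (u := ('X ^+ 2 - 1 : {poly R}) ^+ l) :
  ('X ^+ 2 - 1) * u^`(j.+2) + 2 * (j%:R + 1 - l%:R) * 'X * u^`(j.+1)
  + (j%:R + 1) * (j%:R - 2 * l%:R) * u^`(j) = 0.
Proof.
have base : ('X ^+ 2 - 1) * u^`() = 2 * l%:R * 'X * u.
  rewrite /u; case: l {u} => [|l]; first by rewrite !expr0 derivC; ring.
  rewrite deriv_exp /= derivB derivXn /= derivC subr0 expr1 -[_ *+ l.+1]mulr_natr -[_ *+ 2]mulr_natr [_ ^+ l.+1]exprS.
  by ring.
have dX2 (p : {poly R}) : (('X ^+ 2 - 1) * p)^`() = 2 * 'X * p + ('X ^+ 2 - 1) * p^`().
  by rewrite derivM derivB derivXn derivC /= subr0 expr1 -[_ *+ 2]mulr_natl.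
have dXk (c : R) (k p : {poly R}) : k = c%:P -> (k * 'X * p)^`() = k * (p + 'X * p^`()).
  by move=> ->; rewrite !derivM derivC derivX mul0r add0r mulr1 mulrDr mulrA.
have dk (c : R) (k p : {poly R}) : k = c%:P -> (k * p)^`() = k * p^`().
  by move=> ->; rewrite derivM derivC mul0r add0r.
have polyE := (polyCM, polyCB, polyCD, polyC_natr).
elim: j => [|j IH].
  have /(congr1 (@deriv R)) := base; rewrite dX2 (dXk (2 * l%:R)) ?polyE//.
  rewrite -[u^`()]derivn1 -!derivnS => h; rewrite derivn0.
  have {}h : ('X ^+ 2 - 1) * u^`(2) = 2 * l%:R * (u + 'X * u^`(1)) - 2 * 'X * u^`(1).
    by rewrite -h; ring.
  by rewrite h; ring.
have := congr1 (@deriv R) IH; rewrite derivC !derivD dX2.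
rewrite (dXk (2 * (j%:R + 1 - l%:R))) ?polyE//.
rewrite (dk ((j%:R + 1) * (j%:R - 2 * l%:R))) ?polyE// -!derivnS => h.
by rewrite -[RHS]h -!natr1; ring.
Qed.

Lemma legendre_ode l k (z : R) : let q := (legendre R l)^`(k) in
  (1 - z ^+ 2) * (q^`()^`()).[z] - 2 * (k%:R + 1) * z * (q^`()).[z]
  + (l%:R * (l%:R + 1) - k%:R * (k%:R + 1)) * q.[z] = 0.
Proof.
move=> q; rewrite {}/q /legendre; set c := (_ * _)^-1.
pose u := ('X ^+ 2 - 1 : {poly R}) ^+ l.
have qE : (c *: u^`(l))^`(k) = c *: u^`(l + k).
  by rewrite derivnZ /derivn -iterD addnC.
rewrite -/u qE !derivZ -!derivnS !hornerZ.
have h := congr1 (horner^~ z) (rodrigues_ode l (l + k)); move: h; rewrite -/u horner0 => h.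
rewrite -!(polyC_natr, polyCM, polyCB, polyCD) !hornerE natrD in h.
by rewrite -[RHS](mulr0 (- c)) -[X in _ = - c * X]h; ring.
Qed.

(** The spherical harmonic, extended off the sphere without homogenization. *)
Definition harm_pol l (m : int) : pol R :=
  Mul (Mul (Cst (sph_norm R l m))
      (if 0 <= m then (plane_power `|m|%N).1 else (plane_power `|m|%N).2))
    (pol_of_poly ((legendre R l)^`(`|m|%N))).

Lemma sph_harmE l m y : sph_harm l m y = eval (harm_pol l m) y.
Proof.
by rewrite /sph_harm eval_plane_power /= eval_pol_of_poly; case: ifP => _ /=; ring.
Qed.

Lemma harm_eigen l m : eigen l (harm_pol l m).
Proof.
set k := `|m|%N; pose q := (legendre R l)^`(k).
pose C := Mul (Cst (sph_norm R l m)) (if 0 <= m then (plane_power k).1 else (plane_power k).2).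
have hC : plane_harmonic k C.
  by apply: plane_harmonicZ; have [h1 h2] := plane_power_harmonic k; case: ifP.
exists (Mul C (pol_of_poly q^`()^`())) => y.
rewrite (casimir_plane_mul q y hC).
have /= := legendre_ode l k (y iz ord0); rewrite -/q => h.
rewrite -[LHS]subr0 -[X in _ - X](mulr0 (eval C y)) -[X in _ - eval C y * X]h.
by rewrite !eval_pol_of_poly -/k /=; ring.
Qed.

End harmonics.

(** * The layer potentials of the vector harmonics *)

Section vector_harmonics.
Variable R : realType.
Implicit Types (x y : 'cV[R]_3) (i j : 'I_3).
Variables (mu lambda : R) (hmu : 0 < mu) (hlambda : 0 < 2 * mu + 3 * lambda).
Variables (l : nat) (m : int) (hm : (`|m| <= l)%N).

Let L : R := l%:R.
Let Y := harm_pol R l m.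

(** The densities V and W, for c = - (l + 1) and c = l. *)
Definition grad_density (c : R) i : pol R :=
  Add (sgrad i Y) (Mul (Cst c) (Mul (Var R i) Y)).

Lemma grad_densityE c i y :
  eval (grad_density c i) y = eval (sgrad i Y) y + c * (y i ord0 * eval Y y).
Proof. by []. Qed.

Definition curl_density i : pol R :=
  if i == ix then rot iy iz Y else if i == iy then rot iz ix Y else rot ix iy Y.

Lemma sph_harm_fun : sph_harm l m = eval Y.
Proof. by apply/funext => y; exact: sph_harmE. Qed.

Lemma VsphE y : dot y y = 1 -> forall j,
  Vsph l m y j ord0 = eval (grad_density (- (L + 1)) j) y.
Proof.
move=> y1 j; rewrite /Vsph sph_harm_fun; have := surf_grad_eval Y j y1.
by move: (surf_grad _ _) => G eG; rewrite !mxE eG -/L /=; ring.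
Qed.

Lemma WsphE y : dot y y = 1 -> forall j, Wsph l m y j ord0 = eval (grad_density L j) y.
Proof.
move=> y1 j; rewrite /Wsph sph_harm_fun; have := surf_grad_eval Y j y1.
by move: (surf_grad _ _) => G eG; rewrite !mxE eG -/L /=; ring.
Qed.

Lemma XsphE y : dot y y = 1 -> forall j, Xsph l m y j ord0 = eval (curl_density j) y.
Proof.
move=> y1 j; rewrite /Xsph /cross sph_harm_fun.
have [->|->|->] := ord3P j; rewrite vec3E !surf_grad_eval// /curl_density ?eqxx ?eq3E
  rotE !sgradE y1 !sum3; ring.
Qed.

Lemma sgrad_normal y : dot y y = 1 -> \sum_j y j ord0 * eval (sgrad j Y) y = 0.
Proof.
move=> y1; rewrite sum3 !sgradE y1 !mul1r; set D := \sum_j _.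
transitivity ((1 - dot y y) * D); last by rewrite y1 subrr mul0r.
by rewrite /D dotE sum3; ring.
Qed.

Lemma grad_normal c y : dot y y = 1 ->
  \sum_j y j ord0 * eval (grad_density c j) y = c * eval Y y.
Proof.
move=> y1; transitivity (\sum_j y j ord0 * eval (sgrad j Y) y + c * dot y y * eval Y y).
  by rewrite dotE !sum3 /=; ring.
by rewrite sgrad_normal// y1 mulr1 add0r.
Qed.

Lemma curl_normal y : dot y y = 1 -> \sum_j y j ord0 * eval (curl_density j) y = 0 * eval Y y.
Proof. by move=> y1; rewrite sum3 /curl_density !eqxx !eq3E !rotE; ring. Qed.

Let Y_sph : spherical l Y.
Proof. exact: eigen_spherical (harm_eigen R l m). Qed.

Lemma V_spherical j : spherical l.+1 (grad_density (- (L + 1)) j).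
Proof. by apply/eigen_spherical/(eigen_comb j (harm_eigen R l m)); right. Qed.

(** Only the constants have degree zero, so that W vanishes then. *)
Lemma W_degree0 : l = 0%N -> forall j y, eval (grad_density L j) y = 0.
Proof.
move=> l0 j y; have m0 : `|m|%N = 0%N by apply/eqP; rewrite -leqn0 -l0.
have [c hY] : exists c, eval Y =1 eval (Cst c).
  exists (eval Y 0) => z; rewrite /Y /harm_pol m0 l0 /= !eval_pol_of_poly /legendre expr0.
  by case: (0 <= m); rewrite /= -polyC1 !hornerZ !hornerC.
by rewrite grad_densityE sgradE sum3 !(pd_ext _ hY) /L l0 /=; ring.
Qed.

Lemma W_spherical j : spherical l.-1 (grad_density L j).
Proof.
have [l0|l_gt0] := posnP l.
  move=> y _; rewrite (W_degree0 l0) mulr0 (@casimir_ext _ _ (Cst 0)) ?casimir_cst//.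
  by move=> z; rewrite (W_degree0 l0).
by apply/eigen_spherical/(eigen_comb j (harm_eigen R l m)); left; rewrite prednK.
Qed.

Lemma X_spherical j : spherical l (curl_density j).
Proof.
by apply/eigen_spherical; rewrite /curl_density; do ?case: ifP => _; apply: eigen_rot;
  exact: harm_eigen.
Qed.

Let mu0 : mu != 0. Proof. by rewrite gt_eqF. Qed.
Let lame0 : lambda + 2 * mu != 0. Proof. by rewrite gt_eqF// lame_gt0. Qed.
Let lame0' : 2 * mu + lambda != 0. Proof. by rewrite addrC. Qed.
Let L1 : 2 * L + 1 != 0. Proof. by rewrite gt_eqF// ltr_wpDl// mulr_ge0. Qed.
Let L3 : 2 * L + 3 != 0. Proof. by rewrite gt_eqF// ltr_wpDl// mulr_ge0. Qed.

Definition coefV : R :=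
  ((3 * L + 1) * mu + L * lambda) / ((2 * L + 3) * (2 * L + 1) * mu * (2 * mu + lambda)).
Definition coefW : R :=
  ((3 * L + 2) * mu + (L + 1) * lambda) / ((2 * L - 1) * (2 * L + 1) * mu * (2 * mu + lambda)).
Definition coefX : R := 1 / ((2 * L + 1) * mu).
Definition coefVW : R := (L + 1) * (mu + lambda) / (2 * (2 * L + 1) * mu * (2 * mu + lambda)).
Definition coefWV : R := L * (mu + lambda) / (2 * (2 * L + 1) * mu * (2 * mu + lambda)).

Section off.
Variables (x : 'cV[R]_3) (i : 'I_3).
Let r := enorm x.
Let V := eval (grad_density (- (L + 1)) i) (normalize x).
Let W := eval (grad_density L i) (normalize x).
Let X := eval (curl_density i) (normalize x).

Lemma V_in : 0 < r < 1 -> layer_integral mu lambda (Vsph l m) x i ord0 =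
  V * (coefV * (r ^+ l * r)) + W * (coefVW * (r ^+ l * r - r ^+ l / r)).
Proof.
move=> /andP[x0 x1]; have xn1 : r != 1 by rewrite lt_eqF.
rewrite (layer_off hmu hlambda VsphE i V_spherical Y_sph (@grad_normal _) x0 xn1).
rewrite /V /W !grad_densityE /radial /growth -/r x1 -natr1 -/L.
have r0 : r != 0 by rewrite gt_eqF.
move: (eval (sgrad i Y) _) (eval Y _) (normalize x i ord0) => S Z z.
rewrite exprSr /coefV /coefVW; move: (r ^+ l) r r0 => p q q0.
have := gt_eqF (pi_gt0 R); move: (pi : R) => q' /negbT pi0.
by field; do ?[apply/andP; split]; rewrite ?pi0 ?mu0 ?lame0 ?lame0' ?L1 ?L3.
Qed.

Lemma V_out : 1 < r -> layer_integral mu lambda (Vsph l m) x i ord0 =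
  V * (coefV * (r ^+ l * r ^+ 2)^-1).
Proof.
move=> x1; have x0 : 0 < r by lra.
have xn1 : r != 1 by rewrite gt_eqF.
rewrite (layer_off hmu hlambda VsphE i V_spherical Y_sph (@grad_normal _) x0 xn1).
rewrite /V /W !grad_densityE /radial /growth -/r (le_gtF (ltW x1)) -natr1 -/L.
have r0 : r != 0 by rewrite gt_eqF.
have p0 : r ^+ l != 0 by rewrite expf_eq0 (negbTE r0) andbF.
move: (eval (sgrad i Y) _) (eval Y _) (normalize x i ord0) => S Z z.
rewrite !exprSr expr0 mul1r /coefV; move: p0; move: (r ^+ l) => p p0; move: r r0 => q q0.
have := gt_eqF (pi_gt0 R); move: (pi : R) => q' /negbT pi0.
by field; do ?[apply/andP; split]; rewrite ?pi0 ?mu0 ?lame0 ?lame0' ?L1 ?L3 ?p0 ?q0.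
Qed.

Lemma X_in : 0 < r < 1 -> layer_integral mu lambda (Xsph l m) x i ord0 =
  X * (coefX * r ^+ l).
Proof.
move=> /andP[x0 x1]; have xn1 : r != 1 by rewrite lt_eqF.
rewrite (layer_off hmu hlambda XsphE i X_spherical Y_sph curl_normal x0 xn1).
rewrite /X /radial /growth -/r x1 -/L /coefX.
move: (eval (curl_density i) _) (r ^+ l) => S p.
have := gt_eqF (pi_gt0 R); move: (pi : R) => q' /negbT pi0.
rewrite mul0r mulr0 subr0.
by field; do ?[apply/andP; split]; rewrite ?pi0 ?mu0 ?L1.
Qed.

Lemma X_out : 1 < r -> layer_integral mu lambda (Xsph l m) x i ord0 =
  X * (coefX * (r ^+ l * r)^-1).
Proof.
move=> x1; have x0 : 0 < r by lra.
have xn1 : r != 1 by rewrite gt_eqF.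
rewrite (layer_off hmu hlambda XsphE i X_spherical Y_sph curl_normal x0 xn1).
rewrite /X /radial /growth -/r (le_gtF (ltW x1)) -/L /coefX exprSr.
move: (eval (curl_density i) _) ((r ^+ l * r)^-1) => S p.
have := gt_eqF (pi_gt0 R); move: (pi : R) => q' /negbT pi0.
rewrite mul0r mulr0 subr0.
by field; do ?[apply/andP; split]; rewrite ?pi0 ?mu0 ?L1.
Qed.

Lemma W_in : 0 < r < 1 -> layer_integral mu lambda (Wsph l m) x i ord0 =
  W * (coefW * (r ^+ l / r)).
Proof.
move=> /andP[x0 x1]; have xn1 : r != 1 by rewrite lt_eqF.
rewrite (layer_off hmu hlambda WsphE i W_spherical Y_sph (@grad_normal _) x0 xn1) -/W.
have [l0|/prednK e] := posnP l.
  have L0 : L = 0 by rewrite /L l0.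
  by rewrite /W (W_degree0 l0) !L0; ring.
have eL : l.-1%:R = L - 1 by rewrite /L -e -natr1 addrK.
have L2 : 2 * L - 1 != 0.
  rewrite (_ : 2 * L - 1 = 2 * l.-1%:R + 1); last by rewrite eL; ring.
  by rewrite gt_eqF// ltr_wpDl// mulr_ge0.
have r0 : r != 0 by rewrite gt_eqF.
have er : r ^+ l = r ^+ l.-1 * r by rewrite -[in LHS]e exprSr.
have L2' : 2 * (L - 1) + 1 != 0 by rewrite (_ : 2 * (L - 1) + 1 = 2 * L - 1)//; ring.
rewrite /W !grad_densityE /radial /growth -/r x1 er eL -/L.
move: (eval (sgrad i Y) _) (eval Y _) (normalize x i ord0) => S Z z.
rewrite /coefW; move: (r ^+ l.-1) r r0 => p q q0.
have := gt_eqF (pi_gt0 R); move: (pi : R) => q' /negbT pi0.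
by field; do ?[apply/andP; split]; rewrite ?pi0 ?mu0 ?lame0 ?lame0' ?L1 ?L2 ?L2'.
Qed.

Lemma W_out : 1 < r -> layer_integral mu lambda (Wsph l m) x i ord0 =
  V * (coefWV * ((r ^+ l * r ^+ 2)^-1 - (r ^+ l)^-1)) + W * (coefW * (r ^+ l)^-1).
Proof.
move=> x1; have x0 : 0 < r by lra.
have xn1 : r != 1 by rewrite gt_eqF.
rewrite (layer_off hmu hlambda WsphE i W_spherical Y_sph (@grad_normal _) x0 xn1) -/W.
have [l0|/prednK e] := posnP l.
  have L0 : L = 0 by rewrite /L l0.
  by rewrite /W (W_degree0 l0) /coefWV !L0; ring.
have eL : l.-1%:R = L - 1 by rewrite /L -e -natr1 addrK.
have L2 : 2 * L - 1 != 0.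
  rewrite (_ : 2 * L - 1 = 2 * l.-1%:R + 1); last by rewrite eL; ring.
  by rewrite gt_eqF// ltr_wpDl// mulr_ge0.
have r0 : r != 0 by rewrite gt_eqF.
have p0 : r ^+ l != 0 by rewrite expf_eq0 (negbTE r0) andbF.
have L2' : 2 * (L - 1) + 1 != 0 by rewrite (_ : 2 * (L - 1) + 1 = 2 * L - 1)//; ring.
rewrite /V /W !grad_densityE /radial /growth -/r (le_gtF (ltW x1)) e eL -/L exprSr.
move: (eval (sgrad i Y) _) (eval Y _) (normalize x i ord0) => S Z z.
rewrite /coefW /coefWV; move: p0; move: (r ^+ l) => p p0; move: r r0 => q q0.
have := gt_eqF (pi_gt0 R); move: (pi : R) => q' /negbT pi0.
by field; do ?[apply/andP; split]; rewrite ?pi0 ?mu0 ?lame0 ?lame0' ?L1 ?L2 ?L2' ?p0 ?q0.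
Qed.

End off.
End vector_harmonics.

Section boundary_values.
Variable R : realType.
Variables (mu lambda : R) (hmu : 0 < mu) (hlambda : 0 < 2 * mu + 3 * lambda).
Variables (l : nat) (m : int) (hm : (`|m| <= l)%N).
Variables (w : 'cV[R]_3) (w1 : dot w w = 1) (i : 'I_3).

Let V := eval (grad_density l m (- (l%:R + 1)) i) w.
Let W := eval (grad_density l m l%:R i) w.
Let X := eval (curl_density R l m i) w.

Let ray r : 0 < r < 1 -> 0 < enorm (r *: w) < 1 /\ enorm (r *: w) = r /\ normalize (r *: w) = w.
Proof.
by move=> /andP[r0 r1]; rewrite enormZ1 ?ltW// normalizeZ// r0.
Qed.

Let cpow : {for 1, continuous (fun r : R => r ^+ l)}.
Proof. exact: exprn_continuous. Qed.

Let cinv : {for 1, continuous (fun r : R => r^-1)}.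
Proof. by apply: inv_continuous; exact: oner_neq0. Qed.

Lemma V_on : layer_integral mu lambda (Vsph l m) w i ord0 = V * coefV mu lambda l.
Proof.
rewrite (@layer_boundary R mu lambda _ _ (@VsphE R l m) w w1 i (fun r =>
  V * (coefV mu lambda l * (r ^+ l * r)) + W * (coefVW mu lambda l * (r ^+ l * r - r ^+ l / r)))).
- by rewrite !expr1n invr1 mulr1 subrr !mulr0 addr0 mulr1.
- apply: cvgD; (apply: cvgM; first exact: cvg_cst); apply: cvgM; (try exact: cvg_cst).
    exact: (cvgM cpow (@cvg_id _ _)).
  exact: (cvgB (cvgM cpow (@cvg_id _ _)) (cvgM cpow cinv)).
- by move=> r /ray[h [e1 e2]]; rewrite (V_in hmu hlambda l m i h) e1 e2.
Qed.

Lemma W_on : layer_integral mu lambda (Wsph l m) w i ord0 = W * coefW mu lambda l.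
Proof.
rewrite (@layer_boundary R mu lambda _ _ (@WsphE R l m) w w1 i (fun r =>
  W * (coefW mu lambda l * (r ^+ l / r)))).
- by rewrite !expr1n invr1 !mulr1.
- apply: cvgM; first exact: cvg_cst; apply: cvgM; first exact: cvg_cst.
  exact: (cvgM cpow cinv).
- by move=> r /ray[h [e1 e2]]; rewrite (W_in hmu hlambda hm i h) e1 e2.
Qed.

Lemma X_on : layer_integral mu lambda (Xsph l m) w i ord0 = X * coefX mu l.
Proof.
rewrite (@layer_boundary R mu lambda _ _ (@XsphE R l m) w w1 i (fun r =>
  X * (coefX mu l * r ^+ l))).
- by rewrite !expr1n !mulr1.
- by apply: cvgM; first exact: cvg_cst; apply: cvgM; first exact: cvg_cst.
- by move=> r /ray[h [e1 e2]]; rewrite (X_in hmu hlambda l m i h) e1 e2.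
Qed.

End boundary_values.

Section matrices.
Variable R : realType.
Implicit Types (l : nat) (m : int) (x y : 'cV[R]_3).

Lemma Ysph_cols l m : [/\ (fun y => col ix (Ysph l m y)) = @Vsph R l m,
  (fun y => col iy (Ysph l m y)) = @Wsph R l m & (fun y => col iz (Ysph l m y)) = @Xsph R l m].
Proof.
by split; apply/funext => y; apply/colP => i;
  rewrite /Ysph /cols3 [LHS]mxE [LHS]mxE ?val_ix ?val_iy ?val_iz.
Qed.

Lemma columnwise_Ysph mu lambda l m x i :
  [/\ columnwise (layer_integral mu lambda) (Ysph l m) x i ix =
        layer_integral mu lambda (Vsph l m) x i ord0,
      columnwise (layer_integral mu lambda) (Ysph l m) x i iy =
        layer_integral mu lambda (Wsph l m) x i ord0
    & columnwise (layer_integral mu lambda) (Ysph l m) x i iz =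
        layer_integral mu lambda (Xsph l m) x i ord0].
Proof.
have [h1 h2 h3] := Ysph_cols l m; rewrite -h1 -h2 -h3.
by split; rewrite [LHS]mxE.
Qed.

Lemma Ysph_mul l m x (M : 'M[R]_3) i j : dot x x = 1 -> (Ysph l m x *m M) i j =
  eval (grad_density l m (- (l%:R + 1)) i) x * M ix j + eval (grad_density l m l%:R i) x * M iy j
  + eval (curl_density R l m i) x * M iz j.
Proof.
move=> x1; rewrite mxE sum3; congr (_ * _ + _ * _ + _ * _).
- by rewrite -(VsphE l m x1) /Ysph /cols3 mxE val_ix.
- by rewrite -(WsphE l m x1) /Ysph /cols3 mxE val_iy.
- by rewrite -(XsphE l m x1) /Ysph /cols3 mxE val_iz.
Qed.

End matrices.

Theorem theorem5p1 (R : realType) (mu lambda : R)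
    (hmu : 0 < mu) (hlambda : 0 < 2 * mu + 3 * lambda)
    (l : nat) (m : int) (hm : (absz m <= l)%N) :
  [/\ forall x : 'cV[R]_3, enorm x = 1 ->
        columnwise (slbo mu lambda) (Ysph l m) x
        = Ysph l m x *m A_slbo mu lambda l,
      forall x : 'cV[R]_3, 0 < enorm x < 1 ->
        columnwise (slp mu lambda) (Ysph l m) x
        = Ysph l m (normalize x) *m A_slp_in mu lambda l x
    & forall x : 'cV[R]_3, 1 < enorm x ->
        columnwise (slp mu lambda) (Ysph l m) x
        = Ysph l m (normalize x) *m A_slp_out mu lambda l x].
Proof.
split=> x hx; apply/matrixP => i j; have [cV cW cX] := columnwise_Ysph mu lambda l m x i.
- have x1 := dot_sphere hx; rewrite Ysph_mul//.
  have [->|->|->] := ord3P j; rewrite /slbo ?cV ?cW ?cX.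
  + by rewrite V_on// /A_slbo /mx3 ![matrix_of_fun _ _ _ _]mxE val_ix val_iy val_iz /= !mulr0 !addr0.
  + by rewrite W_on// /A_slbo /mx3 ![matrix_of_fun _ _ _ _]mxE val_ix val_iy val_iz /= !mulr0 addr0 add0r.
  + rewrite X_on// /A_slbo /mx3 ![matrix_of_fun _ _ _ _]mxE val_ix val_iy val_iz /= !mulr0 !add0r.
    by rewrite /coefX [mu * _]mulrC.
- have /andP[x0 x1] := hx; rewrite Ysph_mul ?dot_normalize//.
  have p0 : enorm x != 0 by rewrite gt_eqF.
  have e1 : enorm x ^ (l%:Z + 1) = enorm x ^+ l * enorm x by rewrite expfzDr// -exprnP expr1z.
  have e2 : enorm x ^ (l%:Z - 1) = enorm x ^+ l / enorm x by rewrite expfzDr// -exprnP exprN1.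
  have e3 : enorm x ^ l%:Z = enorm x ^+ l by [].
  have [->|->|->] := ord3P j; rewrite /slp ?cV ?cW ?cX.
  + rewrite V_in// /A_slp_in /mx3 ![matrix_of_fun _ _ _ _]mxE val_ix val_iy val_iz /= e1 e2.
    by rewrite mulr0 addr0.
  + rewrite W_in// /A_slp_in /mx3 ![matrix_of_fun _ _ _ _]mxE val_ix val_iy val_iz /= e2.
    by rewrite !mulr0 addr0 add0r.
  + rewrite X_in// /A_slp_in /mx3 ![matrix_of_fun _ _ _ _]mxE val_ix val_iy val_iz /=.
    by rewrite !mulr0 !add0r.
- have x0 : 0 < enorm x by lra.
  rewrite Ysph_mul ?dot_normalize//.
  have p0 : enorm x != 0 by rewrite gt_eqF.
  have e1 : enorm x ^ (- l%:Z - 2) = (enorm x ^+ l * enorm x ^+ 2)^-1.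
    by rewrite -opprD -invr_expz expfzDr.
  have e2 : enorm x ^ (- l%:Z - 1) = (enorm x ^+ l * enorm x)^-1.
    by rewrite -opprD -invr_expz expfzDr// expr1z.
  have e3 : enorm x ^ (- l%:Z) = (enorm x ^+ l)^-1 by rewrite -invr_expz.
  have [->|->|->] := ord3P j; rewrite /slp ?cV ?cW ?cX.
  + rewrite V_out// /A_slp_out /mx3 ![matrix_of_fun _ _ _ _]mxE val_ix val_iy val_iz /= e1.
    by rewrite !mulr0 !addr0.
  + rewrite W_out// /A_slp_out /mx3 ![matrix_of_fun _ _ _ _]mxE val_ix val_iy val_iz /= e1 e3.
    by rewrite mulr0 addr0.
  + rewrite X_out// /A_slp_out /mx3 ![matrix_of_fun _ _ _ _]mxE val_ix val_iy val_iz /= e2.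
    by rewrite !mulr0 !add0r.
Qed.
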